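(* Let $0<\kappa<1$, $\lambda=\sqrt{1-\kappa^2}$. For $\phi$ near $0$ define $$u(\phi)=\int_0^{\phi} F\!\left(\tfrac14,\tfrac34;\tfrac12;\kappa^2\sin^2\theta\right)\,\mathrm{d}\theta ,$$ let $u\mapsto\phi(u)$ be the local inverse near $0$ with $\phi(0)=0$, let $\psi=\psi(u)$ be defined near $u=0$ with $\psi(0)=0$ and $\sin\psi=\kappa\sin\phi$, and let $d$ be the elliptic function extending $\cos\psi$. Let $2\omega$ and $2i\omega'$ ($\omega,\omega'>0$) be the fundamental periods of the (rectangular) period lattice of the Weierstrass function $\wp(\,\cdot\,;g_2,g_3)$ with $g_2=\tfrac43-\kappa^2$, $g_3=\tfrac{8}{27}-\tfrac13\kappa^2$. Then $d$ has a double pole at $i\omega'$ (and its poles are exactly the points congruent to $i\omega'$ modulo the lattice), and $d$ takes the value $-\lambda$ at $\omega+i\omega'$ and the value $\lambda$ at $\omega$, each with multiplicity two.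
   Context: $F(a,b;c;z)$ denotes the Gauss hypergeometric function ${}_2F_1(a,b;c;z)$. The function $\cos\psi$, defined near $u=0$, extends to an elliptic function $d$ on $\mathbb{C}$. $\wp(\cdot;g_2,g_3)$ is the Weierstrass function satisfying $(\wp')^2=4\wp^3-g_2\wp-g_3$ with a double pole at $0$. *)

(* Defs.v *)
From Stdlib Require Import Reals ZArith.
From Coquelicot Require Import Coquelicot.

Open Scope R_scope.

Fixpoint poch (a : R) (n : nat) : R :=
  match n with
  | O => 1
  | S k => poch a k * (a + INR k)
  end.

Definition hyp2F1 (a b c x : R) : R :=
  Series (fun n => poch a n * poch b n / (poch c n * INR (fact n)) * x ^ n).

Definition u_int (kappa phi : R) : R :=
  RInt (fun theta => hyp2F1 (1/4) (3/4) (1/2) (kappa ^ 2 * (sin theta) ^ 2)) 0 phi.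

Open Scope C_scope.

Fixpoint cpow (z : C) (n : nat) : C :=
  match n with
  | O => 1
  | S k => cpow z k * z
  end.

Definition C_derivable (f : C -> C) (z : C) : Prop :=
  ex_derive (K := C_AbsRing) (V := C_NormedModule) f z.

Definition holo_on_disc (f : C -> C) (z0 : C) (r : R) : Prop :=
  forall w, (Cmod (w - z0) < r)%R -> C_derivable f w.

(* z0 is a pole of f of order m (m >= 1): near z0, f w = g w / (w - z0)^m
   with g holomorphic and g z0 <> 0 (the value f z0 itself is irrelevant). *)
Definition pole_of_order (f : C -> C) (z0 : C) (m : nat) : Prop :=
  (0 < m)%nat /\
  exists r : R, (0 < r)%R /\ exists g : C -> C,
    holo_on_disc g z0 r /\ g z0 <> 0 /\
    forall w, (Cmod (w - z0) < r)%R -> w <> z0 -> f w = g w / cpow (w - z0) m.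

Definition meromorphic_with_poles (f : C -> C) (P : C -> Prop) : Prop :=
  (forall z, ~ P z -> exists r : R, (0 < r)%R /\
      forall w, (Cmod (w - z) < r)%R -> ~ P w /\ C_derivable f w) /\
  (forall z, P z -> (exists m, pole_of_order f z m) /\
      exists r : R, (0 < r)%R /\
        forall w, (Cmod (w - z) < r)%R -> w <> z -> ~ P w).

Definition is_period (f : C -> C) (P : C -> Prop) (w : C) : Prop :=
  forall z, (P z <-> P (z + w)) /\ (~ P z -> f (z + w) = f z).

(* f is elliptic: it has two R-linearly independent periods *)
Definition elliptic (f : C -> C) (P : C -> Prop) : Prop :=
  meromorphic_with_poles f P /\
  exists w1 w2 : C, is_period f P w1 /\ is_period f P w2 /\
    Im (w1 * Cconj w2) <> 0%R.

Definition value_with_mult (f : C -> C) (z0 a : C) (m : nat) : Prop :=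
  exists r : R, (0 < r)%R /\ exists g : C -> C,
    holo_on_disc g z0 r /\ g z0 <> 0 /\
    forall w, (Cmod (w - z0) < r)%R -> f w - a = cpow (w - z0) m * g w.

Definition weierstrass_p (g2 g3 : C) (wp : C -> C) (P : C -> Prop) : Prop :=
  meromorphic_with_poles wp P /\
  P 0 /\ pole_of_order wp 0 2 /\
  forall z, ~ P z -> exists dz : C,
    is_derive (K := C_AbsRing) (V := C_NormedModule) wp z dz /\
    dz * dz = 4 * cpow (wp z) 3 - g2 * wp z - g3.

Definition period_lattice_is (wp : C -> C) (P : C -> Prop) (om om' : R) : Prop :=
  forall w, is_period wp P w <->
    exists m n : Z, w = RtoC (2 * IZR m * om) + Ci * RtoC (2 * IZR n * om').

(* Main.v *)
(** Summing the hypergeometric series, whose value at z^2 is the even part of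
    (1-z)^(-1/2), turns du/dphi into an algebraic function of sin phi and cos phi,
    and d = cos psi satisfies d'^2 = 2 (1 - d) (d^2 - lambda^2) near 0 on the real line,
    hence near 0 in C. So (1 - d)/2 + e3 solves the Weierstrass equation with roots
    e1 = (1/3 + lambda)/2 > e2 = (1/3 - lambda)/2 > e3 = -1/3 and starts at the
    branch value e3. A nonconstant solution through a branch value, or through a
    pole (take reciprocals), is unique because both cases read s'^2 = s T(s) with
    T(0) <> 0, whose nonconstant solutions vanish to order exactly two. This
    uniqueness shows that the poles of wp are its periods, that wp is even and real,
    that it takes three different values among e1, e2, e3 at the half-periods, and,
    with the intermediate value theorem along the two axes, that
    wp(om) = e1 and wp(i om') = e3. Hence d(z) = 1/3 - 2 wp(z + i om'). *)

Require Import Defs.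
From Stdlib Require Import Reals ZArith Lra Lia Psatz Classical Ranalysis5.
From Coquelicot Require Import Coquelicot.

Open Scope R_scope.

(** The hypotheses give complex differentiability and nothing more. What drives the proof, that a
    holomorphic function either vanishes near a point or is [(w - z0)^n] times a factor that is
    nonzero at [z0], is therefore derived from Goursat's lemma on axis-parallel rectangles. The
    winding integral is never evaluated: it is divided out and only has to be nonzero. [wp] is given
    by its equation, a pole and its periods, and uniqueness replaces both the lattice sum and the
    counting of zeros in a period cell: a translation, reflection or conjugation that preserves the
    equation and a pole preserves [wp]. The Lipschitz argument for uniqueness fails at a branch
    value, where the square root is singular and the constant is a second solution; leading
    coefficients are compared instead. With d = 1 - 2 s the equation of [d] becomes s'^2 = 4 s (s -
    (1 - lambda)/2) (s - (1 + lambda)/2). Its roots have mean 1/3, and subtracting this mean removes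
    the quadratic term; this is the origin of e1, e2, e3. *)

(** * Complex derivatives and their rules *)

Definition cderiv (f : C -> C) (z l : C) : Prop :=
  is_derive (K := C_AbsRing) (V := C_NormedModule) f z l.

Definition ccontinuous (f : C -> C) (z : C) : Prop :=
  forall eps, 0 < eps -> exists del, 0 < del /\
    forall w, Cmod (w - z) < del -> Cmod (f w - f z) < eps.

(** [is_derive] quantifies over every limit of the filter [locally z]; the only such limit is [z]
    itself, so the condition collapses to one estimate. *)
Lemma cderiv_eps (f : C -> C) (z l : C) :
  cderiv f z l <->
  forall eps, 0 < eps -> exists del, 0 < del /\
    forall w, Cmod (w - z) < del ->
      Cmod (f w - f z - l * (w - z)) <= eps * Cmod (w - z).
Proof.
  split.
  - intros [_ H] eps Heps.
    assert (Hz : is_filter_lim (locally (T := AbsRing_UniformSpace C_AbsRing) z) (z : AbsRing_NormedModule C_AbsRing)) by (intros P HP; exact HP).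
    destruct (H z Hz (mkposreal eps Heps)) as [del Hdel].
    exists del; split; [apply cond_pos|].
    intros w Hw. specialize (Hdel w Hw).
    rewrite (Cmult_comm l). exact Hdel.
  - intros H; split.
    + apply (is_linear_scal_l (K := C_AbsRing) (V := C_NormedModule)).
    + intros x Hx eps.
      assert (z = x) as <-.
      { apply (is_filter_lim_locally_unique (K := C_AbsRing) (V := AbsRing_NormedModule C_AbsRing)). exact Hx. }
      destruct (H eps (cond_pos eps)) as [del [Hdel H']].
      exists (mkposreal del Hdel). intros w Hw. specialize (H' w Hw).
      rewrite (Cmult_comm l) in H'. exact H'.
Qed.

(** [C] carries two normed-module structures over itself. The rules for products and inner functions
    are stated for the one used here, the definitions of the theorem use the other; the components
    of both derivatives agree. *)
Lemma cderiv_absring (f : C -> C) (z l : C) :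
  cderiv f z l <-> is_derive (K := C_AbsRing) (V := AbsRing_NormedModule C_AbsRing) f z l.
Proof.
  split; intros [[A B D] E]; (split; [split|]); assumption.
Qed.

Lemma Cmod_minus_sym (a b : C) : Cmod (a - b) = Cmod (b - a).
Proof. rewrite <- Cmod_opp. f_equal. ring. Qed.

Lemma Cmod_self (a : C) : Cmod (a - a) = 0.
Proof. replace (a - a)%C with (RtoC 0) by ring. apply Cmod_0. Qed.

Lemma Cmod_triangle_minus (a b : C) : Cmod (a - b) <= Cmod a + Cmod b.
Proof. unfold Cminus. rewrite <- (Cmod_opp b). apply Cmod_triangle. Qed.

Lemma Cmod_triangle_rev (a b : C) : Cmod a - Cmod b <= Cmod (a - b).
Proof.
  pose proof (Cmod_triangle (a - b) b) as H.
  replace (a - b + b)%C with a in H by ring. lra.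
Qed.

Lemma Cmod_triangle3 (a b c : C) : Cmod (a - c) <= Cmod (a - b) + Cmod (b - c).
Proof.
  replace (a - c)%C with ((a - b) + (b - c))%C by ring. apply Cmod_triangle.
Qed.

Lemma cderiv_unique (f : C -> C) (z l1 l2 : C) : cderiv f z l1 -> cderiv f z l2 -> l1 = l2.
Proof.
  intros H1 H2. rewrite cderiv_eps in H1, H2.
  destruct (Ceq_dec l1 l2) as [E|E]; [exact E|exfalso].
  assert (Hp : 0 < Cmod (l1 - l2)) by (apply Cmod_gt_0; now apply Cminus_eq_contra).
  destruct (H1 (Cmod (l1 - l2) / 4)) as [d1 [Hd1 K1]]; [lra|].
  destruct (H2 (Cmod (l1 - l2) / 4)) as [d2 [Hd2 K2]]; [lra|].
  set (h := Rmin d1 d2 / 2).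
  assert (Hh : 0 < h) by (unfold h; apply Rdiv_lt_0_compat; [now apply Rmin_glb_lt|lra]).
  assert (Hh1 : h < d1) by (pose proof (Rmin_l d1 d2); unfold h in *; lra).
  assert (Hh2 : h < d2) by (pose proof (Rmin_r d1 d2); unfold h in *; lra).
  assert (Hm : Cmod (z + RtoC h - z) = h).
  { replace (z + RtoC h - z)%C with (RtoC h) by ring.
    rewrite Cmod_R, Rabs_right; lra. }
  specialize (K1 (z + RtoC h)%C). specialize (K2 (z + RtoC h)%C).
  rewrite Hm in K1, K2. specialize (K1 Hh1). specialize (K2 Hh2).
  assert (E2 : ((l1 - l2) * RtoC h = (f (z + RtoC h)%C - f z - l2 * (z + RtoC h - z)) - (f (z + RtoC h)%C - f z - l1 * (z + RtoC h - z)))%C) by ring.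
  apply (f_equal Cmod) in E2. rewrite Cmod_mult, Cmod_R, (Rabs_right h) in E2 by lra.
  pose proof (Cmod_triangle_minus (f (z + RtoC h)%C - f z - l2 * (z + RtoC h - z)) (f (z + RtoC h)%C - f z - l1 * (z + RtoC h - z))).
  nra.
Qed.

Lemma cderiv_const (c z : C) : cderiv (fun _ => c) z 0.
Proof. exact (is_derive_const (K := C_AbsRing) (V := C_NormedModule) c z). Qed.

Lemma cderiv_id (z : C) : cderiv (fun w => w) z 1.
Proof. apply cderiv_absring. exact (is_derive_id (K := C_AbsRing) z). Qed.

Lemma cderiv_eq (f : C -> C) (z l l' : C) : cderiv f z l -> l = l' -> cderiv f z l'.
Proof. intros H <-; exact H. Qed.

Lemma cderiv_plus (f g : C -> C) (z a b : C) :
  cderiv f z a -> cderiv g z b -> cderiv (fun w => f w + g w)%C z (a + b).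
Proof. exact (is_derive_plus (K := C_AbsRing) (V := C_NormedModule) f g z a b). Qed.

Lemma cderiv_opp (f : C -> C) (z a : C) : cderiv f z a -> cderiv (fun w => - f w)%C z (- a).
Proof. exact (is_derive_opp (K := C_AbsRing) (V := C_NormedModule) f z a). Qed.

Lemma cderiv_minus (f g : C -> C) (z a b : C) :
  cderiv f z a -> cderiv g z b -> cderiv (fun w => f w - g w)%C z (a - b).
Proof. intros; apply cderiv_plus; [|apply cderiv_opp]; assumption. Qed.

Lemma cderiv_mult (f g : C -> C) (z a b : C) :
  cderiv f z a -> cderiv g z b -> cderiv (fun w => f w * g w)%C z (a * g z + f z * b).
Proof.
  rewrite !cderiv_absring. intros Hf Hg.
  exact (is_derive_mult (K := C_AbsRing) f g z a b Hf Hg Cmult_comm).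
Qed.

Lemma cderiv_comp (f g : C -> C) (z a b : C) :
  cderiv f (g z) a -> cderiv g z b -> cderiv (fun w => f (g w)) z (b * a).
Proof.
  intros Hf Hg. apply cderiv_absring in Hg.
  exact (is_derive_comp (K := C_AbsRing) (V := C_NormedModule) f g z a b Hf Hg).
Qed.

Lemma cderiv_continuous (f : C -> C) (z l : C) : cderiv f z l -> ccontinuous f z.
Proof.
  rewrite cderiv_eps. intros H eps Heps.
  destruct (H 1 Rlt_0_1) as [d [Hd K]].
  pose proof (Cmod_ge_0 l) as Hl.
  (* The [+ 1] keeps the quotient meaningful when [l = 0]; the same device recurs in later
     estimates. *)
  exists (Rmin d (eps / (Cmod l + 1))). split.
  - apply Rmin_glb_lt; [assumption|apply Rdiv_lt_0_compat; lra].
  - intros w Hw.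
    assert (H1 : Cmod (w - z) < d) by (eapply Rlt_le_trans; [exact Hw|apply Rmin_l]).
    assert (H2 : Cmod (w - z) < eps / (Cmod l + 1)) by (eapply Rlt_le_trans; [exact Hw|apply Rmin_r]).
    specialize (K w H1).
    replace (f w - f z)%C with ((f w - f z - l * (w - z)) + l * (w - z))%C by ring.
    eapply Rle_lt_trans; [apply Cmod_triangle|]. rewrite Cmod_mult.
    apply Rmult_lt_compat_r with (r := Cmod l + 1) in H2; [|lra].
    unfold Rdiv in H2. rewrite Rmult_assoc, Rinv_l, Rmult_1_r in H2 by lra. lra.
Qed.

Lemma ccontinuous_neq0 (f : C -> C) (z : C) : ccontinuous f z -> f z <> 0 ->
  exists del, 0 < del /\ forall w, Cmod (w - z) < del -> Cmod (f z) / 2 < Cmod (f w).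
Proof.
  intros H Hz. apply Cmod_gt_0 in Hz.
  destruct (H (Cmod (f z) / 2)) as [d [Hd K]]; [lra|].
  exists d; split; [exact Hd|]. intros w Hw. specialize (K w Hw).
  pose proof (Cmod_triangle_rev (f z) (f z - f w)) as T.
  replace (f z - (f z - f w))%C with (f w) in T by ring.
  rewrite (Cmod_minus_sym (f z)) in T. lra.
Qed.

Lemma cderiv_ext_loc (f g : C -> C) (z l : C) (e : R) : 0 < e ->
  (forall w, Cmod (w - z) < e -> f w = g w) -> cderiv f z l -> cderiv g z l.
Proof.
  intros He H. apply is_derive_ext_loc. exists (mkposreal e He). intros y Hy. apply H. exact Hy.
Qed.

Lemma cderiv_Cinv (z : C) : z <> 0 -> cderiv Cinv z (- / (z * z)).
Proof.
  intros Hz. apply cderiv_eps. intros eps Heps.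
  pose proof (proj1 (Cmod_gt_0 z) Hz) as Hm. set (m := Cmod z) in *.
  exists (Rmin (m / 2) (eps * (m * m * m) / 2)). split.
  { apply Rmin_glb_lt; [lra|]. assert (0 < m * m * m) by (repeat apply Rmult_lt_0_compat; lra). nra. }
  intros w Hw.
  assert (H1 : Cmod (w - z) < m / 2) by (eapply Rlt_le_trans; [exact Hw|apply Rmin_l]).
  assert (H2 : Cmod (w - z) < eps * (m * m * m) / 2) by (eapply Rlt_le_trans; [exact Hw|apply Rmin_r]).
  assert (Hwm : m / 2 < Cmod w).
  { pose proof (Cmod_triangle_rev z (z - w)) as T.
    replace (z - (z - w))%C with w in T by ring. rewrite (Cmod_minus_sym z) in T.
    unfold m in *; lra. }
  assert (Hw0 : w <> 0) by (apply Cmod_gt_0; lra).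
  replace (/ w - / z - - / (z * z) * (w - z))%C with ((w - z) * ((w - z) * / (w * (z * z))))%C
    by (field; split; assumption).
  rewrite !Cmod_mult, Cmod_inv, !Cmod_mult by (repeat apply Cmult_neq_0; assumption).
  fold m. rewrite Rmult_comm. apply Rmult_le_compat_r; [apply Cmod_ge_0|].
  apply Rmult_le_reg_r with (Cmod w * (m * m)); [repeat apply Rmult_lt_0_compat; lra|].
  rewrite Rmult_assoc, Rinv_l, Rmult_1_r.
  2:{ apply Rgt_not_eq; repeat apply Rmult_lt_0_compat; lra. }
  apply Rle_trans with (eps * (m * m * m) / 2); [lra|].
  assert (0 < eps * (m * m)) by (repeat apply Rmult_lt_0_compat; lra). nra.
Qed.

Lemma cderiv_inv (f : C -> C) (z a : C) : f z <> 0 ->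
  cderiv f z a -> cderiv (fun w => / f w)%C z (- a / (f z * f z)).
Proof.
  intros Hz H. eapply cderiv_eq; [apply (cderiv_comp Cinv f); [apply cderiv_Cinv; exact Hz|exact H]|].
  field. exact Hz.
Qed.

Lemma cderiv_div (f g : C -> C) (z a b : C) : g z <> 0 ->
  cderiv f z a -> cderiv g z b ->
  cderiv (fun w => f w / g w)%C z ((a * g z - f z * b) / (g z * g z)).
Proof.
  intros Hz Hf Hg. eapply cderiv_eq; [apply cderiv_mult; [exact Hf|apply cderiv_inv; [exact Hz|exact Hg]]|].
  cbv beta. field. exact Hz.
Qed.

Lemma cpow_Cpow (z : C) (n : nat) : cpow z n = (z ^ n)%C.
Proof. induction n as [|n IH]; simpl; [reflexivity|]. rewrite IH. apply Cmult_comm. Qed.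

Lemma cderiv_pow (n : nat) (z a : C) : cderiv (fun w => (w - a) ^ S n)%C z (INR (S n) * (z - a) ^ n).
Proof.
  induction n as [|n IH].
  - simpl. eapply (cderiv_ext_loc (fun w => w - a)%C _ z _ 1); [lra|intros; ring|].
    eapply cderiv_eq; [apply cderiv_minus; [apply cderiv_id|apply cderiv_const]|]. ring.
  - apply (cderiv_ext_loc (fun w => (w - a) * (w - a) ^ S n)%C _ z _ 1); [lra|intros; reflexivity|].
    eapply cderiv_eq; [apply cderiv_mult; [apply cderiv_minus; [apply cderiv_id|apply cderiv_const]|exact IH]|].
    cbv beta. rewrite (S_INR (S n)), RtoC_plus, !Cpow_S. ring.
Qed.

(** Builds the derivative along the syntax of the function. Nonvanishing of denominators stays as a
    goal, and unknown functions are looked up in the context. *)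
Ltac auto_cderiv :=
  lazymatch goal with
  | |- cderiv (fun w => w) _ _ => apply cderiv_id
  | |- cderiv (fun _ => ?c) _ _ => apply cderiv_const
  | |- cderiv (fun w => Cplus (@?f w) (@?g w)) _ _ => apply (cderiv_plus f g); auto_cderiv
  | |- cderiv (fun w => Cminus (@?f w) (@?g w)) _ _ => apply (cderiv_minus f g); auto_cderiv
  | |- cderiv (fun w => Copp (@?f w)) _ _ => apply (cderiv_opp f); auto_cderiv
  | |- cderiv (fun w => Cmult (@?f w) (@?g w)) _ _ => apply (cderiv_mult f g); auto_cderiv
  | |- cderiv (fun w => Cdiv (@?f w) (@?g w)) _ _ => apply (cderiv_div f g); [|auto_cderiv|auto_cderiv]
  | |- cderiv (fun w => Cinv (@?f w)) _ _ => apply (cderiv_inv f); [|auto_cderiv]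
  | |- _ => try eassumption
  end.

(** * Integrals along segments *)
Definition CInt (f : R -> C) (a b : R) : C :=
  (RInt (fun t => fst (f t)) a b, RInt (fun t => snd (f t)) a b).

Definition ex_CInt (f : R -> C) (a b : R) : Prop :=
  ex_RInt (fun t => fst (f t)) a b /\ ex_RInt (fun t => snd (f t)) a b.

Definition path_continuous (f : R -> C) (t : R) : Prop :=
  forall eps, 0 < eps -> exists del, 0 < del /\
    forall s, Rabs (s - t) < del -> Cmod (f s - f t) < eps.

Lemma Cmod_fst (z : C) : Rabs (fst z) <= Cmod z.
Proof. eapply Rle_trans; [apply Rmax_l|apply Rmax_Cmod]. Qed.

Lemma Cmod_snd (z : C) : Rabs (snd z) <= Cmod z.
Proof. eapply Rle_trans; [apply Rmax_r|apply Rmax_Cmod]. Qed.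

Lemma Cmod_le_sum (z : C) : Cmod z <= Rabs (fst z) + Rabs (snd z).
Proof.
  destruct z as [x y].
  replace ((x, y) : C) with (RtoC x + Ci * RtoC y)%C by (apply injective_projections; simpl; ring).
  eapply Rle_trans; [apply Cmod_triangle|]. rewrite Cmod_mult, Cmod_Ci, !Cmod_R.
  apply Req_le. simpl. rewrite Rmult_1_l. f_equal; f_equal; ring.
Qed.

Lemma path_continuous_fst (f : R -> C) (t : R) : path_continuous f t -> continuous (fun s => fst (f s)) t.
Proof.
  intros H. apply continuity_pt_filterlim. intros eps Heps.
  destruct (H eps Heps) as [d [Hd K]]. exists d; split; [exact Hd|].
  intros s [_ Hs]. eapply Rle_lt_trans; [|apply (K s Hs)].
  exact (Cmod_fst (f s - f t)).
Qed.

Lemma path_continuous_snd (f : R -> C) (t : R) : path_continuous f t -> continuous (fun s => snd (f s)) t.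
Proof.
  intros H. apply continuity_pt_filterlim. intros eps Heps.
  destruct (H eps Heps) as [d [Hd K]]. exists d; split; [exact Hd|].
  intros s [_ Hs]. eapply Rle_lt_trans; [|apply (K s Hs)].
  exact (Cmod_snd (f s - f t)).
Qed.

Lemma ex_CInt_continuous (f : R -> C) (a b : R) :
  (forall t, Rmin a b <= t <= Rmax a b -> path_continuous f t) -> ex_CInt f a b.
Proof.
  intros H; split; apply (ex_RInt_continuous (V := R_CompleteNormedModule)); intros t Ht.
  - apply path_continuous_fst, H, Ht.
  - apply path_continuous_snd, H, Ht.
Qed.

Lemma CInt_ext (f g : R -> C) (a b : R) :
  (forall t, Rmin a b <= t <= Rmax a b -> f t = g t) -> CInt f a b = CInt g a b.
Proof.
  intros H. unfold CInt. f_equal; apply RInt_ext; intros t Ht; rewrite H; try reflexivity; lra.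
Qed.

Lemma CInt_plus (f g : R -> C) (a b : R) : ex_CInt f a b -> ex_CInt g a b ->
  CInt (fun t => f t + g t)%C a b = (CInt f a b + CInt g a b)%C.
Proof.
  intros [F1 F2] [G1 G2]. unfold CInt, Cplus; simpl. f_equal.
  - exact (RInt_plus (V := R_CompleteNormedModule) _ _ a b F1 G1).
  - exact (RInt_plus (V := R_CompleteNormedModule) _ _ a b F2 G2).
Qed.

Lemma CInt_scal (c : C) (f : R -> C) (a b : R) : ex_CInt f a b ->
  CInt (fun t => c * f t)%C a b = (c * CInt f a b)%C.
Proof.
  intros [F1 F2]. unfold CInt, Cmult; simpl. f_equal.
  - rewrite (RInt_minus (V := R_CompleteNormedModule) (fun t => fst c * fst (f t)) (fun t => snd c * snd (f t)));
      try (now apply (ex_RInt_scal (V := R_CompleteNormedModule))).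
    rewrite !(RInt_scal (V := R_CompleteNormedModule)); try assumption. reflexivity.
  - rewrite (RInt_plus (V := R_CompleteNormedModule) (fun t => fst c * snd (f t)) (fun t => snd c * fst (f t)));
      try (now apply (ex_RInt_scal (V := R_CompleteNormedModule))).
    rewrite !(RInt_scal (V := R_CompleteNormedModule)); try assumption. reflexivity.
Qed.

Lemma CInt_Chasles (f : R -> C) (a b c : R) : ex_CInt f a b -> ex_CInt f b c ->
  (CInt f a b + CInt f b c)%C = CInt f a c.
Proof.
  intros [F1 F2] [G1 G2]. unfold CInt, Cplus; simpl. f_equal.
  - exact (RInt_Chasles (V := R_CompleteNormedModule) _ a b c F1 G1).
  - exact (RInt_Chasles (V := R_CompleteNormedModule) _ a b c F2 G2).
Qed.

Lemma CInt_swap (f : R -> C) (a b : R) : ex_CInt f a b -> CInt f b a = (- CInt f a b)%C.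
Proof.
  intros [F1 F2]. unfold CInt, Copp; simpl. f_equal; symmetry;
  apply (opp_RInt_swap (V := R_CompleteNormedModule)); assumption.
Qed.

Lemma ex_CI_swap (f : R -> C) (a b : R) : ex_CInt f a b -> ex_CInt f b a.
Proof. intros [F1 F2]; split; now apply ex_RInt_swap. Qed.

(** The factor 2 comes from bounding real and imaginary part separately. It is harmless, since every
    use only needs some bound proportional to [M] and to the length. *)
Lemma CInt_bound (f : R -> C) (a b M : R) : ex_CInt f a b ->
  (forall t, Rmin a b <= t <= Rmax a b -> Cmod (f t) <= M) ->
  Cmod (CInt f a b) <= 2 * M * Rabs (b - a).
Proof.
  assert (W : forall a b, a <= b -> ex_CInt f a b ->
    (forall t, a <= t <= b -> Cmod (f t) <= M) ->
    Cmod (CInt f a b) <= 2 * M * (b - a)).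
  { clear a b; intros a b Hab [F1 F2] H.
    eapply Rle_trans; [apply Cmod_le_sum|]. simpl.
    assert (Rabs (RInt (fun t => fst (f t)) a b) <= (b - a) * M).
    { apply abs_RInt_le_const; try assumption. intros t Ht. eapply Rle_trans; [apply Cmod_fst|now apply H]. }
    assert (Rabs (RInt (fun t => snd (f t)) a b) <= (b - a) * M).
    { apply abs_RInt_le_const; try assumption. intros t Ht. eapply Rle_trans; [apply Cmod_snd|now apply H]. }
    lra. }
  intros F H. destruct (Rle_lt_dec a b) as [Hab|Hab].
  - rewrite Rabs_right by lra. rewrite Rmin_left, Rmax_right in H by lra. now apply W.
  - rewrite Rabs_left1 by lra. rewrite Rmin_right, Rmax_left in H by lra.
    apply ex_CI_swap in F. rewrite (CInt_swap f b a F), Cmod_opp.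
    replace (- (b - a)) with (a - b) by ring. apply W; try assumption; lra.
Qed.

(** The bounds [a] and [b] stay free instead of being normalised to 0 and 1: on a horizontal or
    vertical side the parameter is then the coordinate itself, and cutting a side is plain
    additivity of the integral. *)
Definition seg_int (f : C -> C) (p v : C) (a b : R) : C :=
  CInt (fun t => v * f (p + RtoC t * v)%C)%C a b.

Definition continuous_on_seg (f : C -> C) (p v : C) (a b : R) : Prop :=
  forall t, Rmin a b <= t <= Rmax a b -> ccontinuous f (p + RtoC t * v)%C.

Lemma path_continuous_seg (f : C -> C) (p v : C) (t : R) :
  ccontinuous f (p + RtoC t * v)%C -> path_continuous (fun s => v * f (p + RtoC s * v)%C)%C t.
Proof.
  intros H eps Heps. pose proof (Cmod_ge_0 v) as Hv.
  destruct (H (eps / (Cmod v + 1))) as [d [Hd K]]; [apply Rdiv_lt_0_compat; lra|].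
  exists (d / (Cmod v + 1)); split; [apply Rdiv_lt_0_compat; lra|].
  intros s Hs.
  replace (v * f (p + RtoC s * v)%C - v * f (p + RtoC t * v)%C)%C
    with (v * (f (p + RtoC s * v)%C - f (p + RtoC t * v)%C))%C by ring.
  rewrite Cmod_mult.
  assert (Cmod (f (p + RtoC s * v)%C - f (p + RtoC t * v)%C) < eps / (Cmod v + 1)).
  { apply K. replace (p + RtoC s * v - (p + RtoC t * v))%C with (RtoC (s - t) * v)%C
      by (rewrite RtoC_minus; ring).
    rewrite Cmod_mult, Cmod_R.
    apply Rmult_lt_compat_r with (r := Cmod v + 1) in Hs; [|lra].
    unfold Rdiv in Hs. rewrite Rmult_assoc, Rinv_l, Rmult_1_r in Hs by lra.
    pose proof (Rabs_pos (s - t)). nra. }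
  apply Rmult_lt_compat_r with (r := Cmod v + 1) in H0; [|lra].
  unfold Rdiv in H0. rewrite Rmult_assoc, Rinv_l, Rmult_1_r in H0 by lra.
  pose proof (Cmod_ge_0 (f (p + RtoC s * v)%C - f (p + RtoC t * v)%C)). nra.
Qed.

Lemma ex_CInt_seg (f : C -> C) (p v : C) (a b : R) : continuous_on_seg f p v a b ->
  ex_CInt (fun t => v * f (p + RtoC t * v)%C)%C a b.
Proof. intros H. apply ex_CInt_continuous. intros t Ht. apply path_continuous_seg, H, Ht. Qed.

Lemma cderiv_along_line (F : C -> C) (p v l : C) (t : R) : cderiv F (p + RtoC t * v)%C l ->
  is_derive (fun s => fst (F (p + RtoC s * v)%C)) t (fst (v * l)%C) /\
  is_derive (fun s => snd (F (p + RtoC s * v)%C)) t (snd (v * l)%C).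
Proof.
  intros H. rewrite cderiv_eps in H. pose proof (Cmod_ge_0 v) as Hv.
  assert (K : forall eps, 0 < eps -> exists del, 0 < del /\ forall s, Rabs (s - t) < del ->
    Cmod (F (p + RtoC s * v)%C - F (p + RtoC t * v)%C - RtoC (s - t) * (v * l)) <= eps * Rabs (s - t)).
  { intros eps Heps. destruct (H (eps / (Cmod v + 1))) as [d [Hd K]]; [apply Rdiv_lt_0_compat; lra|].
    exists (d / (Cmod v + 1)); split; [apply Rdiv_lt_0_compat; lra|].
    intros s Hs. specialize (K (p + RtoC s * v)%C).
    assert (E : (p + RtoC s * v - (p + RtoC t * v))%C = (RtoC (s - t) * v)%C)
      by (rewrite RtoC_minus; ring).
    rewrite E, Cmod_mult, Cmod_R in K.
    replace (RtoC (s - t) * (v * l))%C with (l * (RtoC (s - t) * v))%C by ring.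
    eapply Rle_trans; [apply K|].
    - apply Rmult_lt_compat_r with (r := Cmod v + 1) in Hs; [|lra].
      unfold Rdiv in Hs. rewrite Rmult_assoc, Rinv_l, Rmult_1_r in Hs by lra.
      pose proof (Rabs_pos (s - t)). nra.
    - pose proof (Rabs_pos (s - t)).
      replace (eps / (Cmod v + 1) * (Rabs (s - t) * Cmod v))
        with (eps * Rabs (s - t) * (Cmod v / (Cmod v + 1))) by (field; lra).
      rewrite <- (Rmult_1_r (eps * Rabs (s - t))) at 2.
      apply Rmult_le_compat_l; [nra|]. apply Rle_div_l; lra. }
  split; apply is_derive_Reals; intros eps Heps;
    (destruct (K (eps / 2)) as [d [Hd K']]; [lra|]);
    exists (mkposreal d Hd); intros h Hh0 Hh; simpl in Hh;
    (specialize (K' (t + h)); replace (t + h - t) with h in K' by ring; specialize (K' Hh));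
    (assert (Hp : 0 < Rabs h) by now apply Rabs_pos_lt).
  - pose proof (Cmod_fst (F (p + RtoC (t + h) * v)%C - F (p + RtoC t * v)%C - RtoC h * (v * l))) as T.
    match goal with |- Rabs ?e < _ => replace e with
      (fst (F (p + RtoC (t + h) * v)%C - F (p + RtoC t * v)%C - RtoC h * (v * l))%C / h)
      by (simpl; field; exact Hh0) end.
    rewrite Rabs_div by exact Hh0. apply Rlt_div_l; [exact Hp|]. nra.
  - pose proof (Cmod_snd (F (p + RtoC (t + h) * v)%C - F (p + RtoC t * v)%C - RtoC h * (v * l))) as T.
    match goal with |- Rabs ?e < _ => replace e with
      (snd (F (p + RtoC (t + h) * v)%C - F (p + RtoC t * v)%C - RtoC h * (v * l))%C / h)
      by (simpl; field; exact Hh0) end.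
    rewrite Rabs_div by exact Hh0. apply Rlt_div_l; [exact Hp|]. nra.
Qed.

Lemma seg_int_primitive (F f : C -> C) (p v : C) (a b : R) :
  continuous_on_seg f p v a b ->
  (forall t, Rmin a b <= t <= Rmax a b -> cderiv F (p + RtoC t * v)%C (f (p + RtoC t * v)%C)) ->
  seg_int f p v a b = (F (p + RtoC b * v)%C - F (p + RtoC a * v)%C)%C.
Proof.
  intros Hc Hd. unfold seg_int, CInt. apply injective_projections.
  - apply (is_RInt_unique (V := R_CompleteNormedModule)).
    apply (is_RInt_derive (V := R_CompleteNormedModule) (fun s => fst (F (p + RtoC s * v)%C))).
    + intros t Ht. apply cderiv_along_line. apply Hd, Ht.
    + intros t Ht. apply (path_continuous_fst (fun s => v * f (p + RtoC s * v)%C)%C), path_continuous_seg, Hc, Ht.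
  - apply (is_RInt_unique (V := R_CompleteNormedModule)).
    apply (is_RInt_derive (V := R_CompleteNormedModule) (fun s => snd (F (p + RtoC s * v)%C))).
    + intros t Ht. apply cderiv_along_line. apply Hd, Ht.
    + intros t Ht. apply (path_continuous_snd (fun s => v * f (p + RtoC s * v)%C)%C), path_continuous_seg, Hc, Ht.
Qed.

Lemma seg_int_plus (f g : C -> C) (p v : C) (a b : R) : continuous_on_seg f p v a b -> continuous_on_seg g p v a b ->
  seg_int (fun w => f w + g w)%C p v a b = (seg_int f p v a b + seg_int g p v a b)%C.
Proof.
  intros Hf Hg. unfold seg_int. rewrite <- CInt_plus by now apply ex_CInt_seg.
  apply CInt_ext. intros; ring.
Qed.

Lemma seg_int_scal (c : C) (f : C -> C) (p v : C) (a b : R) : continuous_on_seg f p v a b ->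
  seg_int (fun w => c * f w)%C p v a b = (c * seg_int f p v a b)%C.
Proof.
  intros Hf. unfold seg_int. rewrite <- CInt_scal by now apply ex_CInt_seg.
  apply CInt_ext. intros; ring.
Qed.

Lemma seg_int_ext (f g : C -> C) (p v : C) (a b : R) :
  (forall t, Rmin a b <= t <= Rmax a b -> f (p + RtoC t * v)%C = g (p + RtoC t * v)%C) ->
  seg_int f p v a b = seg_int g p v a b.
Proof. intros H. apply CInt_ext. intros t Ht. now rewrite H. Qed.

Lemma seg_int_bound (f : C -> C) (p v : C) (a b M : R) : continuous_on_seg f p v a b ->
  (forall t, Rmin a b <= t <= Rmax a b -> Cmod (f (p + RtoC t * v)%C) <= M) ->
  Cmod (seg_int f p v a b) <= 2 * (Cmod v * M) * Rabs (b - a).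
Proof.
  intros Hf H. apply CInt_bound; [now apply ex_CInt_seg|].
  intros t Ht. rewrite Cmod_mult. apply Rmult_le_compat_l; [apply Cmod_ge_0|now apply H].
Qed.

(** * Goursat and Cauchy on rectangles *)
(* Signed: the sides may be traversed backwards ([b < a] or [d < c]), so that a corner can be put first. *)
Definition rect_int (f : C -> C) (a b c d : R) : C :=
  (seg_int f (0%R, c) 1 a b - seg_int f (0%R, d) 1 a b
   + seg_int f (b, 0%R) Ci c d - seg_int f (a, 0%R) Ci c d)%C.

Definition in_rect (a b c d : R) (w : C) : Prop :=
  Rmin a b <= fst w <= Rmax a b /\ Rmin c d <= snd w <= Rmax c d.

Definition on_rect_bd (a b c d : R) (w : C) : Prop :=
  in_rect a b c d w /\ (fst w = a \/ fst w = b \/ snd w = c \/ snd w = d).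

Definition continuous_on_bd (f : C -> C) (a b c d : R) : Prop :=
  forall w, on_rect_bd a b c d w -> ccontinuous f w.

Lemma continuous_on_bd_of_rect (f : C -> C) (a b c d : R) :
  (forall w, in_rect a b c d w -> ccontinuous f w) -> continuous_on_bd f a b c d.
Proof. intros H w [Hw _]. now apply H. Qed.

Lemma horizontal_point (t c : R) : ((0%R, c) + RtoC t * 1)%C = (t, c).
Proof. apply injective_projections; simpl; ring. Qed.

Lemma vertical_point (t a : R) : ((a, 0%R) + RtoC t * Ci)%C = (a, t).
Proof. apply injective_projections; simpl; ring. Qed.

Ltac minmax := unfold in_rect, Rmin, Rmax in *; simpl in *;
  repeat match goal with
  | |- context [Rle_dec ?a ?b] => destruct (Rle_dec a b)
  | H : context [Rle_dec ?a ?b] |- _ => destruct (Rle_dec a b)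
  end; try lra.

Lemma continuous_on_seg_h (f : C -> C) (a b c : R) :
  (forall t, Rmin a b <= t <= Rmax a b -> ccontinuous f (t, c)) -> continuous_on_seg f (0%R, c) 1 a b.
Proof. intros H t Ht. rewrite horizontal_point. now apply H. Qed.

Lemma continuous_on_seg_v (f : C -> C) (a c d : R) :
  (forall t, Rmin c d <= t <= Rmax c d -> ccontinuous f (a, t)) -> continuous_on_seg f (a, 0%R) Ci c d.
Proof. intros H t Ht. rewrite vertical_point. now apply H. Qed.

Ltac solve_bd := split; [minmax | simpl; tauto].
Ltac solve_seg H := solve [first [apply continuous_on_seg_h | apply continuous_on_seg_v]; intros; apply H; first [solve_bd | minmax]].

Lemma rect_int_plus (f g : C -> C) (a b c d : R) : continuous_on_bd f a b c d -> continuous_on_bd g a b c d ->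
  rect_int (fun w => f w + g w)%C a b c d = (rect_int f a b c d + rect_int g a b c d)%C.
Proof.
  intros Hf Hg. unfold rect_int.
  rewrite !seg_int_plus; try (solve_seg Hf); try (solve_seg Hg). ring.
Qed.

Lemma rect_int_scal (k : C) (f : C -> C) (a b c d : R) : continuous_on_bd f a b c d ->
  rect_int (fun w => k * f w)%C a b c d = (k * rect_int f a b c d)%C.
Proof. intros Hf. unfold rect_int. rewrite !seg_int_scal; try (solve_seg Hf). ring. Qed.

Lemma rect_int_ext (f g : C -> C) (a b c d : R) :
  (forall t, Rmin a b <= t <= Rmax a b -> f (t, c) = g (t, c) /\ f (t, d) = g (t, d)) ->
  (forall t, Rmin c d <= t <= Rmax c d -> f (a, t) = g (a, t) /\ f (b, t) = g (b, t)) ->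
  rect_int f a b c d = rect_int g a b c d.
Proof.
  intros Hh Hv. unfold rect_int.
  rewrite (seg_int_ext f g (0%R, c)), (seg_int_ext f g (0%R, d)), (seg_int_ext f g (b, 0%R)), (seg_int_ext f g (a, 0%R));
  [reflexivity| | | |]; intros t Ht; rewrite ?horizontal_point, ?vertical_point; first [now apply Hh | now apply Hv].
Qed.

Lemma rect_int_primitive (F f : C -> C) (a b c d : R) : continuous_on_bd f a b c d ->
  (forall w, on_rect_bd a b c d w -> cderiv F w (f w)) -> rect_int f a b c d = 0.
Proof.
  intros Hc Hd. unfold rect_int.
  rewrite !(seg_int_primitive F f); try (solve_seg Hc).
  - rewrite !horizontal_point, !vertical_point. ring.
  - intros; rewrite vertical_point; apply Hd; solve_bd.
  - intros; rewrite vertical_point; apply Hd; solve_bd.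
  - intros; rewrite horizontal_point; apply Hd; solve_bd.
  - intros; rewrite horizontal_point; apply Hd; solve_bd.
Qed.

Lemma rect_int_bound (f : C -> C) (a b c d M : R) : continuous_on_bd f a b c d ->
  (forall w, on_rect_bd a b c d w -> Cmod (f w) <= M) ->
  Cmod (rect_int f a b c d) <= 4 * M * (Rabs (b - a) + Rabs (d - c)).
Proof.
  intros Hc HM. unfold rect_int.
  assert (H1 : Cmod (seg_int f (0%R, c) 1 a b) <= 2 * (Cmod 1 * M) * Rabs (b - a)).
  { apply seg_int_bound; [solve_seg Hc|]. intros; rewrite horizontal_point; apply HM; solve_bd. }
  assert (H2 : Cmod (seg_int f (0%R, d) 1 a b) <= 2 * (Cmod 1 * M) * Rabs (b - a)).
  { apply seg_int_bound; [solve_seg Hc|]. intros; rewrite horizontal_point; apply HM; solve_bd. }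
  assert (H3 : Cmod (seg_int f (b, 0%R) Ci c d) <= 2 * (Cmod Ci * M) * Rabs (d - c)).
  { apply seg_int_bound; [solve_seg Hc|]. intros; rewrite vertical_point; apply HM; solve_bd. }
  assert (H4 : Cmod (seg_int f (a, 0%R) Ci c d) <= 2 * (Cmod Ci * M) * Rabs (d - c)).
  { apply seg_int_bound; [solve_seg Hc|]. intros; rewrite vertical_point; apply HM; solve_bd. }
  rewrite Cmod_1 in H1, H2. rewrite Cmod_Ci in H3, H4.
  eapply Rle_trans; [apply Cmod_triangle_minus|].
  eapply Rle_trans; [apply Rplus_le_compat_r, Cmod_triangle|].
  eapply Rle_trans; [apply Rplus_le_compat_r, Rplus_le_compat_r, Cmod_triangle_minus|].
  lra.
Qed.

Lemma seg_int_Chasles (f : C -> C) (p v : C) (a b c : R) : continuous_on_seg f p v a b -> continuous_on_seg f p v b c ->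
  (seg_int f p v a b + seg_int f p v b c)%C = seg_int f p v a c.
Proof. intros H1 H2. apply CInt_Chasles; now apply ex_CInt_seg. Qed.

Lemma seg_int_swap (f : C -> C) (p v : C) (a b : R) : continuous_on_seg f p v a b ->
  seg_int f p v b a = (- seg_int f p v a b)%C.
Proof. intros H. apply CInt_swap; now apply ex_CInt_seg. Qed.

Lemma rect_int_split_h (f : C -> C) (a m b c d : R) :
  continuous_on_bd f a m c d -> continuous_on_bd f m b c d ->
  rect_int f a b c d = (rect_int f a m c d + rect_int f m b c d)%C.
Proof.
  intros H1 H2. unfold rect_int.
  rewrite <- (seg_int_Chasles f (0%R, c) 1 a m b), <- (seg_int_Chasles f (0%R, d) 1 a m b);
    try (solve_seg H1); try (solve_seg H2). ring.
Qed.

Lemma rect_int_split_v (f : C -> C) (a b c m d : R) :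
  continuous_on_bd f a b c m -> continuous_on_bd f a b m d ->
  rect_int f a b c d = (rect_int f a b c m + rect_int f a b m d)%C.
Proof.
  intros H1 H2. unfold rect_int.
  rewrite <- (seg_int_Chasles f (b, 0%R) Ci c m d), <- (seg_int_Chasles f (a, 0%R) Ci c m d);
    try (solve_seg H1); try (solve_seg H2). ring.
Qed.

Lemma rect_int_swap_h (f : C -> C) (a b c d : R) : continuous_on_bd f a b c d ->
  rect_int f b a c d = (- rect_int f a b c d)%C.
Proof.
  intros H. unfold rect_int. rewrite (seg_int_swap f (0%R, c) 1 a b), (seg_int_swap f (0%R, d) 1 a b); try (solve_seg H).
  ring.
Qed.

Lemma rect_int_swap_v (f : C -> C) (a b c d : R) : continuous_on_bd f a b c d ->
  rect_int f a b d c = (- rect_int f a b c d)%C.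
Proof.
  intros H. unfold rect_int. rewrite (seg_int_swap f (a, 0%R) Ci c d), (seg_int_swap f (b, 0%R) Ci c d); try (solve_seg H).
  ring.
Qed.

(** The affine part has a primitive, so its integral along the closed boundary is zero. The
    remainder is at most [eps] times the diameter, itself bounded by the sum of the sides, and the
    length of the path gives the second factor. *)
Lemma rect_int_near_affine (f : C -> C) (a b c d : R) (p l : C) (eps : R) :
  a <= b -> c <= d -> 0 < eps -> continuous_on_bd f a b c d -> in_rect a b c d p ->
  (forall w, in_rect a b c d w -> Cmod (f w - f p - l * (w - p)) <= eps * Cmod (w - p)) ->
  Cmod (rect_int f a b c d) <= 4 * eps * (b - a + (d - c)) ^ 2.
Proof.
  intros Hab Hcd Heps Hc Hp H.
  set (g := fun w => (f p + l * (w - p))%C).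
  assert (Hgd : forall w, cderiv g w l).
  { intros w. eapply cderiv_eq.
    - unfold g; auto_cderiv.
    - cbv beta. ring. }
  assert (Hg : continuous_on_bd g a b c d) by (intros w _; eapply cderiv_continuous; apply Hgd).
  assert (Hg1 : continuous_on_bd (fun w => -(1) * g w)%C a b c d).
  { intros w _. pose proof (Hgd w). eapply cderiv_continuous. auto_cderiv. }
  assert (Hfg : continuous_on_bd (fun w => f w + -(1) * g w)%C a b c d).
  { intros w Hw eps' Heps'.
    destruct (Hc w Hw (eps' / 2)) as [d1 [Hd1 K1]]; [lra|].
    destruct (Hg1 w Hw (eps' / 2)) as [d2 [Hd2 K2]]; [lra|].
    exists (Rmin d1 d2); split; [now apply Rmin_glb_lt|]. intros u Hu.
    specialize (K1 u (Rlt_le_trans _ _ _ Hu (Rmin_l _ _))).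
    specialize (K2 u (Rlt_le_trans _ _ _ Hu (Rmin_r _ _))).
    replace (f u + - (1) * g u - (f w + - (1) * g w))%C with
      ((f u - f w) + (-(1) * g u - -(1) * g w))%C by ring.
    eapply Rle_lt_trans; [apply Cmod_triangle|lra]. }
  assert (E : rect_int f a b c d = rect_int (fun w => f w + -(1) * g w)%C a b c d).
  { rewrite rect_int_plus, rect_int_scal by assumption.
    rewrite (rect_int_primitive (fun w => f p * (w - p) + l / 2 * ((w - p) * (w - p)))%C g); [ring|exact Hg|].
    intros w _. eapply cderiv_eq.
    - auto_cderiv.
    - unfold g. field. }
  rewrite E.
  eapply Rle_trans.
  - apply (rect_int_bound _ a b c d (eps * (b - a + (d - c)))); [exact Hfg|].
    intros w [Hw _]. unfold g. replace (f w + - (1) * (f p + l * (w - p)))%C with (f w - f p - l * (w - p))%C by ring.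
    eapply Rle_trans; [apply H, Hw|]. apply Rmult_le_compat_l; [lra|].
    eapply Rle_trans; [apply Cmod_le_sum|]. simpl.
    apply Rplus_le_compat; apply Rabs_le; minmax.
  - rewrite !Rabs_right by lra. apply Req_le. ring.
Qed.

(** * Bisection of a rectangle *)

Section Bisection.

Variables (f : C -> C) (a c h k : R).

Let Q (x y : R) (n : nat) : C := rect_int f x (x + h / 2 ^ n) y (y + k / 2 ^ n).

(** Only the lower left corner is recorded, because the sides at level [n] are [h / 2 ^ n] and
    [k / 2 ^ n]. A quarter carrying at least a fourth of the integral is selected; the last one
    needs no test, since the four integrals add up to the whole. *)
Fixpoint bisect (n : nat) : R * R :=
  match n with
  | O => (a, c)
  | S n =>
    let (x, y) := bisect n in
    let h' := h / 2 ^ S n in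
    let k' := k / 2 ^ S n in
    if Rle_dec (Cmod (Q x y n)) (4 * Cmod (Q x y (S n))) then (x, y)
    else if Rle_dec (Cmod (Q x y n)) (4 * Cmod (Q (x + h') y (S n))) then (x + h', y)
    else if Rle_dec (Cmod (Q x y n)) (4 * Cmod (Q x (y + k') (S n))) then (x, y + k')
    else (x + h', y + k')
  end.

Hypothesis Hh : 0 < h.
Hypothesis Hk : 0 < k.
Hypothesis Hf : forall w, in_rect a (a + h) c (c + k) w -> ccontinuous f w.

Lemma half_pow (x : R) (n : nat) : x / 2 ^ n = x / 2 ^ S n + x / 2 ^ S n.
Proof. simpl. field. apply pow_nonzero; lra. Qed.

Lemma bisect_inv (n : nat) :
  let (x, y) := bisect n in
  a <= x /\ x + h / 2 ^ n <= a + h /\ c <= y /\ y + k / 2 ^ n <= c + k /\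
  Cmod (Q a c 0) <= 4 ^ n * Cmod (Q x y n).
Proof.
  induction n as [|n IH].
  - simpl. repeat split; try lra.
  - simpl bisect. destruct (bisect n) as [x y] eqn:E.
    destruct IH as [I1 [I2 [I3 [I4 I5]]]].
    pose proof (half_pow h n) as Eh. pose proof (half_pow k n) as Ek.
    assert (P : 0 < 2 ^ S n) by (apply pow_lt; lra).
    assert (Ph : 0 < h / 2 ^ S n) by now apply Rdiv_lt_0_compat.
    assert (Pk : 0 < k / 2 ^ S n) by now apply Rdiv_lt_0_compat.
    assert (P4 : 0 < 4 ^ n) by (apply pow_lt; lra).
    change (h / (2 * 2 ^ n)) with (h / 2 ^ S n). change (k / (2 * 2 ^ n)) with (k / 2 ^ S n).
    assert (Split : Q x y n = (Q x y (S n) + Q (x + h / 2 ^ S n) y (S n) +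
      (Q x (y + k / 2 ^ S n) (S n) + Q (x + h / 2 ^ S n) (y + k / 2 ^ S n) (S n)))%C).
    { unfold Q. rewrite Eh, Ek, <- !Rplus_assoc.
      rewrite (rect_int_split_v f x _ y (y + k / 2 ^ S n)) by (intros w [Hw _]; apply Hf; minmax).
      rewrite (rect_int_split_h f x (x + h / 2 ^ S n) _ y) by (intros w [Hw _]; apply Hf; minmax).
      rewrite (rect_int_split_h f x (x + h / 2 ^ S n) _ (y + k / 2 ^ S n)) by (intros w [Hw _]; apply Hf; minmax).
      reflexivity. }
    change (4 ^ S n) with (4 * 4 ^ n).
    assert (Cmod (Q x y n) <= Cmod (Q x y (S n)) + Cmod (Q (x + h / 2 ^ S n) y (S n)) +
      (Cmod (Q x (y + k / 2 ^ S n) (S n)) + Cmod (Q (x + h / 2 ^ S n) (y + k / 2 ^ S n) (S n)))).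
    { rewrite Split. eapply Rle_trans; [apply Cmod_triangle|].
      apply Rplus_le_compat; apply Cmod_triangle. }
    assert (G : forall q, Cmod (Q x y n) <= 4 * q -> Cmod (Q a c 0) <= 4 * 4 ^ n * q).
    { intros q Hq. eapply Rle_trans; [exact I5|].
      rewrite (Rmult_comm 4), Rmult_assoc. apply Rmult_le_compat_l; lra. }
    (* In the branch without a test, the three failed comparisons and the triangle inequality above
       force the fourth quarter to be large enough. *)
    repeat match goal with |- context [Rle_dec ?u ?v] => destruct (Rle_dec u v) end;
      (repeat split; try lra); apply G; lra.
Qed.

Lemma bisect_mono (n m : nat) : (n <= m)%nat ->
  fst (bisect n) <= fst (bisect m) /\ fst (bisect m) + h / 2 ^ m <= fst (bisect n) + h / 2 ^ n /\
  snd (bisect n) <= snd (bisect m) /\ snd (bisect m) + k / 2 ^ m <= snd (bisect n) + k / 2 ^ n.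
Proof.
  induction 1 as [|m _ IH]; [repeat split; lra|].
  simpl bisect. destruct (bisect m) as [x y] eqn:E. simpl in IH.
  pose proof (half_pow h m) as Eh. pose proof (half_pow k m) as Ek.
  assert (P : 0 < 2 ^ S m) by (apply pow_lt; lra).
  assert (Ph : 0 < h / 2 ^ S m) by now apply Rdiv_lt_0_compat.
  assert (Pk : 0 < k / 2 ^ S m) by now apply Rdiv_lt_0_compat.
  change (h / (2 * 2 ^ m)) with (h / 2 ^ S m). change (k / (2 * 2 ^ m)) with (k / 2 ^ S m).
  repeat match goal with |- context [Rle_dec ?u ?v] => destruct (Rle_dec u v) end;
    cbn [fst snd]; repeat split; lra.
Qed.

End Bisection.

(** The supremum of the left ends works: comparing at the larger of two indices shows that every
    left end lies below every right end. *)
Lemma nested_point (x : nat -> R) (s : nat -> R) :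
  (forall n m, (n <= m)%nat -> x n <= x m /\ x m + s m <= x n + s n) ->
  (forall n, 0 <= s n) ->
  exists p, forall n, x n <= p <= x n + s n.
Proof.
  intros H Hs.
  destruct (completeness (fun r => exists n, r = x n)) as [p [Hp1 Hp2]].
  - exists (x O + s O). intros r [n ->].
    destruct (H O n) as [_ H2]; [lia|]. pose proof (Hs n). lra.
  - exists (x O), O; reflexivity.
  - exists p. intros n; split.
    + apply Hp1. now exists n.
    + apply Hp2. intros r [m ->].
      destruct (H m (Nat.max m n)) as [A1 A2]; [lia|].
      destruct (H n (Nat.max m n)) as [B1 B2]; [lia|].
      pose proof (Hs (Nat.max m n)). lra.
Qed.

Lemma pow2_small (s del : R) : 0 <= s -> 0 < del -> exists n, s / 2 ^ n < del.
Proof.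
  intros Hs Hd.
  destruct (Pow_x_infinity 2) with (b := s / del + 1) as [n Hn].
  - rewrite Rabs_right; lra.
  - exists n. specialize (Hn n (le_n n)).
    assert (P : 0 < 2 ^ n) by (apply pow_lt; lra).
    rewrite Rabs_right in Hn by lra.
    apply Rlt_div_l; [exact P|].
    assert (s / del < 2 ^ n) by lra. apply Rlt_div_l in H; [|exact Hd]. lra.
Qed.

Lemma goursat_pos (f : C -> C) (a c h k : R) : 0 < h -> 0 < k ->
  (forall w, in_rect a (a + h) c (c + k) w -> exists l, cderiv f w l) ->
  rect_int f a (a + h) c (c + k) = 0.
Proof.
  intros Hh Hk Hd.
  assert (Hc : forall w, in_rect a (a + h) c (c + k) w -> ccontinuous f w).
  { intros w Hw. destruct (Hd w Hw) as [l Hl]. eapply cderiv_continuous, Hl. }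
  assert (P2 : forall n, 0 < 2 ^ n) by (intros; apply pow_lt; lra).
  assert (Ph : forall n, 0 < h / 2 ^ n) by (intros; now apply Rdiv_lt_0_compat).
  assert (Pk : forall n, 0 < k / 2 ^ n) by (intros; now apply Rdiv_lt_0_compat).
  destruct (nested_point (fun n => fst (bisect f a c h k n)) (fun n => h / 2 ^ n)) as [px Hpx].
  { intros n m L. destruct (bisect_mono f a c h k Hh Hk n m L) as [? [? _]]; split; assumption. }
  { intros n. now left. }
  destruct (nested_point (fun n => snd (bisect f a c h k n)) (fun n => k / 2 ^ n)) as [py Hpy].
  { intros n m L. destruct (bisect_mono f a c h k Hh Hk n m L) as [_ [_ ?]]; assumption. }
  { intros n. now left. }
  set (p := (px, py) : C).
  destruct (Ceq_dec (rect_int f a (a + h) c (c + k)) 0) as [E|E]; [exact E|exfalso].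
  apply Cmod_gt_0 in E. set (M := Cmod (rect_int f a (a + h) c (c + k))) in *.
  assert (Hp : in_rect a (a + h) c (c + k) p).
  { pose proof (Hpx O) as H1. pose proof (Hpy O) as H2. simpl in H1, H2.
    unfold p. rewrite Rdiv_1_r in H1, H2. minmax. }
  destruct (Hd p Hp) as [l Hl]. rewrite cderiv_eps in Hl.
  (* Chosen so that [4 ^ n] times the bound [4 * eps * ((h + k) / 2 ^ n) ^ 2] equals [M / 2],
     independently of [n]; this contradicts [0 < M]. *)
  set (eps := M / (8 * (h + k) ^ 2)).
  assert (Hs : 0 < (h + k) ^ 2) by (apply pow_lt; lra).
  assert (Heps : 0 < eps) by (apply Rdiv_lt_0_compat; lra).
  destruct (Hl eps Heps) as [del [Hdel K]].
  destruct (pow2_small (h + k) del) as [n Hn]; [lra|lra|].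
  pose proof (bisect_inv f a c h k Hh Hk Hc n) as I.
  specialize (Hpx n). specialize (Hpy n). cbv beta in Hpx, Hpy.
  destruct (bisect f a c h k n) as [x y]. simpl fst in Hpx. simpl snd in Hpy.
  destruct I as [I1 [I2 [I3 [I4 I5]]]].
  change (2 ^ 0) with 1 in I5. rewrite !Rdiv_1_r in I5. fold M in I5.
  assert (B : Cmod (rect_int f x (x + h / 2 ^ n) y (y + k / 2 ^ n)) <=
    4 * eps * (x + h / 2 ^ n - x + (y + k / 2 ^ n - y)) ^ 2).
  { pose proof (Ph n); pose proof (Pk n).
    apply rect_int_near_affine with (p := p) (l := l); try lra.
    - intros w [Hw _]; apply Hc; minmax.
    - unfold p; minmax.
    - intros w Hw. apply K. eapply Rle_lt_trans; [|exact Hn].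
      eapply Rle_trans; [apply Cmod_le_sum|]. simpl.
      replace ((h + k) / 2 ^ n) with (h / 2 ^ n + k / 2 ^ n) by (field; apply pow_nonzero; lra).
      apply Rplus_le_compat; apply Rabs_le; minmax. }
  replace (x + h / 2 ^ n - x + (y + k / 2 ^ n - y)) with ((h + k) / 2 ^ n) in B
    by (field; apply pow_nonzero; lra).
  assert (E4 : 4 ^ n = 2 ^ n * 2 ^ n) by (rewrite <- Rpow_mult_distr; f_equal; ring).
  assert (P4 : 0 < 4 ^ n) by (apply pow_lt; lra).
  assert (M <= M / 2); [|lra].
  eapply Rle_trans; [exact I5|].
  eapply Rle_trans; [apply Rmult_le_compat_l; [lra|exact B]|].
  apply Req_le. rewrite E4. unfold eps. field. repeat split; try lra; apply pow_nonzero; lra.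
Qed.

Lemma rect_int_degenerate_h (f : C -> C) (a c d : R) : rect_int f a a c d = 0.
Proof.
  unfold rect_int, seg_int, CInt. rewrite !(RInt_point (V := R_CompleteNormedModule)).
  apply injective_projections; simpl; ring.
Qed.

Lemma rect_int_degenerate_v (f : C -> C) (a b c : R) : rect_int f a b c c = 0.
Proof.
  unfold rect_int, seg_int, CInt. rewrite !(RInt_point (V := R_CompleteNormedModule)).
  apply injective_projections; simpl; ring.
Qed.

Lemma goursat (f : C -> C) (a b c d : R) :
  (forall w, in_rect a b c d w -> exists l, cderiv f w l) -> rect_int f a b c d = 0.
Proof.
  intros Hd.
  assert (Hc : forall w, in_rect a b c d w -> ccontinuous f w).
  { intros w Hw. destruct (Hd w Hw) as [l Hl]. eapply cderiv_continuous, Hl. }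
  assert (W : forall a b c d, a < b -> c < d ->
    (forall w, in_rect a b c d w -> exists l, cderiv f w l) -> rect_int f a b c d = 0).
  { clear. intros a b c d Hab Hcd Hd.
    replace b with (a + (b - a)) in * by ring. replace d with (c + (d - c)) in * by ring.
    apply goursat_pos; try lra. exact Hd. }
  destruct (Rtotal_order a b) as [Hab|[<-|Hab]]; [|apply rect_int_degenerate_h|];
  (destruct (Rtotal_order c d) as [Hcd|[<-|Hcd]]; [|apply rect_int_degenerate_v|]).
  - now apply W.
  - rewrite rect_int_swap_v, W; try lra; [ring| |]; [intros w Hw; apply Hd|intros w [Hw _]; apply Hc]; minmax.
  - rewrite rect_int_swap_h, W; try lra; [ring| |]; [intros w Hw; apply Hd|intros w [Hw _]; apply Hc]; minmax.
  - rewrite rect_int_swap_h, rect_int_swap_v, W; try lra; [ring| | |];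
    [intros w Hw; apply Hd|intros w [Hw _]; apply Hc|intros w [Hw _]; apply Hc]; minmax.
Qed.

(** For cutting off a corner, whatever the orientation: the first piece stays close to [a], the
    second avoids [a]. *)
Lemma between_split (a b eta : R) : 0 < eta < 1 -> a <> b ->
  let m := a + eta * (b - a) in
  (forall t, Rmin a m <= t <= Rmax a m -> Rmin a b <= t <= Rmax a b /\ Rabs (t - a) <= eta * Rabs (b - a)) /\
  (forall t, Rmin m b <= t <= Rmax m b -> Rmin a b <= t <= Rmax a b /\ t <> a).
Proof.
  intros Heta Hab m. unfold m. destruct (Rtotal_order a b) as [L|[L|L]]; [|contradiction|].
  - rewrite (Rabs_right (b - a)) by lra. rewrite (Rmin_left a b), (Rmax_right a b) by lra.
    split; intros t Ht; rewrite Rmin_left, Rmax_right in Ht by nra; (split; [nra|]).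
    + rewrite Rabs_right; nra.
    + nra.
  - rewrite (Rabs_left (b - a)) by lra. rewrite (Rmin_right a b), (Rmax_left a b) by lra.
    split; intros t Ht; rewrite Rmin_right, Rmax_left in Ht by nra; (split; [nra|]).
    + rewrite Rabs_left1; nra.
    + nra.
Qed.

(** A small rectangle at the corner is cut off. Goursat's lemma kills the rest, where [f] is
    differentiable, and continuity bounds [f] on the small piece, whose perimeter tends to zero. *)
Lemma goursat_corner (f : C -> C) (a b c d : R) :
  (forall w, in_rect a b c d w -> ccontinuous f w) ->
  (forall w, in_rect a b c d w -> w <> (a, c) -> exists l, cderiv f w l) ->
  rect_int f a b c d = 0.
Proof.
  intros Hc Hd.
  destruct (Req_dec a b) as [->|Hab]; [apply rect_int_degenerate_h|].
  destruct (Req_dec c d) as [->|Hcd]; [apply rect_int_degenerate_v|].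
  assert (Hz : in_rect a b c d (a, c)) by minmax.
  destruct (Hc _ Hz 1 Rlt_0_1) as [del [Hdel K]].
  set (s := Rabs (b - a) + Rabs (d - c)).
  assert (Hs : 0 < s).
  { unfold s. pose proof (Rabs_pos (d - c)). assert (0 < Rabs (b - a)) by (apply Rabs_pos_lt; lra). lra. }
  set (M := Cmod (f (a, c)) + 1).
  assert (HM : 0 < M) by (unfold M; pose proof (Cmod_ge_0 (f (a, c))); lra).
  assert (B : forall eta, 0 < eta < 1 -> eta * s < del -> Cmod (rect_int f a b c d) <= 4 * M * (eta * s)).
  { intros eta Heta Hsm.
    destruct (between_split a b eta Heta Hab) as [X1 X2].
    destruct (between_split c d eta Heta Hcd) as [Y1 Y2].
    set (m := a + eta * (b - a)) in *. set (n := c + eta * (d - c)) in *.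
    assert (Em : Rmin a m <= m <= Rmax a m) by minmax.
    assert (En : Rmin c n <= n <= Rmax c n) by minmax.
    assert (Z1 : rect_int f m b c d = 0).
    { apply goursat. intros w [Hw1 Hw2]. destruct (X2 _ Hw1) as [? N]. apply Hd; [split; assumption|].
      intros ->; now apply N. }
    assert (Z2 : rect_int f a m n d = 0).
    { apply goursat. intros w [Hw1 Hw2]. destruct (Y2 _ Hw2) as [? N]. apply Hd; [|intros ->; now apply N].
      split; [|assumption]. now apply X1. }
    rewrite (rect_int_split_h f a m b), Z1, (rect_int_split_v f a m c n d), Z2, !Cplus_0_r.
    - assert (Hin : forall w, on_rect_bd a m c n w -> in_rect a b c d w /\ Cmod (w - (a, c)%R) < del).
      { intros w [[Hw1 Hw2] _]. destruct (X1 _ Hw1) as [P1 Q1]. destruct (Y1 _ Hw2) as [P2 Q2].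
        split; [split; assumption|].
        eapply Rle_lt_trans; [apply Cmod_le_sum|]. eapply Rle_lt_trans; [|exact Hsm].
        unfold s. rewrite Rmult_plus_distr_l. apply Rplus_le_compat; assumption. }
      eapply Rle_trans; [apply (rect_int_bound f a m c n M)|].
      + intros w Hw. apply Hc. now apply Hin.
      + intros w Hw. destruct (Hin w Hw) as [_ L]. specialize (K w L).
        pose proof (Cmod_triangle_rev (f w) (f w - f (a, c))) as T.
        replace (f w - (f w - f (a, c)))%C with (f (a, c)) in T by ring.
        unfold M. pose proof (Cmod_triangle (f w - f (a, c)) (f (a, c))) as T2.
        replace (f w - f (a, c) + f (a, c))%C with (f w) in T2 by ring. lra.
      + unfold m, n. replace (a + eta * (b - a) - a) with (eta * (b - a)) by ring.
        replace (c + eta * (d - c) - c) with (eta * (d - c)) by ring.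
        rewrite !Rabs_mult, (Rabs_right eta) by lra. unfold s. apply Req_le; ring.
    - apply continuous_on_bd_of_rect. intros w [Hw1 Hw2]. apply Hc. split; [now apply X1|now apply Y1].
    - apply continuous_on_bd_of_rect. intros w [Hw1 Hw2]. apply Hc. split; [now apply X1|now apply Y2].
    - apply continuous_on_bd_of_rect. intros w [Hw1 Hw2]. apply Hc. split; [now apply X1|assumption].
    - apply continuous_on_bd_of_rect. intros w [Hw1 Hw2]. apply Hc. split; [now apply X2|assumption]. }
  destruct (Ceq_dec (rect_int f a b c d) 0) as [E|E]; [exact E|exfalso].
  apply Cmod_gt_0 in E. set (D := Cmod (rect_int f a b c d)) in *.
  (* The three bounds make [eta] a proper fraction, keep the small rectangle within [del] of the
     corner, and push [4 * M * (eta * s)] down to [D / 2]. *)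
  set (eta := Rmin (1 / 2) (Rmin (del / (2 * s)) (D / (8 * M * s)))).
  assert (P1 : 0 < del / (2 * s)) by (apply Rdiv_lt_0_compat; lra).
  assert (P2 : 0 < D / (8 * M * s)) by (apply Rdiv_lt_0_compat; [lra|repeat apply Rmult_lt_0_compat; lra]).
  assert (E1 : 0 < eta) by (unfold eta; repeat apply Rmin_glb_lt; lra).
  assert (E2 : eta <= 1 / 2) by apply Rmin_l.
  assert (E3 : eta <= del / (2 * s)) by (eapply Rle_trans; [apply Rmin_r|apply Rmin_l]).
  assert (E4 : eta <= D / (8 * M * s)) by (eapply Rle_trans; [apply Rmin_r|apply Rmin_r]).
  apply Rmult_le_compat_r with (r := s) in E3; [|lra].
  replace (del / (2 * s) * s) with (del / 2) in E3 by (field; lra).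
  apply Rmult_le_compat_r with (r := 4 * M * s) in E4; [|repeat apply Rmult_le_pos; lra].
  replace (D / (8 * M * s) * (4 * M * s)) with (D / 2) in E4 by (field; lra).
  specialize (B eta). assert (D <= D / 2); [|lra].
  eapply Rle_trans; [apply B; lra|]. lra.
Qed.

(** Cutting through [z] gives four rectangles with [z] as a corner. Reversing sides puts that corner
    first in each of them, which is why [rect_int] is signed. *)
Lemma goursat_point (f : C -> C) (a b c d : R) (z : C) :
  in_rect a b c d z ->
  (forall w, in_rect a b c d w -> ccontinuous f w) ->
  (forall w, in_rect a b c d w -> w <> z -> exists l, cderiv f w l) ->
  rect_int f a b c d = 0.
Proof.
  destruct z as [x y]. intros [Hx Hy] Hc Hd. simpl in Hx, Hy.
  assert (W : forall b' d', Rmin a b <= b' <= Rmax a b -> Rmin c d <= d' <= Rmax c d ->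
    (forall w, in_rect x b' y d' w -> in_rect a b c d w)).
  { intros b' d' H1 H2 w [Hw1 Hw2]. revert H1 H2 Hw1 Hw2. clear - Hx Hy. split; minmax. }
  assert (Z : forall b' d', Rmin a b <= b' <= Rmax a b -> Rmin c d <= d' <= Rmax c d ->
    rect_int f x b' y d' = 0).
  { intros b' d' H1 H2. pose proof (W b' d' H1 H2).
    apply goursat_corner; intros w Hw; [apply Hc|apply Hd]; now apply H. }
  assert (Ha : Rmin a b <= a <= Rmax a b) by minmax.
  assert (Hb : Rmin a b <= b <= Rmax a b) by minmax.
  assert (Hc' : Rmin c d <= c <= Rmax c d) by minmax.
  assert (Hd' : Rmin c d <= d <= Rmax c d) by minmax.
  assert (CC : forall a' b' c' d', Rmin a b <= a' <= Rmax a b -> Rmin a b <= b' <= Rmax a b ->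
    Rmin c d <= c' <= Rmax c d -> Rmin c d <= d' <= Rmax c d -> continuous_on_bd f a' b' c' d').
  { intros a' b' c' d' H1 H2 H3 H4. apply continuous_on_bd_of_rect. intros w [Hw1 Hw2]. apply Hc.
    split; [clear - H1 H2 Hw1|clear - H3 H4 Hw2]; minmax. }
  rewrite (rect_int_split_h f a x b) by (apply CC; assumption).
  rewrite (rect_int_split_v f a x c y d), (rect_int_split_v f x b c y d) by (apply CC; assumption).
  rewrite (rect_int_swap_h f x a c y), (rect_int_swap_v f x a y c), (rect_int_swap_h f x a y d), (rect_int_swap_v f x b y c)
    by (apply CC; assumption).
  rewrite !Z by assumption. ring.
Qed.

(** Cauchy's formula with the constant left as an integral. It expresses that the difference
    quotient of [f] at [z] integrates to zero. *)
Lemma cauchy_rect_int (f : C -> C) (a b c d : R) (z : C) :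
  a < fst z < b -> c < snd z < d ->
  (forall w, in_rect a b c d w -> exists l, cderiv f w l) ->
  rect_int (fun w => f w * / (w - z))%C a b c d = (f z * rect_int (fun w => / (w - z))%C a b c d)%C.
Proof.
  intros Hx Hy Hd.
  assert (Hz : in_rect a b c d z) by minmax.
  destruct (Hd z Hz) as [l Hl].
  (* The value [l] at [z] makes the quotient continuous there; differentiability is claimed only
     elsewhere, which is what [goursat_point] asks for. *)
  set (g := fun w => if Ceq_dec w z then l else ((f w - f z) * / (w - z))%C).
  assert (Hg : forall w, in_rect a b c d w -> w <> z -> exists l, cderiv g w l).
  { intros w Hw Hwz. destruct (Hd w Hw) as [l' Hl'].
    assert (Hm : (w - z)%C <> 0) by now apply Cminus_eq_contra.
    eexists. eapply (cderiv_ext_loc (fun w => (f w - f z) * / (w - z))%C g w _ (Cmod (w - z))).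
    - now apply Cmod_gt_0.
    - intros u Hu. unfold g. destruct (Ceq_dec u z) as [->|]; [|reflexivity].
      rewrite Cmod_minus_sym in Hu. lra.
    - auto_cderiv. exact Hm. }
  assert (G0 : rect_int g a b c d = 0).
  { apply (goursat_point g a b c d z Hz); [|exact Hg].
    intros w Hw. destruct (Ceq_dec w z) as [->|Hwz].
    - intros eps Heps. rewrite cderiv_eps in Hl. destruct (Hl (eps / 2)) as [del [Hdel K]]; [lra|].
      exists del; split; [exact Hdel|]. intros u Hu. specialize (K u Hu). unfold g.
      destruct (Ceq_dec z z) as [_|N]; [|contradiction].
      destruct (Ceq_dec u z) as [->|Huz]; [rewrite Cmod_self; lra|].
      assert (Hm : (u - z)%C <> 0) by now apply Cminus_eq_contra.
      replace ((f u - f z) * / (u - z) - l)%C with ((f u - f z - l * (u - z)) * / (u - z))%C by (field; exact Hm).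
      rewrite Cmod_mult, Cmod_inv by exact Hm. apply Cmod_gt_0 in Hm.
      apply Rmult_lt_reg_r with (Cmod (u - z)); [exact Hm|].
      rewrite Rmult_assoc, Rinv_l, Rmult_1_r by lra. nra.
    - destruct (Hg w Hw Hwz) as [l' Hl']. eapply cderiv_continuous, Hl'. }
  assert (Hbz : forall w, on_rect_bd a b c d w -> (w - z)%C <> 0).
  { intros w [_ Hw] E. assert (w = z) as -> by (apply Ceq_minus; exact E). lra. }
  assert (Hi : forall w, on_rect_bd a b c d w -> cderiv (fun w => / (w - z))%C w (- (1 - 0) / ((w - z) * (w - z)))).
  { intros w Hw. auto_cderiv. now apply Hbz. }
  assert (H1 : continuous_on_bd (fun w => f w * / (w - z))%C a b c d).
  { intros w Hw. destruct (Hd w (proj1 Hw)) as [l' Hl']. pose proof (Hi w Hw).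
    eapply cderiv_continuous. apply (cderiv_mult f (fun w => / (w - z))%C); eassumption. }
  assert (H2 : continuous_on_bd (fun w => / (w - z))%C a b c d) by (intros w Hw; eapply cderiv_continuous, Hi, Hw).
  assert (H3 : continuous_on_bd (fun w => - f z * / (w - z))%C a b c d).
  { intros w Hw. pose proof (Hi w Hw). eapply cderiv_continuous. auto_cderiv. now apply Hbz. }
  assert (E : rect_int g a b c d = rect_int (fun w => f w * / (w - z) + - f z * / (w - z))%C a b c d).
  { assert (P : forall w, on_rect_bd a b c d w -> g w = (f w * / (w - z) + - f z * / (w - z))%C).
    { intros w Hw. unfold g. destruct (Ceq_dec w z) as [->|Hwz].
      - destruct (Hbz _ Hw). ring.
      - ring. }
    apply rect_int_ext; intros t Ht; split; apply P; solve_bd. }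
  rewrite G0, rect_int_plus, rect_int_scal in E by assumption.
  apply Ceq_minus. rewrite E. ring.
Qed.

(** * Differentiation of Cauchy integrals in the parameter *)

Lemma seg_bounded (f : C -> C) (p v : C) (a b : R) : a <= b -> continuous_on_seg f p v a b ->
  exists M, 0 <= M /\ forall t, a <= t <= b -> Cmod (f (p + RtoC t * v)%C) <= M.
Proof.
  intros Hab Hf.
  destruct (continuity_ab_maj (fun t => Cmod (f (p + RtoC t * v)%C)) a b Hab) as [t0 [H0 _]].
  - intros t Ht eps Heps. unfold continuous_on_seg in Hf. rewrite Rmin_left, Rmax_right in Hf by lra.
    destruct (Hf t Ht eps Heps) as [d [Hd K]]. pose proof (Cmod_ge_0 v).
    exists (d / (Cmod v + 1)); split; [apply Rdiv_lt_0_compat; lra|].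
    intros s [_ Hs]. unfold dist in *; simpl in *. unfold Rdist in *.
    assert (L : Cmod (p + RtoC s * v - (p + RtoC t * v)) < d).
    { replace (p + RtoC s * v - (p + RtoC t * v))%C with (RtoC (s - t) * v)%C
        by (rewrite RtoC_minus; ring).
      rewrite Cmod_mult, Cmod_R.
      apply Rmult_lt_compat_r with (r := Cmod v + 1) in Hs; [|lra].
      unfold Rdiv in Hs. rewrite Rmult_assoc, Rinv_l, Rmult_1_r in Hs by lra.
      pose proof (Rabs_pos (s - t)). nra. }
    specialize (K _ L). eapply Rle_lt_trans; [|exact K].
    apply Rabs_le. split.
    + pose proof (Cmod_triangle_rev (f (p + RtoC t * v)%C) (f (p + RtoC s * v)%C)) as T.
      rewrite Cmod_minus_sym in T. lra.
    + apply Cmod_triangle_rev.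
  - exists (Cmod (f (p + RtoC t0 * v)%C)). split; [apply Cmod_ge_0|]. exact H0.
Qed.

Lemma rect_bounded (f : C -> C) (a b c d : R) : a <= b -> c <= d -> continuous_on_bd f a b c d ->
  exists M, 0 <= M /\ forall w, on_rect_bd a b c d w -> Cmod (f w) <= M.
Proof.
  intros Hab Hcd Hf.
  destruct (seg_bounded f (0%R, c) 1 a b Hab) as [M1 [P1 H1]]; [solve_seg Hf|].
  destruct (seg_bounded f (0%R, d) 1 a b Hab) as [M2 [P2 H2]]; [solve_seg Hf|].
  destruct (seg_bounded f (a, 0%R) Ci c d Hcd) as [M3 [P3 H3]]; [solve_seg Hf|].
  destruct (seg_bounded f (b, 0%R) Ci c d Hcd) as [M4 [P4 H4]]; [solve_seg Hf|].
  exists (M1 + M2 + M3 + M4). split; [lra|].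
  intros [x y] [[Hx Hy] Hw]. simpl in *. rewrite Rmin_left, Rmax_right in Hx, Hy by lra.
  destruct Hw as [-> | [-> | [-> | ->]]].
  - specialize (H3 y Hy). rewrite vertical_point in H3. lra.
  - specialize (H4 y Hy). rewrite vertical_point in H4. lra.
  - specialize (H1 x Hx). rewrite horizontal_point in H1. lra.
  - specialize (H2 x Hx). rewrite horizontal_point in H2. lra.
Qed.

(** Differentiation under the integral sign. A remainder that is quadratic in [u - z], uniformly
    along the boundary, stays quadratic after integration over a path of finite length. *)
Lemma rect_int_param (F : C -> C -> C) (F' : C -> C) (a b c d : R) (z : C) (eta K : R) :
  0 < eta -> 0 <= K ->
  (forall u, Cmod (u - z) < eta -> continuous_on_bd (F u) a b c d) -> continuous_on_bd F' a b c d ->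
  (forall u w, Cmod (u - z) < eta -> on_rect_bd a b c d w ->
    Cmod (F u w - F z w - (u - z) * F' w) <= K * Cmod (u - z) ^ 2) ->
  cderiv (fun u => rect_int (F u) a b c d) z (rect_int F' a b c d).
Proof.
  intros Heta HK HF HF' H. apply cderiv_eps. intros eps Heps.
  set (S := 4 * K * (Rabs (b - a) + Rabs (d - c))).
  assert (HS : 0 <= S).
  { unfold S. pose proof (Rabs_pos (b - a)); pose proof (Rabs_pos (d - c)).
    repeat apply Rmult_le_pos; lra. }
  exists (Rmin eta (eps / (S + 1))). split; [apply Rmin_glb_lt; [lra|apply Rdiv_lt_0_compat; lra]|].
  intros u Hu.
  assert (Hu1 : Cmod (u - z) < eta) by (eapply Rlt_le_trans; [exact Hu|apply Rmin_l]).
  assert (Hu2 : Cmod (u - z) < eps / (S + 1)) by (eapply Rlt_le_trans; [exact Hu|apply Rmin_r]).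
  assert (Hz : Cmod (z - z) < eta) by (rewrite Cmod_self; lra).
  pose proof (HF u Hu1) as Cu. pose proof (HF z Hz) as Cz.
  assert (scal_cont : forall k g, continuous_on_bd g a b c d -> continuous_on_bd (fun w => k * g w)%C a b c d).
  { intros k g Hg w Hw eps' Heps'. pose proof (Cmod_ge_0 k).
    destruct (Hg w Hw (eps' / (Cmod k + 1))) as [dl [Hdl L]]; [apply Rdiv_lt_0_compat; lra|].
    exists dl; split; [exact Hdl|]. intros y Hy. specialize (L y Hy).
    replace (k * g y - k * g w)%C with (k * (g y - g w))%C by ring. rewrite Cmod_mult.
    apply Rmult_lt_compat_r with (r := Cmod k + 1) in L; [|lra].
    unfold Rdiv in L. rewrite Rmult_assoc, Rinv_l, Rmult_1_r in L by lra.
    pose proof (Cmod_ge_0 (g y - g w)). nra. }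
  assert (plus_cont : forall f g, continuous_on_bd f a b c d -> continuous_on_bd g a b c d ->
    continuous_on_bd (fun w => f w + g w)%C a b c d).
  { intros f g Hf Hg w Hw eps' Heps'.
    destruct (Hf w Hw (eps' / 2)) as [d1 [Hd1 K1]]; [lra|].
    destruct (Hg w Hw (eps' / 2)) as [d2 [Hd2 K2]]; [lra|].
    exists (Rmin d1 d2); split; [now apply Rmin_glb_lt|]. intros y Hy.
    specialize (K1 y (Rlt_le_trans _ _ _ Hy (Rmin_l _ _))).
    specialize (K2 y (Rlt_le_trans _ _ _ Hy (Rmin_r _ _))).
    replace (f y + g y - (f w + g w))%C with ((f y - f w) + (g y - g w))%C by ring.
    eapply Rle_lt_trans; [apply Cmod_triangle|lra]. }
  assert (E : (rect_int (F u) a b c d - rect_int (F z) a b c d - rect_int F' a b c d * (u - z))%C =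
    rect_int (fun w => F u w + (-(1) * F z w + -(u - z) * F' w))%C a b c d).
  { rewrite !rect_int_plus, !rect_int_scal; auto. ring. }
  rewrite E.
  eapply Rle_trans; [apply (rect_int_bound _ a b c d (K * Cmod (u - z) ^ 2))|].
  - auto.
  - intros w Hw. replace (F u w + (- (1) * F z w + - (u - z) * F' w))%C with
      (F u w - F z w - (u - z) * F' w)%C by ring. now apply H.
  - replace (4 * (K * Cmod (u - z) ^ 2) * (Rabs (b - a) + Rabs (d - c)))
      with (S * Cmod (u - z) * Cmod (u - z)) by (unfold S; ring).
    apply Rmult_le_compat_r; [apply Cmod_ge_0|].
    apply Rmult_lt_compat_r with (r := S + 1) in Hu2; [|lra].
    unfold Rdiv in Hu2. rewrite Rmult_assoc, Rinv_l, Rmult_1_r in Hu2 by lra.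
    pose proof (Cmod_ge_0 (u - z)). nra.
Qed.

(** The Cauchy integral without its factor 1/(2 pi i), followed by its first and second derivative
    in [z]. Two derivatives suffice to see that the derivative of a holomorphic function is
    holomorphic. *)
Definition cauchy_int1 (f : C -> C) (a b c d : R) (z : C) : C :=
  rect_int (fun w => f w * / (w - z))%C a b c d.
Definition cauchy_int2 (f : C -> C) (a b c d : R) (z : C) : C :=
  rect_int (fun w => f w * / ((w - z) * (w - z)))%C a b c d.
Definition cauchy_int3 (f : C -> C) (a b c d : R) (z : C) : C :=
  rect_int (fun w => f w * (2 * / ((w - z) * (w - z) * (w - z))))%C a b c d.

Definition in_rect_interior (a b c d : R) (z : C) : Prop := a < fst z < b /\ c < snd z < d.

Lemma rect_bd_distance (a b c d : R) (z : C) : in_rect_interior a b c d z ->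
  exists del, 0 < del /\ forall u w, Cmod (u - z) < del -> on_rect_bd a b c d w -> del <= Cmod (w - u).
Proof.
  intros [Hx Hy].
  set (m := Rmin (Rmin (fst z - a) (b - fst z)) (Rmin (snd z - c) (d - snd z))).
  assert (Hm : 0 < m) by (unfold m; repeat apply Rmin_glb_lt; lra).
  assert (M1 : m <= fst z - a) by (eapply Rle_trans; [apply Rmin_l|apply Rmin_l]).
  assert (M2 : m <= b - fst z) by (eapply Rle_trans; [apply Rmin_l|apply Rmin_r]).
  assert (M3 : m <= snd z - c) by (eapply Rle_trans; [apply Rmin_r|apply Rmin_l]).
  assert (M4 : m <= d - snd z) by (eapply Rle_trans; [apply Rmin_r|apply Rmin_r]).
  (* Half the distance from [z] to the boundary: moving [z] by less than this leaves at least this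
     much. *)
  exists (m / 2). split; [lra|]. intros u w Hu [_ Hw].
  assert (Hwz : m <= Cmod (w - z)).
  { pose proof (Cmod_fst (w - z)) as A1. pose proof (Cmod_snd (w - z)) as A2. simpl in A1, A2.
    destruct Hw as [E|[E|[E|E]]]; rewrite E in *.
    - rewrite Rabs_left1 in A1; lra.
    - rewrite Rabs_right in A1; lra.
    - rewrite Rabs_left1 in A2; lra.
    - rewrite Rabs_right in A2; lra. }
  pose proof (Cmod_triangle3 w u z). lra.
Qed.

Lemma neq0_of_Cmod_ge (w : C) (del : R) : 0 < del -> del <= Cmod w -> w <> 0.
Proof. intros H1 H2. apply Cmod_gt_0. lra. Qed.

Lemma ccontinuous_mult (f g : C -> C) (w : C) : ccontinuous f w -> ccontinuous g w -> ccontinuous (fun x => f x * g x)%C w.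
Proof.
  intros Hf Hg eps Heps.
  pose proof (Cmod_ge_0 (f w)) as Pf. pose proof (Cmod_ge_0 (g w)) as Pg.
  set (e := Rmin 1 (eps / (Cmod (f w) + Cmod (g w) + 2))).
  assert (He : 0 < e) by (apply Rmin_glb_lt; [lra|apply Rdiv_lt_0_compat; lra]).
  assert (He1 : e <= 1) by apply Rmin_l.
  assert (He2 : e * (Cmod (f w) + Cmod (g w) + 2) <= eps).
  { apply Rle_div_r; [lra|apply Rmin_r]. }
  destruct (Hf e He) as [d1 [Hd1 K1]]. destruct (Hg e He) as [d2 [Hd2 K2]].
  exists (Rmin d1 d2); split; [now apply Rmin_glb_lt|]. intros y Hy.
  specialize (K1 y (Rlt_le_trans _ _ _ Hy (Rmin_l _ _))).
  specialize (K2 y (Rlt_le_trans _ _ _ Hy (Rmin_r _ _))).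
  replace (f y * g y - f w * g w)%C with ((f y - f w) * (g y - g w) + (f y - f w) * g w + f w * (g y - g w))%C by ring.
  eapply Rle_lt_trans; [apply Cmod_triangle|].
  eapply Rle_lt_trans; [apply Rplus_le_compat_r, Cmod_triangle|]. rewrite !Cmod_mult.
  pose proof (Cmod_ge_0 (f y - f w)). pose proof (Cmod_ge_0 (g y - g w)). nra.
Qed.

Lemma cderiv_cauchy_int1 (f : C -> C) (a b c d : R) (z : C) : continuous_on_bd f a b c d -> in_rect_interior a b c d z ->
  cderiv (cauchy_int1 f a b c d) z (cauchy_int2 f a b c d z).
Proof.
  intros Hf Hz. destruct (rect_bd_distance a b c d z Hz) as [del [Hdel D]].
  destruct (rect_bounded f a b c d) as [M [HM B]]; [destruct Hz; lra|destruct Hz; lra|exact Hf|].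
  assert (Dz : Cmod (z - z) < del) by (rewrite Cmod_self; lra).
  (* With p = w - u and q = w - z one has 1/p - 1/q - (q-p)/q^2 = (q-p)^2/(p q^2). Both |p| and |q|
     are at least [del], hence this [K]. *)
  apply (rect_int_param (fun u w => f w * / (w - u))%C) with (eta := del) (K := M * / (del * del * del)); [exact Hdel| | | |].
  - apply Rmult_le_pos; [exact HM|]. left; apply Rinv_0_lt_compat. repeat apply Rmult_lt_0_compat; lra.
  - intros u Hu w Hw. pose proof (neq0_of_Cmod_ge _ _ Hdel (D u w Hu Hw)) as N.
    apply ccontinuous_mult; [now apply Hf|]. eapply cderiv_continuous. auto_cderiv. exact N.
  - intros w Hw. pose proof (neq0_of_Cmod_ge _ _ Hdel (D z w Dz Hw)) as N.
    apply ccontinuous_mult; [now apply Hf|]. eapply cderiv_continuous. auto_cderiv. now apply Cmult_neq_0.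
  - intros u w Hu Hw.
    pose proof (D u w Hu Hw) as Du. pose proof (D z w Dz Hw) as Dz'.
    pose proof (neq0_of_Cmod_ge _ _ Hdel Du) as N1. pose proof (neq0_of_Cmod_ge _ _ Hdel Dz') as N2.
    replace (f w * / (w - u) - f w * / (w - z) - (u - z) * (f w * / ((w - z) * (w - z))))%C
      with (f w * / ((w - z) * (w - z) * (w - u)) * ((u - z) * (u - z)))%C by (field; split; assumption).
    rewrite !Cmod_mult, Cmod_inv, !Cmod_mult by (repeat apply Cmult_neq_0; assumption).
    simpl pow. rewrite Rmult_1_r. apply Rmult_le_compat_r; [apply Rle_0_sqr|].
    apply Rmult_le_compat; [apply Cmod_ge_0| |now apply B|].
    + left; apply Rinv_0_lt_compat. repeat apply Rmult_lt_0_compat; lra.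
    + apply Rinv_le_contravar; [repeat apply Rmult_lt_0_compat; lra|].
      repeat apply Rmult_le_compat; try lra. apply Rmult_le_pos; lra.
Qed.

Lemma cderiv_cauchy_int2 (f : C -> C) (a b c d : R) (z : C) : continuous_on_bd f a b c d -> in_rect_interior a b c d z ->
  cderiv (cauchy_int2 f a b c d) z (cauchy_int3 f a b c d z).
Proof.
  intros Hf Hz. destruct (rect_bd_distance a b c d z Hz) as [del [Hdel D]].
  destruct (rect_bounded f a b c d) as [M [HM B]]; [destruct Hz; lra|destruct Hz; lra|exact Hf|].
  assert (Dz : Cmod (z - z) < del) by (rewrite Cmod_self; lra).
  assert (Pd : 0 < del * del * del * del) by (repeat apply Rmult_lt_0_compat; lra).
  apply (rect_int_param (fun u w => f w * / ((w - u) * (w - u)))%C) with (eta := del) (K := M * (3 / (del * del * del * del))); [exact Hdel| | | |].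
  - apply Rmult_le_pos; [exact HM|]. left; apply Rdiv_lt_0_compat; lra.
  - intros u Hu w Hw. pose proof (neq0_of_Cmod_ge _ _ Hdel (D u w Hu Hw)) as N.
    apply ccontinuous_mult; [now apply Hf|]. eapply cderiv_continuous. auto_cderiv. now apply Cmult_neq_0.
  - intros w Hw. pose proof (neq0_of_Cmod_ge _ _ Hdel (D z w Dz Hw)) as N.
    apply ccontinuous_mult; [now apply Hf|]. eapply cderiv_continuous. auto_cderiv. repeat apply Cmult_neq_0; exact N.
  - intros u w Hu Hw.
    pose proof (D u w Hu Hw) as Du. pose proof (D z w Dz Hw) as Dz'.
    pose proof (neq0_of_Cmod_ge _ _ Hdel Du) as N1. pose proof (neq0_of_Cmod_ge _ _ Hdel Dz') as N2.
    set (A := Cmod (w - u)) in *. set (A' := Cmod (w - z)) in *.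
    (* 1/p^2 - 1/q^2 - 2(q-p)/q^3 = (q-p)^2 (q + 2p)/(p^2 q^3) with p = w-u, q = w-z *)
    replace (f w * / ((w - u) * (w - u)) - f w * / ((w - z) * (w - z)) -
      (u - z) * (f w * (2 * / ((w - z) * (w - z) * (w - z)))))%C
      with (f w * (/ ((w - z) * (w - z) * ((w - u) * (w - u))) + 2 * / ((w - z) * (w - z) * (w - z) * (w - u)))
        * ((u - z) * (u - z)))%C by (field; split; assumption).
    rewrite !Cmod_mult.
    simpl pow. rewrite Rmult_1_r. apply Rmult_le_compat_r; [apply Rle_0_sqr|].
    apply Rmult_le_compat; [apply Cmod_ge_0|apply Cmod_ge_0|now apply B|].
    eapply Rle_trans; [apply Cmod_triangle|].
    rewrite (Cmod_mult 2), Cmod_R, Rabs_right by lra.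
    rewrite !Cmod_inv, !Cmod_mult by (repeat apply Cmult_neq_0; assumption).
    fold A A'.
    assert (Q1 : / (A' * A' * (A * A)) <= / (del * del * del * del)).
    { apply Rinv_le_contravar; [exact Pd|]. rewrite <- Rmult_assoc.
      repeat apply Rmult_le_compat; try lra; repeat apply Rmult_le_pos; lra. }
    assert (Q2 : / (A' * A' * A' * A) <= / (del * del * del * del)).
    { apply Rinv_le_contravar; [exact Pd|].
      repeat apply Rmult_le_compat; try lra; repeat apply Rmult_le_pos; lra. }
    unfold Rdiv. lra.
Qed.

Lemma sum_sqr_pos_l (u v : R) : u <> 0 -> 0 < u * u + v * v.
Proof. intros H. pose proof (Rsqr_pos_lt u H). pose proof (Rle_0_sqr v). unfold Rsqr in *. lra. Qed.

Lemma sum_sqr_pos_r (u v : R) : v <> 0 -> 0 < u * u + v * v.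
Proof. intros H. rewrite Rplus_comm. now apply sum_sqr_pos_l. Qed.

(* Each of the four sides contributes a positive imaginary part, which avoids computing [2 pi i]. *)
Lemma cauchy_kernel_int_neq0 (a b c d : R) (z : C) : in_rect_interior a b c d z -> rect_int (fun w => / (w - z))%C a b c d <> 0.
Proof.
  intros Hz. destruct (rect_bd_distance a b c d z Hz) as [del [Hdel D]].
  assert (Dz : Cmod (z - z) < del) by (rewrite Cmod_self; lra).
  assert (Hc : continuous_on_bd (fun w => / (w - z))%C a b c d).
  { intros w Hw. pose proof (neq0_of_Cmod_ge _ _ Hdel (D z w Dz Hw)) as N. eapply cderiv_continuous. auto_cderiv. exact N. }
  destruct z as [x y]. destruct Hz as [Hx Hy]. simpl in Hx, Hy.
  assert (Sg : forall p v s t, s < t -> continuous_on_seg (fun w => / (w - (x, y)%R))%C p v s t ->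
    (forall r, s < r < t -> 0 < snd (v * / (p + RtoC r * v - (x, y)%R))%C) ->
    0 < snd (seg_int (fun w => / (w - (x, y)%R))%C p v s t)).
  { intros p v s t Hst HS HP. unfold seg_int, CInt; simpl snd.
    apply RInt_gt_0; [exact Hst|exact HP|].
    intros r Hr. apply (path_continuous_snd (fun t => v * / (p + RtoC t * v - (x, y)%R))%C).
    apply (path_continuous_seg (fun w => / (w - (x, y)%R))%C). apply HS. minmax. }
  assert (Sl : forall p v s t, s < t -> continuous_on_seg (fun w => / (w - (x, y)%R))%C p v s t ->
    (forall r, s < r < t -> snd (v * / (p + RtoC r * v - (x, y)%R))%C < 0) ->
    snd (seg_int (fun w => / (w - (x, y)%R))%C p v s t) < 0).
  { intros p v s t Hst HS HP. unfold seg_int, CInt; simpl snd.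
    apply Ropp_lt_cancel. rewrite Ropp_0, <- (RInt_opp (V := R_CompleteNormedModule)).
    2:{ apply ex_CInt_seg in HS. apply HS. }
    apply RInt_gt_0; [exact Hst| |].
    - intros r Hr. specialize (HP r Hr). unfold opp; simpl. simpl in HP. lra.
    - intros r Hr. apply (continuous_opp (V := R_NormedModule)).
      apply (path_continuous_snd (fun t => v * / (p + RtoC t * v - (x, y)%R))%C).
      apply (path_continuous_seg (fun w => / (w - (x, y)%R))%C). apply HS. minmax. }
  assert (E : 0 < snd (rect_int (fun w => / (w - (x, y)%R))%C a b c d)).
  { unfold rect_int.
    assert (L1 : 0 < snd (seg_int (fun w => / (w - (x, y)%R))%C (0%R, c) 1 a b)).
    { apply Sg; [lra|solve_seg Hc|]. intros r Hr. rewrite horizontal_point. simpl.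
      assert (P : 0 < (r - x) * (r - x) + (c - y) * (c - y)) by (apply sum_sqr_pos_r; lra).
      match goal with |- 0 < ?e => replace e with ((y - c) / ((r - x) * (r - x) + (c - y) * (c - y))) end.
      - apply Rdiv_lt_0_compat; lra.
      - field. unfold Rminus in P; lra. }
    assert (L2 : snd (seg_int (fun w => / (w - (x, y)%R))%C (0%R, d) 1 a b) < 0).
    { apply Sl; [lra|solve_seg Hc|]. intros r Hr. rewrite horizontal_point. simpl.
      assert (P : 0 < (r - x) * (r - x) + (d - y) * (d - y)) by (apply sum_sqr_pos_r; lra).
      match goal with |- ?e < 0 => replace e with (- ((d - y) / ((r - x) * (r - x) + (d - y) * (d - y)))) end.
      - apply Ropp_lt_gt_0_contravar. apply Rdiv_lt_0_compat; lra.
      - field. unfold Rminus in P; lra. }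
    assert (L3 : 0 < snd (seg_int (fun w => / (w - (x, y)%R))%C (b, 0%R) Ci c d)).
    { apply Sg; [lra|solve_seg Hc|]. intros r Hr. rewrite vertical_point. simpl.
      assert (P : 0 < (b - x) * (b - x) + (r - y) * (r - y)) by (apply sum_sqr_pos_l; lra).
      match goal with |- 0 < ?e => replace e with ((b - x) / ((b - x) * (b - x) + (r - y) * (r - y))) end.
      - apply Rdiv_lt_0_compat; lra.
      - field. unfold Rminus in P; lra. }
    assert (L4 : snd (seg_int (fun w => / (w - (x, y)%R))%C (a, 0%R) Ci c d) < 0).
    { apply Sl; [lra|solve_seg Hc|]. intros r Hr. rewrite vertical_point. simpl.
      assert (P : 0 < (a - x) * (a - x) + (r - y) * (r - y)) by (apply sum_sqr_pos_l; lra).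
      match goal with |- ?e < 0 => replace e with (- ((x - a) / ((a - x) * (a - x) + (r - y) * (r - y)))) end.
      - apply Ropp_lt_gt_0_contravar. apply Rdiv_lt_0_compat; lra.
      - field. unfold Rminus in P; lra. }
    assert (Es : forall p q r s : C, snd (p - q + r - s)%C = snd p - snd q + snd r - snd s)
      by (intros; simpl; ring).
    rewrite Es. lra. }
  intros E0. rewrite E0 in E. simpl in E. lra.
Qed.

(** * Zeros of holomorphic functions *)
Section Square.

Variables (z0 : C) (rho : R).
Hypothesis Hrho : 0 < rho.

Let a := fst z0 - rho.
Let b := fst z0 + rho.
Let c := snd z0 - rho.
Let d := snd z0 + rho.

Lemma in_square_Cmod (w : C) : in_rect a b c d w -> Cmod (w - z0) <= 2 * rho.
Proof.
  unfold a, b, c, d. intros [H1 H2]. rewrite Rmin_left, Rmax_right in H1, H2 by lra.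
  eapply Rle_trans; [apply Cmod_le_sum|]. simpl.
  replace (2 * rho) with (rho + rho) by ring. apply Rplus_le_compat; apply Rabs_le; lra.
Qed.

Lemma disc_in_square (w : C) : Cmod (w - z0) < rho -> in_rect_interior a b c d w.
Proof.
  intros H. pose proof (Cmod_fst (w - z0)) as A1. pose proof (Cmod_snd (w - z0)) as A2.
  simpl in A1, A2. assert (B1 := Rle_lt_trans _ _ _ A1 H). assert (B2 := Rle_lt_trans _ _ _ A2 H).
  apply Rabs_def2 in B1, B2. unfold a, b, c, d; split; lra.
Qed.

Lemma square_bd_Cmod (w : C) : on_rect_bd a b c d w -> rho <= Cmod (w - z0).
Proof.
  intros [_ Hw]. unfold a, b, c, d in Hw.
  pose proof (Cmod_fst (w - z0)) as A1. pose proof (Cmod_snd (w - z0)) as A2. simpl in A1, A2.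
  destruct Hw as [E|[E|[E|E]]]; rewrite E in *.
  - rewrite Rabs_left1 in A1; lra.
  - rewrite Rabs_right in A1; lra.
  - rewrite Rabs_left1 in A2; lra.
  - rewrite Rabs_right in A2; lra.
Qed.

(** This is 2 pi i times the winding number. It is not shown to be constant in [z], so its
    derivative [square_index'] takes part in the quotient rule below. *)
Definition square_index (z : C) : C := cauchy_int1 (fun _ => 1) a b c d z.
Definition square_index' (z : C) : C := cauchy_int2 (fun _ => 1) a b c d z.

Lemma const_continuous_on_bd : continuous_on_bd (fun _ => 1) a b c d.
Proof. intros w _. eapply cderiv_continuous, cderiv_const. Qed.

Lemma square_index_eq (z : C) : square_index z = rect_int (fun w => / (w - z))%C a b c d.
Proof. unfold square_index, cauchy_int1. apply rect_int_ext; intros; split; apply Cmult_1_l. Qed.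

Lemma square_index_neq0 (z : C) : Cmod (z - z0) < rho -> square_index z <> 0.
Proof. intros Hz. rewrite square_index_eq. now apply cauchy_kernel_int_neq0, disc_in_square. Qed.

Variables (f : C -> C) (r : R).
Hypothesis Hr : 2 * rho < r.
Hypothesis Hf : holo_on_disc f z0 r.

Lemma holo_on_square (w : C) : in_rect a b c d w -> exists l, cderiv f w l.
Proof. intros Hw. apply Hf. pose proof (in_square_Cmod w Hw). lra. Qed.

Lemma holo_continuous_on_square_bd : continuous_on_bd f a b c d.
Proof. intros w [Hw _]. destruct (holo_on_square w Hw) as [l Hl]. eapply cderiv_continuous, Hl. Qed.

Lemma cauchy_square (z : C) : Cmod (z - z0) < rho -> cauchy_int1 f a b c d z = (f z * square_index z)%C.
Proof.
  intros Hz. rewrite square_index_eq. destruct (disc_in_square z Hz) as [H1 H2].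
  apply cauchy_rect_int; [exact H1|exact H2|]. exact holo_on_square.
Qed.

Lemma cauchy_formula_square (z : C) : Cmod (z - z0) < rho -> f z = (cauchy_int1 f a b c d z / square_index z)%C.
Proof. intros Hz. rewrite cauchy_square by exact Hz. field. now apply square_index_neq0. Qed.

(** On the disc [f] is the quotient of two Cauchy integrals. The quotient rule gives a formula for
    [f1] made of Cauchy integrals, and that formula can be differentiated once more. *)
Lemma holo_deriv_square : exists f1, (forall z, Cmod (z - z0) < rho -> cderiv f z (f1 z)) /\
  holo_on_disc f1 z0 rho.
Proof.
  exists (fun z => (cauchy_int2 f a b c d z * square_index z - cauchy_int1 f a b c d z * square_index' z) / (square_index z * square_index z))%C.
  pose proof holo_continuous_on_square_bd as Cf. pose proof const_continuous_on_bd as C1.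
  split.
  - intros z Hz. pose proof (square_index_neq0 z Hz) as N.
    eapply (cderiv_ext_loc (fun w => cauchy_int1 f a b c d w / square_index w)%C f z _ (rho - Cmod (z - z0))); [lra| |].
    + intros w Hw. symmetry. apply cauchy_formula_square.
      pose proof (Cmod_triangle3 w z z0). lra.
    + apply cderiv_div; [exact N| |]; apply cderiv_cauchy_int1; try assumption; now apply disc_in_square.
  - intros z Hz. pose proof (square_index_neq0 z Hz) as N. pose proof (disc_in_square z Hz) as I.
    pose proof (cderiv_cauchy_int1 f a b c d z Cf I) as D1. pose proof (cderiv_cauchy_int2 f a b c d z Cf I) as D2.
    pose proof (cderiv_cauchy_int1 _ a b c d z C1 I) as D3. pose proof (cderiv_cauchy_int2 _ a b c d z C1 I) as D4.
    eexists. exact (cderiv_div _ _ z _ _ (Cmult_neq_0 _ _ N N)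
      (cderiv_minus _ _ z _ _ (cderiv_mult _ _ z _ _ D2 D3) (cderiv_mult _ _ z _ _ D1 D4))
      (cderiv_mult _ _ z _ _ D3 D3)).
Qed.

(** The cofactor is the Cauchy integral of f(w)/(w - z0) over the boundary, divided by the index.
    This defines it at [z0] as well, where the naive quotient is meaningless. *)
Lemma holo_factor_square : f z0 = 0 -> exists g, (exists l, cderiv g z0 l) /\
  forall z, Cmod (z - z0) < rho -> f z = ((z - z0) * g z)%C.
Proof.
  intros Hf0.
  set (h := fun w => (f w * / (w - z0))%C).
  assert (Dz : Cmod (z0 - z0) < rho) by (rewrite Cmod_self; exact Hrho).
  assert (Nb : forall w, on_rect_bd a b c d w -> (w - z0)%C <> 0).
  { intros w Hw. apply (neq0_of_Cmod_ge _ rho Hrho). now apply square_bd_Cmod. }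
  assert (Ch : continuous_on_bd h a b c d).
  { intros w Hw. destruct (holo_on_square w (proj1 Hw)) as [l Hl].
    eapply cderiv_continuous. apply (cderiv_mult f (fun w => / (w - z0))%C); [exact Hl|]. auto_cderiv. now apply Nb. }
  exists (fun z => cauchy_int1 h a b c d z / square_index z)%C. split.
  - eexists. pose proof (disc_in_square z0 Dz). apply cderiv_div; [now apply square_index_neq0| |]; apply cderiv_cauchy_int1; try assumption.
    apply const_continuous_on_bd.
  - intros z Hz. pose proof (square_index_neq0 z Hz) as N.
    assert (Nz : forall w, on_rect_bd a b c d w -> (w - z)%C <> 0).
    { intros w Hw E. apply (f_equal Cmod) in E. rewrite Cmod_0 in E. pose proof (square_bd_Cmod w Hw).
      pose proof (Cmod_triangle3 w z z0). lra. }
    assert (E0 : cauchy_int1 f a b c d z0 = 0) by (rewrite cauchy_square, Hf0 by exact Dz; ring).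
    assert (Cz : forall u, (forall w, on_rect_bd a b c d w -> (w - u)%C <> 0) ->
      continuous_on_bd (fun w => f w * / (w - u))%C a b c d).
    { intros u Nu w Hw. destruct (holo_on_square w (proj1 Hw)) as [l Hl].
      eapply cderiv_continuous. apply (cderiv_mult f (fun w => / (w - u))%C); [exact Hl|]. auto_cderiv. now apply Nu. }
    assert (Chz : continuous_on_bd (fun w => h w * / (w - z))%C a b c d).
    { intros w Hw. apply ccontinuous_mult; [now apply Ch|]. eapply cderiv_continuous. auto_cderiv. now apply Nz. }
    assert (Chz' : continuous_on_bd (fun w => (z - z0) * (h w * / (w - z)))%C a b c d).
    { intros w Hw. apply ccontinuous_mult; [eapply cderiv_continuous, cderiv_const|now apply Chz]. }
    assert (E : cauchy_int1 f a b c d z = ((z - z0) * cauchy_int1 h a b c d z)%C).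
    { unfold cauchy_int1 at 2. rewrite <- rect_int_scal by exact Chz.
      rewrite <- (Cplus_0_r (rect_int _ a b c d)), <- E0. unfold cauchy_int1.
      rewrite <- rect_int_plus; [|exact Chz'|now apply Cz].
      (* Partial fractions: 1/(w-z) = (z-z0)/((w-z0)(w-z)) + 1/(w-z0). The last term integrates to
         [f z0] times the index, which is zero. *)
      assert (P : forall w, on_rect_bd a b c d w -> (f w * / (w - z) =
        (z - z0) * (h w * / (w - z)) + f w * / (w - z0))%C).
      { intros w Hw. unfold h. field. split; [now apply Nb|now apply Nz]. }
      apply rect_int_ext; intros t Ht; split; apply P; solve_bd. }
    rewrite (cauchy_formula_square z Hz), E. field. exact N.
Qed.

End Square.

(** Half-side [r / 3]: the square then lies within [2 * r / 3] of its centre, hence inside the disc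
    where [f] is differentiable. *)
Lemma holo_deriv (f : C -> C) (z0 : C) (r : R) : 0 < r -> holo_on_disc f z0 r ->
  exists f1, (forall z, Cmod (z - z0) < r / 3 -> cderiv f z (f1 z)) /\ holo_on_disc f1 z0 (r / 3).
Proof. intros Hr Hf. apply (holo_deriv_square z0 (r / 3) ltac:(lra) f r); [lra|exact Hf]. Qed.

(** Away from [z0] the cofactor is simply the quotient, so it keeps the full radius [r]. Without
    this, the factorisation could not be repeated arbitrarily often in [holo_zero]. *)
Lemma holo_factor (f : C -> C) (z0 : C) (r : R) : 0 < r -> holo_on_disc f z0 r -> f z0 = 0 ->
  exists g, holo_on_disc g z0 r /\ forall w, Cmod (w - z0) < r -> f w = ((w - z0) * g w)%C.
Proof.
  intros Hr Hf H0.
  destruct (holo_factor_square z0 (r / 3) ltac:(lra) f r ltac:(lra) Hf H0) as [g [[l Hg] E]].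
  exists (fun w => if Ceq_dec w z0 then g z0 else f w / (w - z0))%C. split.
  - intros w Hw. destruct (Ceq_dec w z0) as [->|Hwz].
    + exists l. eapply (cderiv_ext_loc g _ z0 l (r / 3)); [lra| |exact Hg].
      intros u Hu. destruct (Ceq_dec u z0) as [->|Huz]; [reflexivity|].
      rewrite (E u Hu). field. now apply Cminus_eq_contra.
    + destruct (Hf w Hw) as [l' Hl'].
      assert (N : (w - z0)%C <> 0) by now apply Cminus_eq_contra.
      eexists. eapply (cderiv_ext_loc (fun u => f u / (u - z0))%C _ w _ (Cmod (w - z0))).
      * now apply Cmod_gt_0.
      * intros u Hu. destruct (Ceq_dec u z0) as [->|]; [|reflexivity].
        rewrite Cmod_minus_sym in Hu. lra.
      * apply (cderiv_div f (fun u => u - z0)%C); [exact N|exact Hl'|auto_cderiv].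
  - intros w Hw. destruct (Ceq_dec w z0) as [->|Hwz].
    + rewrite H0. ring.
    + field. now apply Cminus_eq_contra.
Qed.

(** A substitute for the power series. If every power of w - z0 divides [f], the n-th cofactor is at
    most [M / rho ^ n] on the boundary of the square. Cauchy's formula carries this bound inside and
    gives |f(z)| at most a constant times (|z - z0|/rho)^n, which tends to zero. *)
Lemma holo_zero (f : C -> C) (z0 : C) (r : R) : 0 < r -> holo_on_disc f z0 r ->
  (forall w, Cmod (w - z0) < r / 3 -> f w = 0) \/
  exists (n : nat) (g : C -> C), holo_on_disc g z0 r /\ g z0 <> 0 /\
    forall w, Cmod (w - z0) < r -> f w = ((w - z0) ^ n * g w)%C.
Proof.
  intros Hr Hf. apply NNPP. intros HN. apply not_or_and in HN. destruct HN as [N1 N2].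
  apply N1. clear N1.
  assert (G : forall n, exists g, holo_on_disc g z0 r /\
    forall w, Cmod (w - z0) < r -> f w = ((w - z0) ^ n * g w)%C).
  { induction n as [|n [g [Hg E]]].
    - exists f. split; [exact Hf|]. intros; simpl; ring.
    - destruct (Ceq_dec (g z0) 0) as [Z|Z].
      + destruct (holo_factor g z0 r Hr Hg Z) as [h [Hh E']]. exists h. split; [exact Hh|].
        intros w Hw. rewrite (E w Hw), (E' w Hw), Cpow_S. ring.
      + exfalso. apply N2. now exists n, g. }
  intros z Hz. set (rho := r / 3) in *.
  assert (Hrho : 0 < rho) by (unfold rho; lra).
  assert (Hr2 : 2 * rho < r) by (unfold rho; lra).
  set (a := fst z0 - rho). set (b := fst z0 + rho). set (c := snd z0 - rho). set (d := snd z0 + rho).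
  destruct (rect_bounded f a b c d) as [M [HM B]]; [unfold a, b; lra|unfold c, d; lra| |].
  { exact (holo_continuous_on_square_bd z0 rho Hrho f r Hr2 Hf). }
  pose proof (square_index_neq0 z0 rho z Hz) as NK. pose proof (proj1 (Cmod_gt_0 _) NK) as PK.
  set (q := Cmod (z - z0)) in *. assert (Hq : 0 <= q) by apply Cmod_ge_0.
  (* The bound [rect_int_bound] for the Cauchy kernel at distance at least [rho - q], divided by the
     index; it depends on [z] but not on [n]. *)
  set (C0 := 4 * (M / (rho - q)) * (4 * rho) / Cmod (square_index z0 rho z)).
  assert (HC0 : 0 <= C0).
  { unfold C0. repeat apply Rmult_le_pos; try lra; left; apply Rinv_0_lt_compat; lra. }
  assert (Bn : forall n, Cmod (f z) <= C0 * (q / rho) ^ n).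
  { intros n. destruct (G n) as [g [Hg E]].
    assert (Hz' : Cmod (z - z0) < r) by (unfold q in *; lra).
    rewrite (E z Hz'), (cauchy_formula_square z0 rho Hrho g r Hr2 Hg z Hz).
    rewrite Cmod_mult, Cmod_pow, Cmod_div by exact NK. fold q.
    assert (Pn : 0 < rho ^ n) by now apply pow_lt.
    assert (Bg : forall w, on_rect_bd a b c d w -> Cmod (g w) <= M / rho ^ n).
    { intros w Hw. pose proof (square_bd_Cmod z0 rho Hrho w Hw) as L.
      assert (Hw' : Cmod (w - z0) < r).
      { pose proof (in_square_Cmod z0 rho Hrho w (proj1 Hw)). lra. }
      pose proof (B w Hw) as Bw. rewrite (E w Hw'), Cmod_mult, Cmod_pow in Bw.
      apply Rle_div_r; [exact Pn|]. eapply Rle_trans; [|exact Bw].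
      rewrite Rmult_comm. apply Rmult_le_compat_r; [apply Cmod_ge_0|]. apply pow_incr; lra. }
    assert (Dz : forall w, on_rect_bd a b c d w -> rho - q <= Cmod (w - z)).
    { intros w Hw. pose proof (square_bd_Cmod z0 rho Hrho w Hw). pose proof (Cmod_triangle3 w z z0). unfold q. lra. }
    assert (BR : Cmod (cauchy_int1 g a b c d z) <= 4 * (M / rho ^ n * / (rho - q)) * (Rabs (b - a) + Rabs (d - c))).
    { apply rect_int_bound.
      - intros w Hw. apply ccontinuous_mult.
        + exact (holo_continuous_on_square_bd z0 rho Hrho g r Hr2 Hg w Hw).
        + pose proof (neq0_of_Cmod_ge _ (rho - q) ltac:(lra) (Dz w Hw)). eapply cderiv_continuous. auto_cderiv. assumption.
      - intros w Hw. pose proof (Dz w Hw) as L. pose proof (neq0_of_Cmod_ge _ (rho - q) ltac:(lra) L) as N.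
        rewrite Cmod_mult, Cmod_inv by exact N.
        apply Rmult_le_compat; [apply Cmod_ge_0| |now apply Bg|apply Rinv_le_contravar; lra].
        left; apply Rinv_0_lt_compat; lra. }
    replace (b - a) with (2 * rho) in BR by (unfold a, b; ring).
    replace (d - c) with (2 * rho) in BR by (unfold d, c; ring).
    rewrite Rabs_right in BR by lra.
    assert (Qn : 0 <= q ^ n) by now apply pow_le.
    replace (C0 * (q / rho) ^ n) with
      (q ^ n * ((4 * (M / rho ^ n * / (rho - q)) * (2 * rho + 2 * rho)) / Cmod (square_index z0 rho z))).
    - apply Rmult_le_compat_l; [exact Qn|]. apply Rmult_le_compat_r; [|exact BR].
      left; now apply Rinv_0_lt_compat.
    - unfold C0, Rdiv. rewrite Rpow_mult_distr, pow_inv. field. repeat split; lra. }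
  destruct (Ceq_dec (f z) 0) as [E|E]; [exact E|exfalso].
  apply Cmod_gt_0 in E.
  assert (Hqr : Rabs (q / rho) < 1).
  { rewrite Rabs_right; [apply Rlt_div_l; lra|]. apply Rle_ge, Rdiv_le_0_compat; lra. }
  destruct (pow_lt_1_zero (q / rho) Hqr (Cmod (f z) / (C0 + 1))) as [N HN]; [apply Rdiv_lt_0_compat; lra|].
  specialize (HN N (le_n N)). specialize (Bn N).
  apply Rlt_div_r in HN; [|lra]. pose proof (Rle_abs ((q / rho) ^ N)).
  pose proof (Rabs_pos ((q / rho) ^ N)). nra.
Qed.

Lemma Cpow_nz_sub (w z : C) (n : nat) : w <> z -> ((w - z) ^ n)%C <> 0.
Proof. intros H. apply Cpow_nz. now apply Cminus_eq_contra. Qed.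

Lemma holo_accum (f : C -> C) (z0 : C) (r : R) : 0 < r -> holo_on_disc f z0 r ->
  (forall eps, 0 < eps -> exists w, 0 < Cmod (w - z0) < eps /\ f w = 0) ->
  forall w, Cmod (w - z0) < r / 3 -> f w = 0.
Proof.
  intros Hr Hf Hacc. destruct (holo_zero f z0 r Hr Hf) as [Z|[n [g [Hg [N E]]]]]; [exact Z|exfalso].
  assert (D0 : Cmod (z0 - z0) < r) by (rewrite Cmod_self; exact Hr).
  destruct (Hg z0 D0) as [l Hl]. apply cderiv_continuous in Hl.
  destruct (ccontinuous_neq0 g z0 Hl N) as [del [Hdel K]].
  destruct (Hacc (Rmin del r)) as [w [[Hw1 Hw2] Ew]]; [now apply Rmin_glb_lt|].
  assert (Hw3 := Rlt_le_trans _ _ _ Hw2 (Rmin_l _ _)). assert (Hw4 := Rlt_le_trans _ _ _ Hw2 (Rmin_r _ _)).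
  rewrite (E w Hw4) in Ew. specialize (K w Hw3). apply Cmod_gt_0 in N.
  assert (Hwz : w <> z0) by (intros ->; rewrite Cmod_self in Hw1; lra).
  apply (Cmult_neq_0 _ (g w) (Cpow_nz_sub w z0 n Hwz)); [|exact Ew].
  apply Cmod_gt_0. lra.
Qed.

(** * The identity theorem for meromorphic functions *)
Lemma ex_point_near (z : C) (eps : R) : 0 < eps -> exists w, 0 < Cmod (w - z) < eps.
Proof.
  intros H. exists (z + RtoC (eps / 2))%C.
  replace (z + RtoC (eps / 2) - z)%C with (RtoC (eps / 2)) by ring.
  rewrite Cmod_R, Rabs_right; lra.
Qed.

Lemma Cmod_pos_neq (w z : C) : 0 < Cmod (w - z) -> w <> z.
Proof. intros H ->. rewrite Cmod_self in H. lra. Qed.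

Lemma neq_Cmod_pos (w z : C) : w <> z -> 0 < Cmod (w - z).
Proof. intros H. apply Cmod_gt_0. now apply Cminus_eq_contra. Qed.

Lemma holo_on_disc_sub (f : C -> C) (z0 : C) (r r' : R) : r' <= r -> holo_on_disc f z0 r -> holo_on_disc f z0 r'.
Proof. intros H Hf w Hw. apply Hf. lra. Qed.

Lemma limit_unique (f g : C -> C) (z : C) (r : R) : 0 < r -> ccontinuous f z -> ccontinuous g z ->
  (forall w, 0 < Cmod (w - z) < r -> f w = g w) -> f z = g z.
Proof.
  intros Hr Hf Hg H. destruct (Ceq_dec (f z) (g z)) as [E|E]; [exact E|exfalso].
  apply neq_Cmod_pos in E. set (e := Cmod (f z - g z)) in *.
  destruct (Hf (e / 2)) as [d1 [Hd1 K1]]; [lra|]. destruct (Hg (e / 2)) as [d2 [Hd2 K2]]; [lra|].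
  destruct (ex_point_near z (Rmin r (Rmin d1 d2))) as [w [W1 W2]]; [repeat apply Rmin_glb_lt; lra|].
  assert (W3 := Rlt_le_trans _ _ _ W2 (Rmin_l _ _)). assert (W4 := Rlt_le_trans _ _ _ W2 (Rmin_r _ _)).
  assert (W5 := Rlt_le_trans _ _ _ W4 (Rmin_l _ _)). assert (W6 := Rlt_le_trans _ _ _ W4 (Rmin_r _ _)).
  specialize (K1 w W5). specialize (K2 w W6). rewrite (H w (conj W1 W3)) in K1.
  pose proof (Cmod_triangle3 (f z) (g w) (g z)) as T. rewrite (Cmod_minus_sym (f z) (g w)) in T.
  unfold e in *. lra.
Qed.

Lemma ex_cderiv_pow (n : nat) (z a : C) : exists l, cderiv (fun w => (w - a) ^ n)%C z l.
Proof.
  destruct n as [|n].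
  - exists 0. exact (cderiv_const 1 z).
  - eexists; apply cderiv_pow.
Qed.

(** Along the segment from [z0] to [z], the supremum of the parameters up to which [S] holds belongs
    to them by closedness and equals 1 by openness. *)
Lemma connected_C (S : C -> Prop) :
  (forall z, S z -> exists r, 0 < r /\ forall w, Cmod (w - z) < r -> S w) ->
  (forall z, (forall eps, 0 < eps -> exists w, Cmod (w - z) < eps /\ S w) -> S z) ->
  forall z0, S z0 -> forall z, S z.
Proof.
  intros Hopen Hclosed z0 H0 z.
  set (g := fun t : R => (z0 + RtoC t * (z - z0))%C).
  assert (Hg : forall s t, Cmod (g s - g t) = Rabs (s - t) * Cmod (z - z0)).
  { intros s t. unfold g. replace (z0 + RtoC s * (z - z0) - (z0 + RtoC t * (z - z0)))%C
      with (RtoC (s - t) * (z - z0))%C by (rewrite RtoC_minus; ring).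
    now rewrite Cmod_mult, Cmod_R. }
  pose proof (Cmod_ge_0 (z - z0)) as Pz. set (L := Cmod (z - z0)) in *.
  set (E := fun t => 0 <= t <= 1 /\ forall s, 0 <= s <= t -> S (g s)).
  assert (G0 : g 0 = z0) by (unfold g; ring).
  assert (E0 : E 0).
  { split; [lra|]. intros s Hs. replace s with 0 by lra. now rewrite G0. }
  destruct (completeness E) as [m [Hm1 Hm2]].
  { exists 1. intros t [Ht _]. lra. }
  { now exists 0. }
  assert (Hm0 : 0 <= m) by now apply Hm1.
  assert (Hm1' : m <= 1) by (apply Hm2; intros t [Ht _]; lra).
  assert (Below : forall s, 0 <= s < m -> S (g s)).
  { intros s Hs. apply NNPP. intros HN. assert (m <= s); [|lra].
    apply Hm2. intros t [Ht1 Ht2]. destruct (Rle_lt_dec t s); [assumption|].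
    exfalso. apply HN, Ht2. lra. }
  assert (Sm : S (g m)).
  { apply Hclosed. intros eps Heps. destruct (Req_dec m 0) as [Z|Z].
    - exists (g m). rewrite Cmod_self. split; [exact Heps|]. now rewrite Z, G0.
    - exists (g (Rmax 0 (m - eps / (2 * (L + 1))))).
      assert (0 < eps / (2 * (L + 1))) by (apply Rdiv_lt_0_compat; lra).
      assert (Hmx : 0 <= Rmax 0 (m - eps / (2 * (L + 1))) < m) by (split; [apply Rmax_l|apply Rmax_lub_lt; lra]).
      split; [|now apply Below].
      rewrite Hg. rewrite Rabs_left1 by lra.
      pose proof (Rmax_r 0 (m - eps / (2 * (L + 1)))).
      assert (eps / (2 * (L + 1)) * L < eps); [|nra].
      replace (eps / (2 * (L + 1)) * L) with (eps * (L / (2 * (L + 1)))) by (field; lra).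
      assert (L / (2 * (L + 1)) < 1) by (apply Rlt_div_l; lra). nra. }
  destruct (Hopen _ Sm) as [r [Hr Hb]].
  set (de := r / (2 * (L + 1))).
  assert (Hde : 0 < de) by (apply Rdiv_lt_0_compat; lra).
  assert (Above : forall s, m <= s <= m + de -> S (g s)).
  { intros s Hs. apply Hb. rewrite Hg, Rabs_right by lra.
    assert (de * L < r); [|nra]. unfold de.
    replace (r / (2 * (L + 1)) * L) with (r * (L / (2 * (L + 1)))) by (field; lra).
    assert (L / (2 * (L + 1)) < 1) by (apply Rlt_div_l; lra). nra. }
  assert (All : forall s, 0 <= s <= m + de -> S (g s)).
  { intros s Hs. destruct (Rlt_le_dec s m); [apply Below|apply Above]; lra. }
  destruct (Rle_lt_dec 1 (m + de)) as [Q|Q].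
  - replace z with (g 1) by (unfold g; ring). apply All; lra.
  - assert (m + de <= m); [|lra]. apply Hm1. split; [lra|exact All].
Qed.

(** Poles and regular points in one form, with exponent 0 at a regular point, so that later
    arguments need not treat them separately. *)
Lemma meromorphic_local_form (f : C -> C) (P : C -> Prop) (z : C) : meromorphic_with_poles f P ->
  exists (r : R) (m : nat) (g : C -> C), 0 < r /\ holo_on_disc g z r /\
    (forall w, 0 < Cmod (w - z) < r -> ~ P w /\ f w = (g w / (w - z) ^ m)%C) /\
    ((m <> O /\ P z /\ g z <> 0) \/ (m = O /\ ~ P z /\ f z = g z)).
Proof.
  intros [H1 H2]. destruct (classic (P z)) as [Pz|Pz].
  - destruct (H2 z Pz) as [[m [Hm [r1 [Hr1 [g [Hg [Ng E]]]]]]] [r2 [Hr2 K]]].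
    exists (Rmin r1 r2), m, g. split; [now apply Rmin_glb_lt|]. split; [|split].
    + eapply holo_on_disc_sub; [apply Rmin_l|exact Hg].
    + intros w [Hw1 Hw2]. apply Cmod_pos_neq in Hw1.
      assert (W3 := Rlt_le_trans _ _ _ Hw2 (Rmin_l _ _)). assert (W4 := Rlt_le_trans _ _ _ Hw2 (Rmin_r _ _)).
      split; [now apply K|]. rewrite (E w W3 Hw1). now rewrite cpow_Cpow.
    + left. split; [lia|]. split; assumption.
  - destruct (H1 z Pz) as [r [Hr K]]. exists r, O, f. split; [exact Hr|]. split; [|split].
    + intros w Hw. now apply K.
    + intros w [_ Hw]. split; [now apply K|]. simpl. field.
    + right. repeat split; assumption.
Qed.

Section MeroEq.

Variables (f1 f2 : C -> C) (P1 P2 : C -> Prop).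
Hypothesis M1 : meromorphic_with_poles f1 P1.
Hypothesis M2 : meromorphic_with_poles f2 P2.

(** Both notions stay off the poles, because the value of the total function at a pole is arbitrary,
    and use punctured discs, because [z] itself may be a pole. *)
Definition agree_accumulating (z : C) : Prop :=
  forall eps, 0 < eps -> exists w, 0 < Cmod (w - z) < eps /\ ~ P1 w /\ ~ P2 w /\ f1 w = f2 w.

Definition agree_near (z : C) : Prop :=
  exists r, 0 < r /\ forall w, 0 < Cmod (w - z) < r -> ~ P1 w /\ ~ P2 w /\ f1 w = f2 w.

(** Clearing denominators in the two local forms gives a holomorphic [h] whose zeros accumulate at
    [z], so it vanishes nearby. If only one function had a pole at [z], then [h z = 0] would make
    its numerator vanish there. *)
Lemma agree_acc_near (z : C) : agree_accumulating z ->
  agree_near z /\ (P1 z <-> P2 z) /\ (~ P1 z -> f1 z = f2 z).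
Proof.
  intros Ha.
  destruct (meromorphic_local_form f1 P1 z M1) as [r1 [m1 [g1 [Hr1 [Hg1 [E1 L1]]]]]].
  destruct (meromorphic_local_form f2 P2 z M2) as [r2 [m2 [g2 [Hr2 [Hg2 [E2 L2]]]]]].
  set (r := Rmin r1 r2). assert (Hr : 0 < r) by now apply Rmin_glb_lt.
  assert (R1 : r <= r1) by apply Rmin_l. assert (R2 : r <= r2) by apply Rmin_r.
  set (h := fun w => (g1 w * (w - z) ^ m2 - g2 w * (w - z) ^ m1)%C).
  assert (Hh : holo_on_disc h z r).
  { intros w Hw. destruct (Hg1 w ltac:(lra)) as [l1 D1]. destruct (Hg2 w ltac:(lra)) as [l2 D2].
    destruct (ex_cderiv_pow m1 w z) as [l3 D3]. destruct (ex_cderiv_pow m2 w z) as [l4 D4].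
    eexists. exact (cderiv_minus _ _ w _ _ (cderiv_mult _ _ w _ _ D1 D4) (cderiv_mult _ _ w _ _ D2 D3)). }
  assert (Hz : forall w, Cmod (w - z) < r / 3 -> h w = 0).
  { apply (holo_accum h z r Hr Hh). intros eps Heps.
    destruct (Ha (Rmin eps r)) as [w [[W1 W2] [_ [_ Ew]]]]; [now apply Rmin_glb_lt|].
    assert (W3 := Rlt_le_trans _ _ _ W2 (Rmin_l _ _)). assert (W4 := Rlt_le_trans _ _ _ W2 (Rmin_r _ _)).
    exists w. split; [split; assumption|].
    destruct (E1 w) as [_ F1]; [lra|]. destruct (E2 w) as [_ F2]; [lra|].
    rewrite F1, F2 in Ew. apply Cmod_pos_neq in W1.
    pose proof (Cpow_nz_sub w z m1 W1) as N1. pose proof (Cpow_nz_sub w z m2 W1) as N2.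
    unfold h. apply (f_equal (fun x => x * ((w - z) ^ m1 * (w - z) ^ m2))%C) in Ew.
    replace (g1 w / (w - z) ^ m1 * ((w - z) ^ m1 * (w - z) ^ m2))%C with (g1 w * (w - z) ^ m2)%C in Ew
      by (field; exact N1).
    replace (g2 w / (w - z) ^ m2 * ((w - z) ^ m1 * (w - z) ^ m2))%C with (g2 w * (w - z) ^ m1)%C in Ew
      by (field; exact N2).
    rewrite Ew. ring. }
  assert (H0 : h z = 0) by (apply Hz; rewrite Cmod_self; lra).
  assert (Z0 : (z - z)%C = 0) by ring.
  unfold h in H0. rewrite Z0 in H0.
  assert (Zp : forall m, m <> O -> (RtoC 0 ^ m)%C = 0) by (intros [|m] Hm; [lia|simpl; ring]).
  split; [|split].
  - exists (r / 3). split; [lra|]. intros w [W1 W2].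
    destruct (E1 w) as [Q1 F1]; [lra|]. destruct (E2 w) as [Q2 F2]; [lra|].
    split; [exact Q1|]. split; [exact Q2|].
    apply Cmod_pos_neq in W1.
    pose proof (Cpow_nz_sub w z m1 W1) as N1. pose proof (Cpow_nz_sub w z m2 W1) as N2.
    specialize (Hz w W2). unfold h in Hz. apply Ceq_minus in Hz. rewrite F1, F2.
    replace (g1 w / (w - z) ^ m1)%C with (g1 w * (w - z) ^ m2 / ((w - z) ^ m1 * (w - z) ^ m2))%C
      by (field; split; assumption).
    rewrite Hz. field; split; assumption.
  - destruct L1 as [[A1 [A2 A3]]|[A1 [A2 A3]]], L2 as [[B1 [B2 B3]]|[B1 [B2 B3]]]; try tauto; exfalso.
    + apply A3. subst m2. rewrite (Zp m1 A1) in H0. simpl in H0. rewrite <- H0. ring.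
    + apply B3. subst m1. rewrite (Zp m2 B1) in H0. simpl in H0.
      replace (g2 z) with (- (g1 z * 0 - g2 z * 1))%C by ring. rewrite H0. ring.
  - intros NP. destruct L1 as [[A1 [A2 A3]]|[A1 [A2 A3]]]; [tauto|].
    subst m1. destruct L2 as [[B1 [B2 B3]]|[B1 [B2 B3]]].
    + exfalso. apply B3. rewrite (Zp m2 B1) in H0. simpl in H0.
      replace (g2 z) with (- (g1 z * 0 - g2 z * 1))%C by ring. rewrite H0. ring.
    + subst m2. simpl in H0. rewrite A3, B3. apply Ceq_minus. rewrite <- H0. ring.
Qed.

(** The points satisfying [agree_near] form an open set, and a closed one because a limit of such
    points satisfies [agree_accumulating]. *)
Lemma meromorphic_identity (z0 : C) : agree_accumulating z0 ->
  forall z, (P1 z <-> P2 z) /\ (~ P1 z -> f1 z = f2 z).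
Proof.
  intros H0 z.
  assert (NA : forall z, agree_near z -> agree_accumulating z).
  { intros u [r [Hr K]] eps Heps. destruct (ex_point_near u (Rmin eps r)) as [w [W1 W2]]; [now apply Rmin_glb_lt|].
    assert (W3 := Rlt_le_trans _ _ _ W2 (Rmin_l _ _)). assert (W4 := Rlt_le_trans _ _ _ W2 (Rmin_r _ _)).
    exists w. split; [split; assumption|]. now apply K. }
  assert (All : agree_near z).
  { apply (connected_C agree_near) with (z0 := z0).
    - intros u [r [Hr K]]. exists r. split; [exact Hr|]. intros w Hw.
      destruct (Ceq_dec w u) as [->|Hwu]; [now exists r|]. apply neq_Cmod_pos in Hwu.
      exists (Rmin (Cmod (w - u)) (r - Cmod (w - u))). split; [apply Rmin_glb_lt; lra|].
      intros v [V1 V2]. apply K.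
      assert (W3 := Rlt_le_trans _ _ _ V2 (Rmin_l _ _)). assert (W4 := Rlt_le_trans _ _ _ V2 (Rmin_r _ _)).
      split.
      + apply neq_Cmod_pos. intros ->. rewrite Cmod_minus_sym in W3. lra.
      + pose proof (Cmod_triangle3 v w u). lra.
    - intros u Hu. apply agree_acc_near. intros eps Heps.
      destruct (Hu (eps / 2)) as [w [Hw Hn]]; [lra|].
      destruct Hn as [r [Hr K]].
      destruct (Ceq_dec w u) as [->|Hwu].
      { destruct (NA u (ex_intro _ r (conj Hr K)) eps Heps) as [v Hv]. now exists v. }
      apply neq_Cmod_pos in Hwu.
      destruct (ex_point_near w (Rmin r (Cmod (w - u)))) as [v [V1 V2]]; [now apply Rmin_glb_lt|].
      assert (W3 := Rlt_le_trans _ _ _ V2 (Rmin_l _ _)). assert (W4 := Rlt_le_trans _ _ _ V2 (Rmin_r _ _)).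
      exists v. split; [split|].
      + apply neq_Cmod_pos. intros ->. rewrite Cmod_minus_sym in W4. lra.
      + pose proof (Cmod_triangle3 v w u). lra.
      + apply K. lra.
    - now apply agree_acc_near. }
  now apply agree_acc_near, NA.
Qed.

End MeroEq.

(** * Solutions of s'^2 = s T(s) through a branch point *)
Lemma Cmult_eq_reg_l (a b c : C) : a <> 0 -> (a * b = a * c)%C -> b = c.
Proof.
  intros Ha E. apply Ceq_minus. destruct (Ceq_dec (b - c)%C 0) as [Y|Y]; [exact Y|].
  destruct (Cmult_neq_0 _ _ Ha Y). apply Ceq_minus in E. rewrite <- E. ring.
Qed.

Section SquareODE.

Variables (a0 a1 a2 a3 : C).
Hypothesis Ha0 : a0 <> 0.

Definition cubic_poly (x : C) : C := (a0 + a1 * x + a2 * (x * x) + a3 * (x * x * x))%C.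

(* Satisfied by [wp - e] at a point where [wp] takes the root [e], and by [1 / wp] at a pole. *)
Definition branch_sol (s : C -> C) (z0 : C) (r : R) : Prop :=
  s z0 = 0 /\
  (forall w, Cmod (w - z0) < r -> exists l, cderiv s w l /\ (l * l = s w * cubic_poly (s w))%C) /\
  (forall eps, 0 < eps -> exists w, Cmod (w - z0) < eps /\ s w <> 0).

Lemma branch_sol_holo (s : C -> C) (z0 : C) (r : R) : branch_sol s z0 r -> holo_on_disc s z0 r.
Proof. intros [_ [H _]] w Hw. destruct (H w Hw) as [l [Hl _]]. now exists l. Qed.

Lemma cderiv_cubic_poly (s : C -> C) (z l : C) : cderiv s z l -> exists l', cderiv (fun w => cubic_poly (s w)) z l'.
Proof. intros H. eexists. unfold cubic_poly. auto_cderiv. Qed.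

Lemma cderiv_pow_prod (k : nat) (g : C -> C) (z0 w l : C) : cderiv g w l ->
  cderiv (fun w => (w - z0) ^ S k * g w)%C w ((w - z0) ^ k * (INR (S k) * g w + (w - z0) * l)).
Proof.
  intros H. eapply cderiv_eq; [exact (cderiv_mult _ _ _ _ _ (cderiv_pow k w z0) H)|]. cbv beta. rewrite Cpow_S. ring.
Qed.

Lemma INR_S_neq0 (k : nat) : RtoC (INR (S k)) <> 0.
Proof. intros E. apply RtoC_inj in E. pose proof (lt_0_INR (S k) (Nat.lt_0_succ k)). lra. Qed.

(** Write s = (w - z0)^n g with g(z0) nonzero. Then s'^2 has order 2(n-1) and s T(s) has order n
    because T(0) = [a0] is nonzero, so n = 2. The leading coefficients give 4 g^2 = g [a0] at
    [z0]. *)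
Lemma branch_sol_order (s : C -> C) (z0 : C) (r : R) : 0 < r -> branch_sol s z0 r ->
  exists h, holo_on_disc h z0 r /\ (4 * h z0 = a0)%C /\
    forall w, Cmod (w - z0) < r -> s w = ((w - z0) ^ 2 * h w)%C.
Proof.
  intros Hr Hs. pose proof (branch_sol_holo s z0 r Hs) as Hh.
  destruct (holo_zero s z0 r Hr Hh) as [Z|[n [g [Hg [Ng E]]]]].
  { destruct Hs as [_ [_ N]]. destruct (N (r / 3)) as [w [Hw Nw]]; [lra|]. destruct Nw. now apply Z. }
  assert (D0 : Cmod (z0 - z0) < r) by (rewrite Cmod_self; exact Hr).
  destruct Hs as [S0 [Sd _]].
  destruct n as [|k].
  { exfalso. apply Ng. rewrite <- S0, (E z0 D0). simpl. ring. }
  destruct (holo_deriv g z0 r Hr Hg) as [g1 [Dg Hg1]].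
  set (A := fun w => (INR (S k) * g w + (w - z0) * g1 w)%C).
  assert (Eq : forall w, Cmod (w - z0) < r / 3 ->
    ((w - z0) ^ k * (w - z0) ^ k * (A w * A w) = (w - z0) ^ S k * (g w * cubic_poly (s w)))%C).
  { intros w Hw. destruct (Sd w ltac:(lra)) as [l [Dl El]].
    assert (l = ((w - z0) ^ k * A w)%C) as ->.
    { apply (cderiv_unique s w); [exact Dl|].
      eapply (cderiv_ext_loc (fun w => (w - z0) ^ S k * g w)%C s w _ (r - Cmod (w - z0))); [lra| |].
      - intros u Hu. symmetry. apply E. pose proof (Cmod_triangle3 u w z0). lra.
      - apply cderiv_pow_prod. now apply Dg. }
    rewrite (E w ltac:(lra)) in El at 1.
    replace ((w - z0) ^ k * (w - z0) ^ k * (A w * A w))%C with ((w - z0) ^ k * A w * ((w - z0) ^ k * A w))%C by ring.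
    rewrite El. ring. }
  assert (D3 : Cmod (z0 - z0) < r / 3) by (rewrite Cmod_self; lra).
  assert (Z0 : (z0 - z0)%C = 0) by ring.
  assert (A0 : A z0 = (INR (S k) * g z0)%C) by (unfold A; rewrite Z0; ring).
  (* Order n = 1: at [z0] the left side is g(z0)^2 while the right side vanishes. *)
  destruct k as [|k].
  { exfalso. specialize (Eq z0 D3). rewrite A0, Z0 in Eq. simpl in Eq. apply Ng.
    assert (Q : (g z0 * g z0 = 0)%C).
    { transitivity (1 * 1 * (1 * g z0 * (1 * g z0)))%C; [ring|]. rewrite Eq. ring. }
    destruct (Ceq_dec (g z0) 0) as [G|G]; [exact G|]. destruct (Cmult_neq_0 _ _ G G). exact Q. }
  pose proof (Dg z0 D3) as Dgz. destruct (Hg1 z0 D3) as [l1 Dg1].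
  destruct (Sd z0 D0) as [ls [Ds _]]. destruct (cderiv_cubic_poly s z0 ls Ds) as [lc Dc].
  destruct (ex_cderiv_pow k z0 z0) as [lp Dp].
  (* Now the order is k + 2. The common power can be cancelled only off [z0]; continuity carries the
     quotient identity to [z0]. *)
  assert (Lim : ((z0 - z0) ^ k * (A z0 * A z0) = g z0 * cubic_poly (s z0))%C).
  { assert (DA : exists l, cderiv A z0 l) by (eexists; unfold A; auto_cderiv). destruct DA as [lA DA].
    apply (limit_unique (fun w => (w - z0) ^ k * (A w * A w))%C (fun w => g w * cubic_poly (s w))%C z0 (r / 3)); [lra| | |].
    - exact (cderiv_continuous _ _ _ (cderiv_mult _ _ _ _ _ Dp (cderiv_mult _ _ _ _ _ DA DA))).
    - exact (cderiv_continuous _ _ _ (cderiv_mult _ _ _ _ _ Dgz Dc)).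
    - intros w [W1 W2]. specialize (Eq w W2). apply Cmod_pos_neq in W1.
      apply (Cmult_eq_reg_l _ _ _ (Cpow_nz_sub w z0 (S (S k)) W1)). rewrite <- Eq, !Cpow_S. ring. }
  rewrite A0, Z0, S0 in Lim.
  assert (C0 : cubic_poly 0 = a0) by (unfold cubic_poly; ring). rewrite C0 in Lim.
  destruct k as [|k].
  - exists g. split; [exact Hg|]. split; [|exact E].
    apply (Cmult_eq_reg_l _ _ _ Ng). rewrite <- Lim. simpl INR. rewrite RtoC_plus. simpl. ring.
  - exfalso. destruct (Cmult_neq_0 _ _ Ng Ha0). rewrite <- Lim. simpl. ring.
Qed.

(** Both solutions start with (a0/4)(w - z0)^2. If s - t had finite order N > 2 with leading
    coefficient g, then (s' + t')(s' - t') = s T(s) - t T(t) would give [a0] N g = [a0] g at order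
    N, which is impossible. *)
Lemma branch_sol_unique (s t : C -> C) (z0 : C) (r : R) : 0 < r -> branch_sol s z0 r -> branch_sol t z0 r ->
  exists r', 0 < r' /\ forall w, Cmod (w - z0) < r' -> s w = t w.
Proof.
  intros Hr Hs Ht.
  destruct (branch_sol_order s z0 r Hr Hs) as [h [Hh [H0 Eh]]].
  destruct (branch_sol_order t z0 r Hr Ht) as [k [Hk [K0 Ek]]].
  assert (HE : holo_on_disc (fun w => h w - k w)%C z0 r).
  { intros w Hw. destruct (Hh w Hw) as [l1 D1]. destruct (Hk w Hw) as [l2 D2].
    eexists. exact (cderiv_minus _ _ _ _ _ D1 D2). }
  destruct (holo_zero _ z0 r Hr HE) as [Z|[n [g [Hg [Ng E]]]]].
  { exists (r / 3). split; [lra|]. intros w Hw. rewrite (Eh w ltac:(lra)), (Ek w ltac:(lra)).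
    specialize (Z w Hw). cbv beta in Z. apply Ceq_minus in Z. now rewrite Z. }
  exfalso.
  assert (D0 : Cmod (z0 - z0) < r) by (rewrite Cmod_self; exact Hr).
  assert (D3 : Cmod (z0 - z0) < r / 3) by (rewrite Cmod_self; lra).
  assert (Z0 : (z0 - z0)%C = 0) by ring.
  assert (N4 : RtoC 4 <> 0) by (intros X; apply RtoC_inj in X; lra).
  assert (H0' : h z0 = (a0 / 4)%C) by (rewrite <- H0; field).
  assert (K0' : k z0 = (a0 / 4)%C) by (rewrite <- K0; field).
  destruct n as [|n].
  { apply Ng. specialize (E z0 D0). cbv beta in E. rewrite H0', K0' in E. simpl in E.
    transitivity (1 * g z0)%C; [ring|]. rewrite <- E. ring. }
  destruct (holo_deriv h z0 r Hr Hh) as [h1 [Dh Hh1]].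
  destruct (holo_deriv k z0 r Hr Hk) as [k1 [Dk Hk1]].
  destruct (holo_deriv g z0 r Hr Hg) as [g1 [Dg Hg1]].
  destruct Hs as [S0 [Sd _]]. destruct Ht as [T0 [Td _]].
  set (Sg := fun w => (2 * (h w + k w) + (w - z0) * (h1 w + k1 w))%C).
  set (A := fun w => (INR (S (S (S n))) * g w + (w - z0) * g1 w)%C).
  (* The divided difference (s T(s) - t T(t))/(s - t), whose value at [z0] is [a0]. *)
  set (U := fun w => (a0 + a1 * (s w + t w) + a2 * (s w * s w + s w * t w + t w * t w)
    + a3 * (s w * s w * s w + s w * s w * t w + s w * t w * t w + t w * t w * t w))%C).
  assert (Eq : forall w, Cmod (w - z0) < r / 3 ->
    ((w - z0) ^ S (S (S n)) * (Sg w * A w) = (w - z0) ^ S (S (S n)) * (g w * U w))%C).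
  { intros w Hw. destruct (Sd w ltac:(lra)) as [l [Dl El]]. destruct (Td w ltac:(lra)) as [m [Dm Em]].
    assert (Sub : forall u, Cmod (u - w) < r - Cmod (w - z0) -> Cmod (u - z0) < r).
    { intros u Hu. pose proof (Cmod_triangle3 u w z0). lra. }
    assert (l = ((w - z0) ^ 1 * (INR 2 * h w + (w - z0) * h1 w))%C) as L1.
    { apply (cderiv_unique s w); [exact Dl|].
      eapply (cderiv_ext_loc (fun w => (w - z0) ^ 2 * h w)%C s w _ (r - Cmod (w - z0))); [lra| |].
      - intros u Hu. symmetry. now apply Eh, Sub.
      - apply (cderiv_pow_prod 1). now apply Dh. }
    assert (m = ((w - z0) ^ 1 * (INR 2 * k w + (w - z0) * k1 w))%C) as L2.
    { apply (cderiv_unique t w); [exact Dm|].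
      eapply (cderiv_ext_loc (fun w => (w - z0) ^ 2 * k w)%C t w _ (r - Cmod (w - z0))); [lra| |].
      - intros u Hu. symmetry. now apply Ek, Sub.
      - apply (cderiv_pow_prod 1). now apply Dk. }
    assert (Est : forall u, Cmod (u - z0) < r -> (s u - t u = (u - z0) ^ S (S (S n)) * g u)%C).
    { intros u Hu. rewrite (Eh u Hu), (Ek u Hu). specialize (E u Hu). cbv beta in E.
      transitivity ((u - z0) ^ 2 * (h u - k u))%C; [ring|]. rewrite E, !Cpow_S. simpl. ring. }
    assert ((l - m)%C = ((w - z0) ^ S (S n) * A w)%C) as L3.
    { apply (cderiv_unique (fun u => s u - t u)%C w); [exact (cderiv_minus _ _ _ _ _ Dl Dm)|].
      eapply (cderiv_ext_loc (fun w => (w - z0) ^ S (S (S n)) * g w)%C _ w _ (r - Cmod (w - z0))); [lra| |].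
      - intros u Hu. symmetry. now apply Est, Sub.
      - apply cderiv_pow_prod. now apply Dg. }
    assert (L4 : (l + m = (w - z0) * Sg w)%C).
    { rewrite L1, L2. unfold Sg. simpl INR. rewrite RtoC_plus. simpl. ring. }
    transitivity ((l + m) * (l - m))%C.
    { rewrite L4, L3, (Cpow_S (w - z0) (S (S n))). ring. }
    transitivity (l * l - m * m)%C; [ring|]. rewrite El, Em.
    transitivity ((s w - t w) * U w)%C; [unfold U, cubic_poly; ring|].
    rewrite (Est w ltac:(lra)). ring. }
  pose proof (Dh z0 D3) as Dhz. destruct (Hh1 z0 D3) as [l1 Dh1].
  pose proof (Dk z0 D3) as Dkz. destruct (Hk1 z0 D3) as [l2 Dk1].
  pose proof (Dg z0 D3) as Dgz. destruct (Hg1 z0 D3) as [l3 Dg1].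
  destruct (Sd z0 D0) as [ls [Ds _]]. destruct (Td z0 D0) as [lt [Dt _]].
  assert (Lim : (Sg z0 * A z0 = g z0 * U z0)%C).
  { assert (DS : exists l, cderiv Sg z0 l) by (eexists; unfold Sg; auto_cderiv). destruct DS as [lS DS].
    assert (DA : exists l, cderiv A z0 l) by (eexists; unfold A; auto_cderiv). destruct DA as [lA DA].
    assert (DU : exists l, cderiv U z0 l) by (eexists; unfold U; auto_cderiv). destruct DU as [lU DU].
    apply (limit_unique (fun w => Sg w * A w)%C (fun w => g w * U w)%C z0 (r / 3)); [lra| | |].
    - exact (cderiv_continuous _ _ _ (cderiv_mult _ _ _ _ _ DS DA)).
    - exact (cderiv_continuous _ _ _ (cderiv_mult _ _ _ _ _ Dgz DU)).
    - intros w [W1 W2]. apply Cmod_pos_neq in W1.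
      apply (Cmult_eq_reg_l _ _ _ (Cpow_nz_sub w z0 (S (S (S n))) W1)). now apply Eq. }
  unfold Sg, A, U in Lim. rewrite Z0, H0', K0', S0, T0 in Lim.
  (* The order is N = [S (S (S n))], and [Lim] says (N - 1) [a0] g(z0) = 0, with N - 1 =
     [S (S n)]. *)
  destruct (Cmult_neq_0 _ _ Ha0 (Cmult_neq_0 _ _ Ng (INR_S_neq0 (S n)))).
  rewrite (S_INR (S (S n))), RtoC_plus in Lim.
  transitivity ((2 * (a0 / 4 + a0 / 4) + 0 * (h1 z0 + k1 z0)) * ((INR (S (S n)) + 1) * g z0 + 0 * g1 z0)
    - a0 * g z0)%C; [field|].
  rewrite Lim. ring.
Qed.

End SquareODE.

(** * Solutions of the Weierstrass equation *)
(** The condition on [s] means a sign, so translations and the reflection are covered together.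
    Distances are preserved, and (s(w-z))^m differs from (w-z)^m by the factor s^m, which moves into
    the numerator. *)
Lemma pole_of_order_affine (f : C -> C) (z s a : C) (m : nat) : (s * s = 1)%C ->
  pole_of_order f (s * z + a)%C m -> pole_of_order (fun w => f (s * w + a)%C) z m.
Proof.
  intros Hs [Hm [r [Hr [g [Hg [Ng E]]]]]].
  assert (Hms : Cmod s = 1).
  { apply (f_equal Cmod) in Hs. rewrite Cmod_mult, Cmod_1 in Hs. pose proof (Cmod_ge_0 s). nra. }
  assert (Ns : s <> 0) by (apply Cmod_gt_0; lra).
  assert (D : forall w, (s * w + a - (s * z + a) = s * (w - z))%C) by (intros; ring).
  assert (Dm : forall w, Cmod (s * w + a - (s * z + a)) = Cmod (w - z)).
  { intros w. rewrite D, Cmod_mult, Hms. ring. }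
  split; [exact Hm|]. exists r. split; [exact Hr|].
  exists (fun w => (s ^ m * g (s * w + a))%C). split; [|split].
  - intros w Hw. destruct (Hg (s * w + a)%C) as [l Hl]; [now rewrite Dm|].
    assert (Da : cderiv (fun w => s * w + a)%C w (0 * w + s * 1 + 0)) by auto_cderiv.
    eexists. exact (cderiv_mult _ _ _ _ _ (cderiv_const (s ^ m)%C w) (cderiv_comp g (fun w => s * w + a)%C w _ _ Hl Da)).
  - apply Cmult_neq_0; [now apply Cpow_nz|exact Ng].
  - intros w Hw Hwz. rewrite E.
    + rewrite !cpow_Cpow, D, Cpow_mult_l.
      assert (S2 : (s ^ m * s ^ m = 1)%C) by (rewrite <- Cpow_mult_l, Hs; apply Cpow_1_l).
      pose proof (Cpow_nz_sub w z m Hwz) as N. pose proof (Cpow_nz s m Ns) as N'.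
      apply (Cmult_eq_reg_l (s ^ m * (w - z) ^ m)%C); [now apply Cmult_neq_0|].
      transitivity (g (s * w + a)%C); [field; split; assumption|].
      transitivity ((s ^ m * s ^ m) * g (s * w + a)%C)%C; [rewrite S2; ring|field; assumption].
    + now rewrite Dm.
    + intros X. apply Hwz. apply (Cmult_eq_reg_l s); [exact Ns|].
      apply Ceq_minus in X. apply Ceq_minus. rewrite <- X. ring.
Qed.

Lemma meromorphic_affine (f : C -> C) (P : C -> Prop) (s a : C) : (s * s = 1)%C ->
  meromorphic_with_poles f P ->
  meromorphic_with_poles (fun w => f (s * w + a)%C) (fun w => P (s * w + a)%C).
Proof.
  intros Hs [H1 H2].
  assert (Hms : Cmod s = 1).
  { apply (f_equal Cmod) in Hs. rewrite Cmod_mult, Cmod_1 in Hs. pose proof (Cmod_ge_0 s). nra. }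
  assert (Ns : s <> 0) by (apply Cmod_gt_0; lra).
  assert (Dm : forall w z, Cmod (s * w + a - (s * z + a)) = Cmod (w - z)).
  { intros w z. replace (s * w + a - (s * z + a))%C with (s * (w - z))%C by ring.
    rewrite Cmod_mult, Hms. ring. }
  split.
  - intros z Hz. destruct (H1 _ Hz) as [r [Hr K]]. exists r. split; [exact Hr|].
    intros w Hw. destruct (K (s * w + a)%C) as [K1 [l K2]]; [now rewrite Dm|].
    split; [exact K1|].
    assert (Da : cderiv (fun w => s * w + a)%C w (0 * w + s * 1 + 0)) by auto_cderiv.
    eexists. exact (cderiv_comp f (fun w => s * w + a)%C w _ _ K2 Da).
  - intros z Hz. destruct (H2 _ Hz) as [[m Hm] [r [Hr K]]]. split.
    + exists m. now apply pole_of_order_affine.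
    + exists r. split; [exact Hr|]. intros w Hw Hwz. apply K; [now rewrite Dm|].
      intros X. apply Hwz. apply (Cmult_eq_reg_l s); [exact Ns|].
      apply Ceq_minus in X. apply Ceq_minus. rewrite <- X. ring.
Qed.

Lemma pole_of_order_affine_post (f : C -> C) (z al be : C) (m : nat) : be <> 0 ->
  pole_of_order f z m -> pole_of_order (fun w => al + be * f w)%C z m.
Proof.
  intros Hb [Hm [r [Hr [g [Hg [Ng E]]]]]]. split; [exact Hm|]. exists r. split; [exact Hr|].
  exists (fun w => al * (w - z) ^ m + be * g w)%C. split; [|split].
  - intros w Hw. destruct (Hg w Hw) as [l Hl]. destruct (ex_cderiv_pow m w z) as [l' Hl'].
    eexists. exact (cderiv_plus _ _ _ _ _ (cderiv_mult _ _ _ _ _ (cderiv_const al w) Hl')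
      (cderiv_mult _ _ _ _ _ (cderiv_const be w) Hl)).
  - replace (z - z)%C with (RtoC 0) by ring. destruct m as [|m]; [lia|]. rewrite Cpow_S.
    replace (al * (0 * 0 ^ m) + be * g z)%C with (be * g z)%C by ring. now apply Cmult_neq_0.
  - intros w Hw Hwz. rewrite (E w Hw Hwz), cpow_Cpow.
    pose proof (Cpow_nz_sub w z m Hwz). field. assumption.
Qed.

Lemma meromorphic_affine_post (f : C -> C) (P : C -> Prop) (al be : C) : be <> 0 ->
  meromorphic_with_poles f P -> meromorphic_with_poles (fun w => al + be * f w)%C P.
Proof.
  intros Hb [H1 H2]. split.
  - intros z Hz. destruct (H1 z Hz) as [r [Hr K]]. exists r. split; [exact Hr|].
    intros w Hw. destruct (K w Hw) as [K1 [l K2]]. split; [exact K1|].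
    eexists. exact (cderiv_plus _ _ _ _ _ (cderiv_const al w) (cderiv_mult _ _ _ _ _ (cderiv_const be w) K2)).
  - intros z Hz. destruct (H2 z Hz) as [[m Hm] K]. split; [|exact K].
    exists m. now apply pole_of_order_affine_post.
Qed.

(** * Complex conjugation *)

Lemma Cmod_Cconj (z : C) : Cmod (Cconj z) = Cmod z.
Proof. unfold Cmod, Cconj; simpl. f_equal. ring. Qed.

Lemma Cconj_minus (a b : C) : Cconj (a - b) = (Cconj a - Cconj b)%C.
Proof. apply injective_projections; simpl; ring. Qed.

Lemma Cconj_mult (a b : C) : Cconj (a * b) = (Cconj a * Cconj b)%C.
Proof. apply injective_projections; simpl; ring. Qed.

Lemma Cconj_R (x : R) : Cconj (RtoC x) = RtoC x.
Proof. apply injective_projections; simpl; ring. Qed.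

Lemma Cconj_inv (z : C) : Cconj (Cconj z) = z.
Proof. apply injective_projections; simpl; ring. Qed.

Lemma Cconj_pow (z : C) (n : nat) : Cconj (z ^ n) = (Cconj z ^ n)%C.
Proof. induction n as [|n IH]; [apply Cconj_R|]. now rewrite !Cpow_S, Cconj_mult, IH. Qed.

Lemma cderiv_conj (f : C -> C) (z l : C) : cderiv f (Cconj z) l -> cderiv (fun w => Cconj (f (Cconj w))) z (Cconj l).
Proof.
  rewrite !cderiv_eps. intros H eps Heps. destruct (H eps Heps) as [d [Hd K]]. exists d. split; [exact Hd|].
  intros w Hw. specialize (K (Cconj w)). rewrite <- Cconj_minus, Cmod_Cconj in K. specialize (K Hw).
  rewrite <- !Cconj_minus.
  replace (Cconj l * (w - z))%C with (Cconj (l * Cconj (w - z))) by (now rewrite Cconj_mult, Cconj_inv).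
  now rewrite <- Cconj_minus, Cmod_Cconj.
Qed.

Lemma meromorphic_conj (f : C -> C) (P : C -> Prop) : meromorphic_with_poles f P ->
  meromorphic_with_poles (fun w => Cconj (f (Cconj w))) (fun w => P (Cconj w)).
Proof.
  intros [H1 H2].
  assert (Dm : forall w z, Cmod (Cconj w - Cconj z) = Cmod (w - z)).
  { intros. now rewrite <- Cconj_minus, Cmod_Cconj. }
  assert (Nq : forall w z, w <> z -> Cconj w <> Cconj z).
  { intros w z N E. apply N. rewrite <- (Cconj_inv w), E. apply Cconj_inv. }
  split.
  - intros z Hz. destruct (H1 _ Hz) as [r [Hr K]]. exists r. split; [exact Hr|].
    intros w Hw. destruct (K (Cconj w)) as [K1 [l K2]]; [now rewrite Dm|].
    split; [exact K1|]. eexists. exact (cderiv_conj f w l K2).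
  - intros z Hz. destruct (H2 _ Hz) as [[m Hm] [r [Hr K]]]. split.
    + exists m. destruct Hm as [Hm [r' [Hr' [g [Hg [Ng E]]]]]]. split; [exact Hm|].
      exists r'. split; [exact Hr'|]. exists (fun w => Cconj (g (Cconj w))). split; [|split].
      * intros w Hw. destruct (Hg (Cconj w)) as [l Hl]; [now rewrite Dm|].
        eexists. exact (cderiv_conj g w l Hl).
      * intros X. apply Ng. rewrite <- (Cconj_inv (g _)), X. apply Cconj_R.
      * intros w Hw Hwz. rewrite E; [|now rewrite Dm|now apply Nq].
        rewrite !cpow_Cpow, <- Cconj_minus, <- Cconj_pow.
        pose proof (Cpow_nz_sub w z m Hwz) as N.
        assert (N' : Cconj ((w - z) ^ m) <> 0).
        { intros X. apply N. rewrite <- (Cconj_inv (_ ^ m)), X. apply Cconj_R. }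
        apply (Cmult_eq_reg_l ((w - z) ^ m)%C); [exact N|].
        rewrite <- (Cconj_inv ((w - z) ^ m)) at 1. rewrite <- Cconj_mult.
        replace (Cconj ((w - z) ^ m) * (g (Cconj w) / Cconj ((w - z) ^ m)))%C with (g (Cconj w))
          by (field; exact N').
        field. exact N.
    + exists r. split; [exact Hr|]. intros w Hw Hwz. apply K; [now rewrite Dm|now apply Nq].
Qed.

Lemma meromorphic_const (e : C) : meromorphic_with_poles (fun _ => e) (fun _ => False).
Proof.
  split; [|tauto]. intros z _. exists 1. split; [lra|]. intros w _. split; [tauto|].
  exists (RtoC 0). exact (cderiv_const e w).
Qed.

Lemma branch_sol_sub (a0 a1 a2 a3 : C) (s : C -> C) (z0 : C) (r r' : R) : r' <= r ->
  branch_sol a0 a1 a2 a3 s z0 r -> branch_sol a0 a1 a2 a3 s z0 r'.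
Proof. intros H [S0 [Sd N]]. split; [exact S0|]. split; [|exact N]. intros w Hw. apply Sd. lra. Qed.

Section Weierstrass.

Variables (g2 g3 : C).

Definition weierstrass_ode (f : C -> C) (P : C -> Prop) : Prop :=
  forall z, ~ P z -> exists l, cderiv f z l /\ (l * l = 4 * cpow (f z) 3 - g2 * f z - g3)%C.

Lemma weierstrass_ode_affine (f : C -> C) (P : C -> Prop) (s a : C) : (s * s = 1)%C ->
  weierstrass_ode f P -> weierstrass_ode (fun w => f (s * w + a)%C) (fun w => P (s * w + a)%C).
Proof.
  intros Hs H z Hz. destruct (H _ Hz) as [l [Hl E]].
  assert (Da : cderiv (fun w => s * w + a)%C z (0 * z + s * 1 + 0)) by auto_cderiv.
  eexists. split; [exact (cderiv_comp f (fun w => s * w + a)%C z _ _ Hl Da)|]. rewrite <- E.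
  transitivity ((s * s) * (l * l))%C; [ring|]. rewrite Hs. ring.
Qed.

(** The coefficients are those of the Taylor expansion of 4 x^3 - g2 x - g3 at its root e, divided
    by x - e. *)
Lemma weierstrass_ode_branch_sol (f : C -> C) (P : C -> Prop) (z0 e : C) :
  meromorphic_with_poles f P -> weierstrass_ode f P -> (exists p, P p) -> ~ P z0 -> f z0 = e ->
  (4 * e * e * e - g2 * e - g3 = 0)%C ->
  exists r, 0 < r /\ branch_sol (12 * e * e - g2) (12 * e) 4 0 (fun w => f w - e)%C z0 r /\
    forall w, Cmod (w - z0) < r -> ~ P w.
Proof.
  intros Hm Hw [p Hp] Hz Hf He.
  destruct (proj1 Hm z0 Hz) as [r [Hr K]]. exists r. split; [exact Hr|]. split; [|intros w W; now apply K].
  split; [|split].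
  - rewrite Hf. ring.
  - intros w W. destruct (Hw w (proj1 (K w W))) as [l [Hl E]].
    exists (l - 0)%C. split; [exact (cderiv_minus _ _ _ _ _ Hl (cderiv_const e w))|].
    transitivity (l * l)%C; [ring|]. rewrite E.
    transitivity (4 * cpow (f w) 3 - g2 * f w - g3 - (4 * e * e * e - g2 * e - g3))%C.
    + rewrite He. ring.
    + unfold cubic_poly. simpl. ring.
  - intros eps Heps. apply NNPP. intros HN.
    (* If [f] were equal to [e] near [z0], it would share the empty pole set of the constant,
       against the pole [p]. *)
    destruct (meromorphic_identity f (fun _ => e) P (fun _ => False) Hm (meromorphic_const e) z0) with (z := p) as [X _]; [|tauto].
    intros eps' Heps'. destruct (ex_point_near z0 (Rmin eps' (Rmin eps r))) as [w [W1 W2]].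
    { repeat apply Rmin_glb_lt; lra. }
    assert (W3 := Rlt_le_trans _ _ _ W2 (Rmin_l _ _)). assert (W4 := Rlt_le_trans _ _ _ W2 (Rmin_r _ _)).
    assert (W5 := Rlt_le_trans _ _ _ W4 (Rmin_l _ _)). assert (W6 := Rlt_le_trans _ _ _ W4 (Rmin_r _ _)).
    exists w. split; [split; assumption|]. split; [now apply K|]. split; [tauto|].
    apply Ceq_minus. apply NNPP. intros Y. apply HN. now exists w.
Qed.

(** For s = 1/f one gets s'^2 = (4 f^3 - g2 f - g3)/f^4 = s (4 - g2 s^2 - g3 s^3), with constant
    term 4 whatever g2 and g3 are. The numerator of the local form extends [s] across [p]. *)
Lemma weierstrass_pole_branch_sol (f : C -> C) (P : C -> Prop) (p : C) :
  meromorphic_with_poles f P -> weierstrass_ode f P -> P p ->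
  exists r s, 0 < r /\ branch_sol 4 0 (- g2) (- g3) s p r /\
    forall w, 0 < Cmod (w - p) < r -> ~ P w /\ s w <> 0 /\ f w = (/ s w)%C.
Proof.
  intros Hm Hw Hp.
  destruct (meromorphic_local_form f P p Hm) as [r [m [g [Hr [Hg [E L]]]]]].
  destruct L as [[Nm [_ Ng]]|[_ [X _]]]; [|tauto].
  assert (Dp : Cmod (p - p) < r) by (rewrite Cmod_self; exact Hr).
  destruct (Hg p Dp) as [l0 Hl0].
  destruct (ccontinuous_neq0 g p (cderiv_continuous _ _ _ Hl0) Ng) as [del [Hdel K]].
  set (rho := Rmin r del). assert (Hrho : 0 < rho) by now apply Rmin_glb_lt.
  assert (R1 : rho <= r) by apply Rmin_l. assert (R2 : rho <= del) by apply Rmin_r.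
  assert (Gn : forall w, Cmod (w - p) < rho -> g w <> 0).
  { intros w W. apply Cmod_gt_0. pose proof (K w ltac:(lra)). pose proof (Cmod_ge_0 (g p)). lra. }
  set (s := fun w => ((w - p) ^ m / g w)%C).
  assert (Hs : holo_on_disc s p rho).
  { intros w W. destruct (Hg w ltac:(lra)) as [l Hl]. destruct (ex_cderiv_pow m w p) as [l' Hl'].
    eexists. exact (cderiv_div _ _ _ _ _ (Gn w W) Hl' Hl). }
  destruct (holo_deriv s p rho Hrho Hs) as [s1 [Ds Hs1]].
  assert (Off : forall w, 0 < Cmod (w - p) < rho -> ~ P w /\ s w <> 0 /\ f w = (/ s w)%C).
  { intros w [W1 W2]. destruct (E w ltac:(lra)) as [Q F]. split; [exact Q|].
    apply Cmod_pos_neq in W1. pose proof (Cpow_nz_sub w p m W1) as N. pose proof (Gn w W2) as N'.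
    split.
    - apply Cmult_neq_0; [exact N|]. intros X. apply (f_equal (fun x => g w * x)%C) in X.
      rewrite Cinv_r in X by exact N'. apply C1_nz. rewrite X. ring.
    - rewrite F. unfold s. field. split; assumption. }
  assert (s p = 0) as S0.
  { unfold s. replace (p - p)%C with (RtoC 0) by ring. destruct m as [|m]; [lia|]. rewrite Cpow_S.
    field. exact Ng. }
  set (T := cubic_poly 4 0 (- g2) (- g3)).
  assert (Ode : forall w, 0 < Cmod (w - p) < rho / 3 -> (s1 w * s1 w = s w * T (s w))%C).
  { intros w [W1 W2]. destruct (Off w ltac:(lra)) as [Q [N F]].
    destruct (Hw w Q) as [l [Hl El]].
    assert (Nf : f w <> 0).
    { rewrite F. intros X. apply (f_equal (fun x => s w * x)%C) in X.
      rewrite Cinv_r in X by exact N. apply C1_nz. rewrite X. ring. }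
    assert (s1 w = (- l / (f w * f w))%C) as ->.
    { apply (cderiv_unique s w); [apply Ds; lra|].
      eapply (cderiv_ext_loc (fun w => / f w)%C s w _ (Rmin (Cmod (w - p)) (rho - Cmod (w - p))));
        [apply Rmin_glb_lt; lra| |exact (cderiv_inv _ _ _ Nf Hl)].
      intros u U. assert (U1 := Rlt_le_trans _ _ _ U (Rmin_l _ _)).
      assert (U2 := Rlt_le_trans _ _ _ U (Rmin_r _ _)).
      assert (0 < Cmod (u - p) < rho) as Hu.
      { split.
        - apply neq_Cmod_pos. intros ->. rewrite Cmod_minus_sym in U1. lra.
        - pose proof (Cmod_triangle3 u w p). lra. }
      destruct (Off u Hu) as [_ [Nu Fu]]. rewrite Fu. field. exact Nu. }
    transitivity ((l * l) / (f w * f w * (f w * f w)))%C; [field; exact Nf|].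
    rewrite El, F. unfold T, cubic_poly. simpl. field. exact N. }
  assert (Dp3 : Cmod (p - p) < rho / 3) by (rewrite Cmod_self; lra).
  (* The equation of [f] says nothing at its pole; the one for [s] is obtained there as a limit. *)
  assert (Ode0 : (s1 p * s1 p = s p * T (s p))%C).
  { destruct (Hs1 p Dp3) as [l1 D1]. pose proof (Ds p Dp3) as D2.
    destruct (cderiv_cubic_poly 4 0 (- g2) (- g3) s p _ D2) as [l3 D3].
    apply (limit_unique (fun w => s1 w * s1 w)%C (fun w => s w * T (s w))%C p (rho / 3)); [lra| | |exact Ode].
    - exact (cderiv_continuous _ _ _ (cderiv_mult _ _ _ _ _ D1 D1)).
    - exact (cderiv_continuous _ _ _ (cderiv_mult _ _ _ _ _ D2 D3)). }
  exists (rho / 3), s. split; [lra|]. split; [|intros w W; apply Off; lra].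
  split; [exact S0|]. split.
  - intros w W. exists (s1 w). split; [now apply Ds|].
    destruct (Ceq_dec w p) as [->|N]; [exact Ode0|]. apply Ode. split; [now apply neq_Cmod_pos|exact W].
  - intros eps Heps. destruct (ex_point_near p (Rmin eps rho)) as [w [W1 W2]]; [now apply Rmin_glb_lt|].
    assert (W3 := Rlt_le_trans _ _ _ W2 (Rmin_l _ _)). assert (W4 := Rlt_le_trans _ _ _ W2 (Rmin_r _ _)).
    exists w. split; [exact W3|]. now apply Off.
Qed.

Lemma C4_neq0 : RtoC 4 <> 0.
Proof. intros X; apply RtoC_inj in X; lra. Qed.

Lemma weierstrass_ode_eq_of_pole (f1 f2 : C -> C) (P1 P2 : C -> Prop) (p : C) :
  meromorphic_with_poles f1 P1 -> weierstrass_ode f1 P1 -> meromorphic_with_poles f2 P2 -> weierstrass_ode f2 P2 ->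
  P1 p -> P2 p -> forall z, (P1 z <-> P2 z) /\ (~ P1 z -> f1 z = f2 z).
Proof.
  intros M1 W1 M2 W2 Hp1 Hp2.
  destruct (weierstrass_pole_branch_sol f1 P1 p M1 W1 Hp1) as [r1 [s1 [Hr1 [S1 E1]]]].
  destruct (weierstrass_pole_branch_sol f2 P2 p M2 W2 Hp2) as [r2 [s2 [Hr2 [S2 E2]]]].
  set (r := Rmin r1 r2). assert (Hr : 0 < r) by now apply Rmin_glb_lt.
  assert (R1 : r <= r1) by apply Rmin_l. assert (R2 : r <= r2) by apply Rmin_r.
  destruct (branch_sol_unique 4 0 (- g2) (- g3) C4_neq0 s1 s2 p r Hr (branch_sol_sub _ _ _ _ _ _ _ _ R1 S1)
    (branch_sol_sub _ _ _ _ _ _ _ _ R2 S2)) as [r' [Hr' Eq]].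
  apply (meromorphic_identity f1 f2 P1 P2 M1 M2 p). intros eps Heps.
  destruct (ex_point_near p (Rmin eps (Rmin r r'))) as [w [V1 V2]]; [repeat apply Rmin_glb_lt; lra|].
  assert (W3 := Rlt_le_trans _ _ _ V2 (Rmin_l _ _)). assert (W4 := Rlt_le_trans _ _ _ V2 (Rmin_r _ _)).
  assert (W5 := Rlt_le_trans _ _ _ W4 (Rmin_l _ _)). assert (W6 := Rlt_le_trans _ _ _ W4 (Rmin_r _ _)).
  destruct (E1 w ltac:(lra)) as [Q1 [_ F1]]. destruct (E2 w ltac:(lra)) as [Q2 [_ F2]].
  exists w. split; [split; assumption|]. split; [exact Q1|]. split; [exact Q2|].
  rewrite F1, F2, (Eq w W6). reflexivity.
Qed.

(** The second function has to satisfy the equation only near [z0]. This is needed for the one built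
    from [d], whose equation is known only near 0. *)
Lemma weierstrass_ode_eq_of_root (f1 f2 : C -> C) (P1 P2 : C -> Prop) (z0 e : C) :
  meromorphic_with_poles f1 P1 -> weierstrass_ode f1 P1 -> meromorphic_with_poles f2 P2 ->
  (exists r, 0 < r /\ branch_sol (12 * e * e - g2) (12 * e) 4 0 (fun w => f2 w - e)%C z0 r /\
    forall w, Cmod (w - z0) < r -> ~ P2 w) ->
  (exists p, P1 p) -> ~ P1 z0 -> f1 z0 = e ->
  (4 * e * e * e - g2 * e - g3 = 0)%C -> (12 * e * e - g2)%C <> 0 ->
  forall z, (P1 z <-> P2 z) /\ (~ P1 z -> f1 z = f2 z).
Proof.
  intros M1 W1 M2 [r2 [Hr2 [S2 E2]]] Hp1 Hz Hf He Hne.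
  destruct (weierstrass_ode_branch_sol f1 P1 z0 e M1 W1 Hp1 Hz Hf He) as [r1 [Hr1 [S1 E1]]].
  set (r := Rmin r1 r2). assert (Hr : 0 < r) by now apply Rmin_glb_lt.
  assert (R1 : r <= r1) by apply Rmin_l. assert (R2 : r <= r2) by apply Rmin_r.
  destruct (branch_sol_unique _ _ _ _ Hne _ _ z0 r Hr (branch_sol_sub _ _ _ _ _ _ _ _ R1 S1)
    (branch_sol_sub _ _ _ _ _ _ _ _ R2 S2)) as [r' [Hr' Eq]].
  apply (meromorphic_identity f1 f2 P1 P2 M1 M2 z0). intros eps Heps.
  destruct (ex_point_near z0 (Rmin eps (Rmin r r'))) as [w [V1 V2]]; [repeat apply Rmin_glb_lt; lra|].
  assert (W3 := Rlt_le_trans _ _ _ V2 (Rmin_l _ _)). assert (W4 := Rlt_le_trans _ _ _ V2 (Rmin_r _ _)).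
  assert (W5 := Rlt_le_trans _ _ _ W4 (Rmin_l _ _)). assert (W6 := Rlt_le_trans _ _ _ W4 (Rmin_r _ _)).
  exists w. split; [split; assumption|]. split; [apply E1; lra|]. split; [apply E2; lra|].
  specialize (Eq w W6). cbv beta in Eq. apply Ceq_minus in Eq. apply Ceq_minus. rewrite <- Eq. ring.
Qed.

End Weierstrass.

(** * Values at the half-periods *)
Section HalfPeriods.

Variables (e1 e2 e3 om om' : R) (wp : C -> C) (P : C -> Prop).
Hypothesis Hsum : e1 + e2 + e3 = 0.
Hypothesis H12 : e2 < e1.
Hypothesis H23 : e3 < e2.
Let g2 : R := -4 * (e1 * e2 + e1 * e3 + e2 * e3).
Let g3 : R := 4 * e1 * e2 * e3.
Hypothesis Hom : 0 < om.
Hypothesis Hom' : 0 < om'.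
Hypothesis Hmero : meromorphic_with_poles wp P.
Hypothesis HP0 : P 0.
Hypothesis Hode : weierstrass_ode (RtoC g2) (RtoC g3) wp P.
Hypothesis Hlat : period_lattice_is wp P om om'.

Definition in_lattice (w : C) : Prop :=
  exists m n : Z, fst w = 2 * IZR m * om /\ snd w = 2 * IZR n * om'.

Lemma period_iff_lattice (w : C) : is_period wp P w <-> in_lattice w.
Proof.
  rewrite (Hlat w). split; intros [m [n E]]; exists m, n.
  - rewrite E; split; simpl; ring.
  - destruct E as [E1 E2]. apply injective_projections; simpl; rewrite ?E1, ?E2; ring.
Qed.

Lemma one_sqr : (1 * 1 = RtoC 1)%C.
Proof. ring. Qed.

Lemma minus_one_sqr : (- (1) * - (1) = RtoC 1)%C.
Proof. ring. Qed.

(** If [w] is a pole, then [wp] and its translate by [w] solve the same equation and share the pole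
    0, so they coincide and [w] is a period. Conversely a period carries the pole 0 to itself
    shifted. *)
Lemma pole_iff_lattice (w : C) : P w <-> in_lattice w.
Proof.
  rewrite <- period_iff_lattice. split.
  - intros Hw.
    pose proof (weierstrass_ode_eq_of_pole _ _ wp (fun z => wp (1 * z + w)%C) P (fun z => P (1 * z + w)%C) 0 Hmero Hode
      (meromorphic_affine wp P 1 w one_sqr Hmero) (weierstrass_ode_affine _ _ wp P 1 w one_sqr Hode) HP0) as E.
    cbv beta in E. replace (1 * 0 + w)%C with w in E by ring. specialize (E Hw).
    intros z. destruct (E z) as [E1 E2]. replace (1 * z + w)%C with (z + w)%C in E1, E2 by ring.
    split; [exact E1|]. intros Hz. symmetry. now apply E2.
  - intros Hw. destruct (Hw 0) as [X _]. replace (0 + w)%C with w in X by ring. now apply X.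
Qed.

Lemma wp_period (z w : C) : in_lattice w -> (P z <-> P (z + w)%C) /\ (~ P z -> wp (z + w)%C = wp z).
Proof. intros Hw. apply period_iff_lattice in Hw. apply Hw. Qed.

Lemma wp_even (z : C) : (P z <-> P (- z)%C) /\ (~ P z -> wp (- z)%C = wp z).
Proof.
  pose proof (weierstrass_ode_eq_of_pole _ _ wp (fun z => wp (- (1) * z + 0)%C) P (fun z => P (- (1) * z + 0)%C) 0 Hmero Hode
    (meromorphic_affine wp P (- (1)) 0 minus_one_sqr Hmero) (weierstrass_ode_affine _ _ wp P (- (1)) 0 minus_one_sqr Hode) HP0) as E.
  cbv beta in E. replace (- (1) * 0 + 0)%C with (RtoC 0) in E by ring. specialize (E HP0 z).
  replace (- (1) * z + 0)%C with (- z)%C in E by ring. destruct E as [E1 E2].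
  split; [exact E1|]. intros Hz. symmetry. now apply E2.
Qed.

Lemma weierstrass_ode_conj : weierstrass_ode (RtoC g2) (RtoC g3) (fun w => Cconj (wp (Cconj w))) (fun w => P (Cconj w)).
Proof.
  intros z Hz. destruct (Hode _ Hz) as [l [Hl E]]. exists (Cconj l). split; [now apply cderiv_conj|].
  rewrite <- Cconj_mult, E, !Cconj_minus, !Cconj_mult, !cpow_Cpow, Cconj_pow, !Cconj_R. reflexivity.
Qed.

(** Real [g2] and [g3] make the conjugated function a solution, and 0 is its own conjugate. On the
    real axis this makes [wp] real. *)
Lemma wp_conj (z : C) : (P z <-> P (Cconj z)) /\ (~ P z -> Cconj (wp (Cconj z)) = wp z).
Proof.
  pose proof (weierstrass_ode_eq_of_pole _ _ wp _ P _ 0 Hmero Hode (meromorphic_conj wp P Hmero) weierstrass_ode_conj HP0) as E.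
  cbv beta in E. rewrite Cconj_R in E. destruct (E HP0 z) as [E1 E2].
  split; [exact E1|]. intros Hz. symmetry. now apply E2.
Qed.

Lemma cubic_factor (x : C) :
  (4 * x * x * x - RtoC g2 * x - RtoC g3 = 4 * ((x - RtoC e1) * (x - RtoC e2) * (x - RtoC e3)))%C.
Proof.
  unfold g2, g3. replace e3 with (- e1 - e2) by lra.
  rewrite ?RtoC_mult, ?RtoC_plus, ?RtoC_minus, ?RtoC_opp, ?RtoC_mult, ?RtoC_plus, ?RtoC_minus, ?RtoC_opp,
    ?RtoC_mult, ?RtoC_plus, ?RtoC_minus, ?RtoC_opp. ring.
Qed.

Definition is_root (e : R) : Prop := e = e1 \/ e = e2 \/ e = e3.

(** The second expression is the derivative of the cubic at the root, that is 4 times the product of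
    the differences from the other two roots. *)
Lemma is_root_simple (e : R) : is_root e ->
  (4 * RtoC e * RtoC e * RtoC e - RtoC g2 * RtoC e - RtoC g3 = 0)%C /\
  (12 * RtoC e * RtoC e - RtoC g2)%C <> 0.
Proof.
  intros He. split.
  - rewrite cubic_factor. destruct He as [->|[->| ->]]; ring.
  - rewrite <- !RtoC_mult, <- RtoC_minus. intros X. apply RtoC_inj in X. unfold g2 in X.
    assert (P12 : 0 < (e1 - e2) * (e1 - e3)) by (apply Rmult_lt_0_compat; lra).
    assert (P23 : 0 < (e1 - e2) * (e2 - e3)) by (apply Rmult_lt_0_compat; lra).
    assert (P13 : 0 < (e1 - e3) * (e2 - e3)) by (apply Rmult_lt_0_compat; lra).
    (* Together with the products above, this leaves goals that are linear in the monomials. *)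
    assert (Z : e * (e1 + e2 + e3) = 0) by (rewrite Hsum; ring).
    destruct He as [->|[->| ->]]; lra.
Qed.

(** Evenness and the period 2h make [wp] symmetric about [h]. Its derivative there equals its own
    negative, so it vanishes and the equation turns [wp h] into a root of the cubic. *)
Lemma half_period_value_is_root (h : C) : in_lattice (2 * h)%C -> ~ in_lattice h -> exists e, is_root e /\ wp h = RtoC e.
Proof.
  intros H2 Hn. rewrite <- pole_iff_lattice in Hn.
  assert (Sym : forall z, ~ P z -> wp (- z + 2 * h)%C = wp z).
  { intros z Hz. destruct (wp_even z) as [E1 E2]. rewrite (proj2 (wp_period (- z)%C (2 * h)%C H2)) by tauto.
    now apply E2. }
  destruct (Hode h Hn) as [l [Hl E]].
  destruct (proj1 Hmero h Hn) as [r [Hr K]].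
  assert (L0 : l = 0).
  { assert (X : l = ((- (1)) * l)%C).
    { apply (cderiv_unique wp h); [exact Hl|].
      assert (Da : cderiv (fun z => - z + 2 * h)%C h (- (1) + 0)) by (auto_cderiv).
      assert (Hl' : cderiv wp (- h + 2 * h)%C l) by (replace (- h + 2 * h)%C with h by ring; exact Hl).
      pose proof (cderiv_comp wp (fun z => - z + 2 * h)%C h _ _ Hl' Da) as D.
      eapply (cderiv_ext_loc _ wp h _ r Hr); [|eapply cderiv_eq; [exact D|ring]].
      intros w Hw. cbv beta. apply Sym. now apply K. }
    apply (Cmult_eq_reg_l 2); [intros Y; apply RtoC_inj in Y; lra|].
    transitivity (l - (- (1) * l))%C; [ring|]. rewrite <- X. ring. }
  assert (F : (4 * ((wp h - RtoC e1) * (wp h - RtoC e2) * (wp h - RtoC e3)) = 0)%C).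
  { rewrite <- cubic_factor. transitivity (4 * cpow (wp h) 3 - RtoC g2 * wp h - RtoC g3)%C; [simpl; ring|].
    rewrite <- E, L0. ring. }
  destruct (Ceq_dec (wp h) (RtoC e1)) as [Q1|Q1]; [exists e1; split; [left; reflexivity|exact Q1]|].
  destruct (Ceq_dec (wp h) (RtoC e2)) as [Q2|Q2]; [exists e2; split; [right; left; reflexivity|exact Q2]|].
  destruct (Ceq_dec (wp h) (RtoC e3)) as [Q3|Q3]; [exists e3; split; [right; right; reflexivity|exact Q3]|].
  exfalso. revert F. repeat apply Cmult_neq_0; try (now apply Cminus_eq_contra). apply C4_neq0.
Qed.

(** The translates of [wp] by [a] and by [b] both take the branch value [e] at 0, so they coincide.
    The point -b is a pole of the second, hence of the first, which places a - b in the lattice. *)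
Lemma root_value_lattice (a b : C) (e : R) : is_root e -> ~ P a -> ~ P b -> wp a = RtoC e -> wp b = RtoC e -> in_lattice (a - b)%C.
Proof.
  intros He Ha Hb Ea Eb. destruct (is_root_simple e He) as [R1 R2].
  assert (Z : forall c, (1 * 0 + c)%C = c) by (intros; ring).
  pose proof (meromorphic_affine wp P 1 a one_sqr Hmero) as Ma. pose proof (weierstrass_ode_affine _ _ wp P 1 a one_sqr Hode) as Wa.
  pose proof (meromorphic_affine wp P 1 b one_sqr Hmero) as Mb. pose proof (weierstrass_ode_affine _ _ wp P 1 b one_sqr Hode) as Wb.
  assert (N : forall c, exists p, P (1 * p + c)%C).
  { intros c. exists (- c)%C. replace (1 * - c + c)%C with (RtoC 0) by ring. exact HP0. }
  destruct (weierstrass_ode_eq_of_root _ _ _ _ _ _ 0 (RtoC e) Ma Wa Mb) with (z := (- b)%C) as [X _].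
  - apply (weierstrass_ode_branch_sol _ _ _ _ 0 (RtoC e) Mb Wb (N b)); [|now rewrite Z|exact R1]. now rewrite Z.
  - exact (N a).
  - now rewrite Z.
  - now rewrite Z.
  - exact R1.
  - exact R2.
  - cbv beta in X. apply pole_iff_lattice. replace (a - b)%C with (1 * - b + a)%C by ring. apply X.
    replace (1 * - b + b)%C with (RtoC 0) by ring. exact HP0.
Qed.

Lemma not_in_lattice_fst (w : C) (x : R) : 0 < x < 2 * om -> fst w = x \/ fst w = - x -> ~ in_lattice w.
Proof.
  intros Hx Hw [m [n [E _]]].
  assert (X : Rabs (IZR m) * (2 * om) = x).
  { rewrite <- (Rabs_right (2 * om)) by lra. rewrite <- Rabs_mult.
    replace (IZR m * (2 * om)) with (fst w) by lra.
    destruct Hw as [-> | ->]; [apply Rabs_right|rewrite Rabs_Ropp; apply Rabs_right]; lra. }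
  rewrite <- abs_IZR in X.
  assert (0 < IZR (Z.abs m) < 1) as [Y1 Y2] by (split; nra).
  apply lt_IZR in Y1. apply lt_IZR in Y2. lia.
Qed.

Lemma not_in_lattice_snd (w : C) (x : R) : 0 < x < 2 * om' -> snd w = x \/ snd w = - x -> ~ in_lattice w.
Proof.
  intros Hx Hw [m [n [_ E]]].
  assert (X : Rabs (IZR n) * (2 * om') = x).
  { rewrite <- (Rabs_right (2 * om')) by lra. rewrite <- Rabs_mult.
    replace (IZR n * (2 * om')) with (snd w) by lra.
    destruct Hw as [-> | ->]; [apply Rabs_right|rewrite Rabs_Ropp; apply Rabs_right]; lra. }
  rewrite <- abs_IZR in X.
  assert (0 < IZR (Z.abs n) < 1) as [Y1 Y2] by (split; nra).
  apply lt_IZR in Y1. apply lt_IZR in Y2. lia.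
Qed.

(** Both axes at once: [u = 1], [sg = 1] for the real one and [u = Ci], [sg = -1] for the imaginary
    one. Near 0, [wp] behaves like 1/z^2, so at [t * u] like [sg / t^2]. *)
Lemma wp_near_zero (u : C) (sg B eps : R) : (u * u = RtoC sg)%C -> sg * sg = 1 -> 1 <= B -> 0 < eps ->
  exists t, 0 < t < eps /\ forall x, wp (RtoC t * u)%C = RtoC x -> B < sg * x.
Proof.
  intros Hu Hsg HB Heps.
  destruct (weierstrass_pole_branch_sol _ _ wp P 0 Hmero Hode HP0) as [r [s [Hr [Ss Es]]]].
  destruct (branch_sol_order _ _ _ _ C4_neq0 s 0 r Hr Ss) as [h [Hh [H0 Eh]]].
  assert (h 0 = 1) as H1.
  { apply (Cmult_eq_reg_l 4); [apply C4_neq0|]. rewrite H0. ring. }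
  assert (D0 : Cmod (0 - 0) < r) by (rewrite Cmod_self; exact Hr).
  destruct (Hh 0 D0) as [l Hl]. apply cderiv_continuous in Hl.
  destruct (Hl (1 / 2)) as [del [Hdel K]]; [lra|].
  assert (Hmu : Cmod u = 1).
  { apply (f_equal Cmod) in Hu. rewrite Cmod_mult, Cmod_R in Hu. pose proof (Cmod_ge_0 u).
    assert (Rabs sg = 1) by (assert (Rabs sg * Rabs sg = 1) by (rewrite <- Rabs_mult, Hsg; apply Rabs_R1);
      pose proof (Rabs_pos sg); nra). nra. }
  (* The bound [1 / B] yields t B at most 1/2, and t at most 1/2 as [1 <= B]. With the real part of
     [h (t * u)] below 3/2 this gives [B * (t * t * fst y) < 1]. *)
  set (m := Rmin (Rmin eps r) (Rmin del (1 / B))). set (t := m / 2).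
  assert (P1 : 0 < 1 / B) by (apply Rdiv_lt_0_compat; lra).
  assert (Pm : 0 < m) by (unfold m; repeat apply Rmin_glb_lt; lra).
  assert (Ht : 0 < t) by (unfold t; lra).
  assert (T1 : t < eps /\ t < r /\ t < del /\ t <= 1 / B / 2).
  { assert (A1 : m <= Rmin eps r) by apply Rmin_l. assert (A2 : m <= Rmin del (1 / B)) by apply Rmin_r.
    pose proof (Rmin_l eps r). pose proof (Rmin_r eps r). pose proof (Rmin_l del (1 / B)). pose proof (Rmin_r del (1 / B)).
    unfold t. repeat split; lra. }
  destruct T1 as [T1 [T2 [T3 T4]]].
  assert (Hm : Cmod (RtoC t * u - 0) = t).
  { replace (RtoC t * u - 0)%C with (RtoC t * u)%C by ring. rewrite Cmod_mult, Cmod_R, Hmu, Rabs_right; lra. }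
  exists t. split; [split; assumption|]. intros x Ex.
  destruct (Es (RtoC t * u)%C) as [_ [Ns Fs]]; [rewrite Hm; lra|].
  rewrite (Eh (RtoC t * u)%C) in Ns, Fs by (rewrite Hm; lra).
  assert (Kt : Cmod (h (RtoC t * u)%C - h 0) < 1 / 2) by (apply K; rewrite Hm; lra).
  rewrite H1 in Kt. set (y := h (RtoC t * u)%C) in *.
  assert (Ey : (RtoC x * (RtoC (sg * t * t) * y) = 1)%C).
  { rewrite <- Ex, Fs.
    assert (Q : ((RtoC t * u - 0) ^ 2 * y = RtoC (sg * t * t) * y)%C).
    { rewrite !RtoC_mult, <- Hu. simpl. ring. }
    rewrite Q in *. field.
    split; [intros X; apply Ns; rewrite X; ring|intros X; apply Ns; rewrite X; ring]. }
  pose proof (Cmod_fst (y - 1)) as Fy. simpl in Fy.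
  assert (Fy' : Rabs (fst y + - (1)) < 1 / 2) by lra. apply Rabs_def2 in Fy'.
  apply (f_equal fst) in Ey. simpl in Ey.
  assert (Ey' : sg * x * (t * t * fst y) = 1) by (rewrite <- Ey; ring).
  assert (Tt : t * B <= 1 / 2).
  { apply Rmult_le_compat_r with (r := B) in T4; [|lra].
    replace (1 / B / 2 * B) with (1 / 2) in T4 by (field; lra). exact T4. }
  assert (t <= 1 / 2) by nra.
  assert (Pp : 0 < t * t * fst y) by (repeat apply Rmult_lt_0_compat; lra).
  assert (Q : B * (t * t * fst y) < 1).
  { replace (B * (t * t * fst y)) with ((t * B) * (t * fst y)) by ring.
    assert (0 <= t * fst y <= 3 / 4) by (split; nra). nra. }
  apply Rmult_lt_reg_r with (t * t * fst y); lra.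
Qed.

(** The function [sg * (e - wp)] is negative close to the pole and positive at the end [T]. The sign
    [sg] turns a start at plus infinity on the real axis and at minus infinity on the imaginary axis
    into the same situation. *)
Lemma axis_ivt (u : C) (sg T e x : R) : (u * u = RtoC sg)%C -> sg * sg = 1 -> 0 < T ->
  (forall t, 0 < t <= T -> ~ P (RtoC t * u)%C) ->
  (forall t, 0 < t <= T -> snd (wp (RtoC t * u)%C) = 0) ->
  wp (RtoC T * u)%C = RtoC x -> sg * (e - x) > 0 ->
  exists t, 0 < t < T /\ wp (RtoC t * u)%C = RtoC e.
Proof.
  intros Hu Hsg HT HP HR Hx Hlt.
  destruct (wp_near_zero u sg (1 + Rabs e) T Hu Hsg) as [t0 [Ht0 K]]; [pose proof (Rabs_pos e); lra|exact HT|].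
  assert (Rl : forall t, 0 < t <= T -> wp (RtoC t * u)%C = RtoC (fst (wp (RtoC t * u)%C))).
  { intros t Ht. apply injective_projections; [reflexivity|]. simpl. now apply HR. }
  set (f := fun t => sg * (e - fst (wp (0 + RtoC t * u)%C))).
  assert (Z : forall t, (0 + RtoC t * u)%C = (RtoC t * u)%C) by (intros; ring).
  destruct (IVT_interv f t0 T) as [t [Ht Ft]].
  - intros t Ht.
    destruct (Hode (0 + RtoC t * u)%C) as [l [Hl _]]; [rewrite Z; apply HP; lra|].
    destruct (cderiv_along_line wp 0 u l t Hl) as [D _].
    apply continuity_pt_filterlim. apply (continuous_scal_r sg (fun t => e - fst (wp (0 + RtoC t * u)%C))).
    apply (continuous_minus (fun _ => e) (fun t => fst (wp (0 + RtoC t * u)%C))); [apply continuous_const|].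
    apply ex_derive_continuous. eexists. exact D.
  - lra.
  - unfold f. rewrite Z. specialize (K _ (Rl t0 ltac:(lra))).
    assert (sg * e <= Rabs e).
    { apply Rle_trans with (Rabs (sg * e)); [apply Rle_abs|]. rewrite Rabs_mult.
      assert (Rabs sg = 1) as -> by (assert (Rabs sg * Rabs sg = 1) by (rewrite <- Rabs_mult, Hsg; apply Rabs_R1);
        pose proof (Rabs_pos sg); nra). lra. }
    lra.
  - unfold f. rewrite Z, Hx. simpl. lra.
  - unfold f in Ft. rewrite Z in Ft.
    assert (Fe : fst (wp (RtoC t * u)%C) = e).
    { assert (e - fst (wp (RtoC t * u)%C) = 0); [|lra].
      transitivity (sg * (sg * (e - fst (wp (RtoC t * u)%C)))); [rewrite <- Rmult_assoc, Hsg; ring|].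
      rewrite Ft; ring. }
    exists t. split.
    + split; [lra|]. destruct (proj2 Ht) as [L|L]; [exact L|exfalso].
      subst t. rewrite Hx in Fe. simpl in Fe. subst e. rewrite Rminus_diag, Rmult_0_r in Hlt. lra.
    + rewrite (Rl t) by lra. now rewrite Fe.
Qed.

Theorem half_period_values :
  wp (RtoC om) = RtoC e1 /\ wp (Ci * RtoC om')%C = RtoC e3 /\ wp (RtoC om + Ci * RtoC om')%C = RtoC e2.
Proof.
  set (h1 := RtoC om). set (h3 := (Ci * RtoC om')%C). set (h2 := (RtoC om + Ci * RtoC om')%C).
  assert (F1 : fst h1 = om /\ snd h1 = 0) by (unfold h1; simpl; lra).
  assert (F3 : fst h3 = 0 /\ snd h3 = om') by (unfold h3; simpl; lra).
  assert (F2 : fst h2 = om /\ snd h2 = om') by (unfold h2; simpl; lra).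
  destruct F1 as [X1 Y1], F2 as [X2 Y2], F3 as [X3 Y3].
  assert (L1 : ~ in_lattice h1) by (apply (not_in_lattice_fst _ om); lra).
  assert (L2 : ~ in_lattice h2) by (apply (not_in_lattice_fst _ om); lra).
  assert (L3 : ~ in_lattice h3) by (apply (not_in_lattice_snd _ om'); lra).
  assert (D : forall h, (2 * h)%C = (h + h)%C) by (intros; ring).
  destruct (half_period_value_is_root h1) as [v1 [V1 E1]]; [rewrite D; exists 1%Z, 0%Z; simpl; rewrite ?X1, ?Y1; lra|exact L1|].
  destruct (half_period_value_is_root h2) as [v2 [V2 E2]]; [rewrite D; exists 1%Z, 1%Z; cbn [fst snd Cplus]; rewrite ?X2, ?Y2; lra|exact L2|].
  destruct (half_period_value_is_root h3) as [v3 [V3 E3]]; [rewrite D; exists 0%Z, 1%Z; cbn [fst snd Cplus]; rewrite ?X3, ?Y3; lra|exact L3|].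
  rewrite <- pole_iff_lattice in L1, L2, L3.
  assert (Df : forall a b : C, fst (a - b)%C = fst a - fst b /\ snd (a - b)%C = snd a - snd b)
    by (intros; simpl; lra).
  assert (N12 : v1 <> v2).
  { intros E. subst v2. apply (not_in_lattice_snd (h1 - h2)%C om'); [lra| |now apply (root_value_lattice h1 h2 v1)].
    rewrite (proj2 (Df h1 h2)). lra. }
  assert (N13 : v1 <> v3).
  { intros E. subst v3. apply (not_in_lattice_snd (h1 - h3)%C om'); [lra| |now apply (root_value_lattice h1 h3 v1)].
    rewrite (proj2 (Df h1 h3)). lra. }
  assert (N23 : v2 <> v3).
  { intros E. subst v3. apply (not_in_lattice_fst (h2 - h3)%C om); [lra| |now apply (root_value_lattice h2 h3 v2)].
    rewrite (proj1 (Df h2 h3)). lra. }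
  (* Otherwise [wp om] is less than [e1], so [e1] is taken at some t between 0 and [om]. One of the
     other half-periods also takes [e1], as the three values differ; their difference from t would
     be a lattice point with imaginary part [-om']. *)
  assert (W1 : v1 = e1).
  { apply NNPP. intros N.
    assert (exists h, (h = h2 \/ h = h3) /\ wp h = RtoC e1) as [h [Hh Eh]].
    { unfold is_root in *. destruct (Req_dec v2 e1) as [Q|Q]; [exists h2; split; [left; reflexivity|now rewrite E2, Q]|].
      exists h3. assert (Q3 : v3 = e1) by lra. split; [right; reflexivity|now rewrite E3, Q3]. }
    destruct (axis_ivt 1 1 om e1 v1) as [t [Ht Et]].
    - exact one_sqr.
    - ring.
    - exact Hom.
    - intros t Ht. rewrite pole_iff_lattice. apply (not_in_lattice_fst _ t); [lra|left; simpl; ring].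
    - intros t Ht. replace (RtoC t * 1)%C with (RtoC t) by ring.
      assert (Np : ~ P (RtoC t)) by (rewrite pole_iff_lattice; apply (not_in_lattice_fst _ t); [lra|left; reflexivity]).
      pose proof (proj2 (wp_conj (RtoC t)) Np) as Q. rewrite Cconj_R in Q.
      apply (f_equal snd) in Q. simpl in Q. lra.
    - replace (RtoC om * 1)%C with h1 by (unfold h1; ring). exact E1.
    - unfold is_root in V1. lra.
    - replace (RtoC t * 1)%C with (RtoC t) in Et by ring.
      assert (Np : ~ P (RtoC t)) by (rewrite pole_iff_lattice; apply (not_in_lattice_fst _ t); [lra|left; reflexivity]).
      apply (not_in_lattice_snd (RtoC t - h)%C om'); [lra| |].
      + rewrite (proj2 (Df _ _)). right. destruct Hh as [-> | ->]; simpl (snd (RtoC t)); lra.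
      + apply (root_value_lattice _ _ e1); [left; reflexivity|exact Np| |exact Et|exact Eh].
        destruct Hh as [-> | ->]; assumption. }
  (* The mirror argument on the imaginary axis, where [wp] rises from minus infinity; the excluded
     lattice point has real part [-om]. *)
  assert (W3 : v3 = e3).
  { apply NNPP. intros N.
    assert (exists h, (h = h1 \/ h = h2) /\ wp h = RtoC e3) as [h [Hh Eh]].
    { unfold is_root in *. destruct (Req_dec v1 e3) as [Q|Q]; [exists h1; split; [left; reflexivity|now rewrite E1, Q]|].
      exists h2. assert (Q2 : v2 = e3) by lra. split; [right; reflexivity|now rewrite E2, Q2]. }
    assert (Np : forall t, 0 < t <= om' -> ~ P (RtoC t * Ci)%C).
    { intros t Ht. rewrite pole_iff_lattice. apply (not_in_lattice_snd _ t); [lra|left; simpl; ring]. }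
    destruct (axis_ivt Ci (-1) om' e3 v3) as [t [Ht Et]].
    - apply injective_projections; simpl; ring.
    - ring.
    - exact Hom'.
    - exact Np.
    - intros t Ht. specialize (Np t Ht).
      (* On the imaginary axis conjugation is negation, so evenness combines with conjugation
         symmetry to make [wp] real. *)
      pose proof (proj2 (wp_conj (RtoC t * Ci)) Np) as Q.
      replace (Cconj (RtoC t * Ci)) with (- (RtoC t * Ci))%C in Q by (apply injective_projections; simpl; ring).
      rewrite (proj2 (wp_even _) Np) in Q.
      apply (f_equal snd) in Q. cbn [snd Cconj] in Q. lra.
    - replace (RtoC om' * Ci)%C with h3 by (unfold h3; ring). exact E3.
    - unfold is_root in V3. lra.
    - apply (not_in_lattice_fst (RtoC t * Ci - h)%C om); [lra| |].
      + rewrite (proj1 (Df _ _)). right. assert (fst (RtoC t * Ci)%C = 0) as -> by (simpl; ring).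
        destruct Hh as [-> | ->]; lra.
      + apply (root_value_lattice _ _ e3); [right; right; reflexivity|apply Np; lra| |exact Et|exact Eh].
        destruct Hh as [-> | ->]; assumption. }
  assert (W2 : v2 = e2) by (unfold is_root in V2; lra).
  subst v1 v2 v3. auto.
Qed.

End HalfPeriods.

(** * The hypergeometric integrand *)
(** Taylor coefficients of (1-x)^(-1/2) at 0. *)
Definition invsqrt_coef (n : nat) : R := poch (1/2) n / INR (fact n).

Lemma poch_pos (a : R) (n : nat) : 0 < a -> 0 < poch a n.
Proof.
  intros Ha. induction n as [|n IH]; simpl poch; [lra|].
  apply Rmult_lt_0_compat; [exact IH|]. pose proof (pos_INR n). lra.
Qed.

Lemma invsqrt_coef_S (n : nat) : INR (S n) * invsqrt_coef (S n) = (1/2 + INR n) * invsqrt_coef n.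
Proof.
  unfold invsqrt_coef. rewrite fact_simpl, mult_INR. simpl poch. field.
  split; [apply INR_fact_neq_0|apply not_0_INR; lia].
Qed.

Lemma invsqrt_coef_bound (n : nat) : 0 <= invsqrt_coef n <= 1.
Proof.
  induction n as [|n IH].
  - unfold invsqrt_coef. simpl. lra.
  - pose proof (invsqrt_coef_S n) as E. rewrite S_INR in E. pose proof (pos_INR n). split; nra.
Qed.

(** Duplication: (1/2)_(2n) = 4^n (1/4)_n (3/4)_n and (2n)! = 4^n (1/2)_n n!. The induction replaces
    this by two steps of the recurrence for [invsqrt_coef]. *)
Lemma hyp2F1_coef (n : nat) :
  poch (1/4) n * poch (3/4) n / (poch (1/2) n * INR (fact n)) = invsqrt_coef (2 * n).
Proof.
  induction n as [|n IH].
  - unfold invsqrt_coef. simpl. field.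
  - assert (P : 0 < poch (1/2) n) by (apply poch_pos; lra).
    pose proof (INR_fact_neq_0 n) as F. pose proof (pos_INR n) as Pn.
    replace (2 * S n)%nat with (S (S (2 * n))) by lia.
    pose proof (invsqrt_coef_S (2 * n)) as E1. pose proof (invsqrt_coef_S (S (2 * n))) as E2.
    rewrite <- IH in E1. rewrite !S_INR, mult_INR in E2. rewrite !S_INR, mult_INR in E1. simpl INR in E1, E2.
    set (x := invsqrt_coef (S (2 * n))) in *. set (y := invsqrt_coef (S (S (2 * n)))) in *.
    apply Rmult_eq_reg_l with ((2 * INR n + 1) * (2 * INR n + 2)); [|nra].
    replace (1 + 1) with 2 in * by ring.
    replace ((2 * INR n + 1) * (2 * INR n + 2) * y) with ((1 / 2 + (2 * INR n + 1)) * ((2 * INR n + 1) * x)) by nra.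
    rewrite E1. rewrite fact_simpl, mult_INR, S_INR. simpl poch. field. repeat split; lra.
Qed.

Lemma bounded_radius (a : nat -> R) (x : R) : (forall n, Rabs (a n) <= 1) -> Rabs x < 1 ->
  Rbar_lt (Rabs x) (CV_radius a).
Proof.
  intros Ha Hx. apply Rbar_lt_le_trans with 1; [exact Hx|].
  apply (proj1 (CV_radius_bounded a)). exists 1. intros n. now rewrite pow1, Rmult_1_r.
Qed.

Lemma invsqrt_abs (n : nat) : Rabs (invsqrt_coef n) <= 1.
Proof. pose proof (invsqrt_coef_bound n). rewrite Rabs_right; lra. Qed.

Lemma invsqrt_ode (x : R) : Rabs x < 1 ->
  (1 - x) * PSeries (PS_derive invsqrt_coef) x = PSeries invsqrt_coef x / 2.
Proof.
  intros Hx. pose proof (bounded_radius _ x invsqrt_abs Hx) as Hr.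
  assert (E : PSeries (PS_derive invsqrt_coef) x =
    1 / 2 * PSeries invsqrt_coef x + x * PSeries (PS_derive invsqrt_coef) x); [|lra].
  rewrite <- PSeries_incr_1, <- PSeries_scal, <- PSeries_plus.
  - apply PSeries_ext. intros n. unfold PS_derive at 1. rewrite invsqrt_coef_S.
    destruct n as [|n].
    + change ((1 / 2 + INR 0) * invsqrt_coef 0 = 1 / 2 * invsqrt_coef 0 + 0). simpl INR. ring.
    + change ((1 / 2 + INR (S n)) * invsqrt_coef (S n) =
        1 / 2 * invsqrt_coef (S n) + INR (S n) * invsqrt_coef (S n)). ring.
  - apply ex_pseries_scal; [apply Rmult_comm|]. now apply CV_radius_inside.
  - apply ex_pseries_incr_1. now apply ex_pseries_derive.
Qed.

(** By [invsqrt_ode] the product of the series with sqrt(1-x) has zero derivative, and it equals 1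
    at 0. *)
Lemma invsqrt_series (x : R) : Rabs x < 1 -> PSeries invsqrt_coef x = / sqrt (1 - x).
Proof.
  intros Hx.
  set (g := fun t => PSeries invsqrt_coef t * sqrt (1 - t)).
  assert (Dg : forall t, Rabs t < 1 -> is_derive g t 0).
  { intros t Ht. pose proof (bounded_radius _ t invsqrt_abs Ht) as Hr.
    pose proof (is_derive_PSeries _ _ Hr) as D1. pose proof (invsqrt_ode t Ht) as O.
    apply Rabs_def2 in Ht.
    assert (Sp : 0 < sqrt (1 - t)) by (apply sqrt_lt_R0; lra).
    assert (D2 : is_derive (fun t => sqrt (1 - t)) t (- 1 / (2 * sqrt (1 - t)))).
    { auto_derive; [lra|]. unfold Rminus in *. field. lra. }
    pose proof (is_derive_mult _ _ t _ _ D1 D2 Rmult_comm) as D.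
    eapply is_derive_ext; [intros; reflexivity|].
    replace 0 with (plus (mult (PSeries (PS_derive invsqrt_coef) t) (sqrt (1 - t)))
      (mult (PSeries invsqrt_coef t) (- 1 / (2 * sqrt (1 - t))))); [exact D|].
    unfold plus, mult; simpl.
    assert (Sq : sqrt (1 - t) * sqrt (1 - t) = 1 - t) by (apply sqrt_sqrt; lra).
    apply Rmult_eq_reg_r with (sqrt (1 - t)); [|lra].
    transitivity (PSeries (PS_derive invsqrt_coef) t * (sqrt (1 - t) * sqrt (1 - t)) - PSeries invsqrt_coef t / 2);
      [field; lra|]. rewrite Sq. lra. }
  assert (G0 : g 0 = 1).
  { unfold g. rewrite PSeries_0, Rminus_0_r, sqrt_1. unfold invsqrt_coef. simpl. field. }
  assert (Gx : g x = 1).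
  { rewrite <- G0. destruct (Rtotal_order x 0) as [L|[->|L]]; [|reflexivity|].
    - apply (eq_is_derive (V := R_NormedModule) g x 0); [|exact L].
      intros t Ht. apply Dg. apply Rabs_def2 in Hx. apply Rabs_def1; lra.
    - symmetry. apply (eq_is_derive (V := R_NormedModule) g 0 x); [|exact L].
      intros t Ht. apply Dg. apply Rabs_def2 in Hx. apply Rabs_def1; lra. }
  unfold g in Gx. apply Rabs_def2 in Hx.
  assert (Sp : 0 < sqrt (1 - x)) by (apply sqrt_lt_R0; lra).
  apply Rmult_eq_reg_r with (sqrt (1 - x)); [|lra]. rewrite Gx. field. lra.
Qed.

(* The hypergeometric series in [z^2] is the even part of the binomial series of [(1-z)^(-1/2)]. *)
Lemma hyp2F1_closed_form (z : R) : Rabs z < 1 ->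
  hyp2F1 (1/4) (3/4) (1/2) (z ^ 2) = (/ sqrt (1 - z) + / sqrt (1 + z)) / 2.
Proof.
  intros Hz.
  assert (Hz2 : Rabs (z ^ 2) < 1).
  { rewrite <- RPow_abs. pose proof (Rabs_pos z). simpl. nra. }
  assert (Ex1 : ex_pseries (fun n => invsqrt_coef (2 * n)) (z ^ 2)).
  { apply CV_radius_inside, bounded_radius; [intros; apply invsqrt_abs|exact Hz2]. }
  assert (Ex2 : ex_pseries (fun n => invsqrt_coef (2 * n + 1)) (z ^ 2)).
  { apply CV_radius_inside, bounded_radius; [intros; apply invsqrt_abs|exact Hz2]. }
  assert (Ez : (- z) ^ 2 = z ^ 2) by ring.
  pose proof (PSeries_odd_even invsqrt_coef z Ex1 Ex2) as E1.
  assert (E2 := PSeries_odd_even invsqrt_coef (- z)). rewrite Ez in E2. specialize (E2 Ex1 Ex2).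
  rewrite invsqrt_series in E1 by exact Hz. rewrite invsqrt_series in E2 by now rewrite Rabs_Ropp.
  replace (1 - - z) with (1 + z) in E2 by ring. rewrite E1, E2.
  assert (E : hyp2F1 (1/4) (3/4) (1/2) (z ^ 2) = PSeries (fun n => invsqrt_coef (2 * n)) (z ^ 2)).
  { apply Series_ext. intros n. now rewrite hyp2F1_coef. }
  rewrite E. field.
Qed.

Section RealCurve.

Variable kappa : R.
Hypothesis Hk0 : 0 < kappa.
Hypothesis Hk1 : kappa < 1.

Definition integrand (y : R) : R := (/ sqrt (1 - kappa * sin y) + / sqrt (1 + kappa * sin y)) / 2.

Lemma ksin_bound (y : R) : -1 < kappa * sin y < 1.
Proof. pose proof (SIN_bound y). nra. Qed.

Lemma integrand_pos (y : R) : 0 < integrand y.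
Proof.
  pose proof (ksin_bound y). unfold integrand.
  assert (0 < / sqrt (1 - kappa * sin y)) by (apply Rinv_0_lt_compat, sqrt_lt_R0; lra).
  assert (0 < / sqrt (1 + kappa * sin y)) by (apply Rinv_0_lt_compat, sqrt_lt_R0; lra). lra.
Qed.

Lemma integrand_cont (y : R) : continuous integrand y.
Proof.
  apply (ex_derive_continuous (K := R_AbsRing) (V := R_NormedModule)). pose proof (ksin_bound y).
  assert (0 < sqrt (1 - kappa * sin y)) by (apply sqrt_lt_R0; lra).
  assert (0 < sqrt (1 + kappa * sin y)) by (apply sqrt_lt_R0; lra).
  unfold integrand. auto_derive. unfold Rminus in *; repeat split; lra.
Qed.

Lemma u_int_eq (y : R) : u_int kappa y = RInt integrand 0 y.
Proof.
  unfold u_int. apply RInt_ext. intros t _.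
  rewrite <- Rpow_mult_distr. apply hyp2F1_closed_form. apply Rabs_def1; apply ksin_bound.
Qed.

Lemma u_int_derive (y : R) : is_derive (u_int kappa) y (integrand y).
Proof.
  apply (is_derive_ext (fun y => RInt integrand 0 y)); [intros; symmetry; apply u_int_eq|].
  apply (is_derive_RInt integrand _ 0 y); [|apply integrand_cont].
  apply filter_forall. intros z. apply (RInt_correct (V := R_CompleteNormedModule)).
  apply (ex_RInt_continuous (V := R_CompleteNormedModule)). intros; apply integrand_cont.
Qed.

(** The function [phi] is known only as a continuous right inverse of [u], so the difference
    quotient of [u] is read along the increments of [phi]. *)
Lemma inverse_derive (u phi : R -> R) (t del m : R) : 0 < del -> 0 < m ->
  (forall s, Rabs (s - t) < del -> u (phi s) = s) -> continuity_pt phi t ->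
  is_derive u (phi t) m -> is_derive phi t (/ m).
Proof.
  intros Hdel Hm Hu Hc Hd. apply is_derive_Reals in Hd. apply is_derive_Reals.
  assert (Ut : u (phi t) = t) by (apply Hu; rewrite Rminus_diag, Rabs_R0; exact Hdel).
  assert (L : forall eta, 0 < eta -> exists d, 0 < d /\ forall s, Rabs (s - t) < d ->
    Rabs (s - t - m * (phi s - phi t)) <= eta * Rabs (phi s - phi t)).
  { intros eta Heta. destruct (Hd eta Heta) as [d1 K1].
    destruct (Hc d1 (cond_pos d1)) as [d2 [Hd2 K2]].
    exists (Rmin d2 del). split; [now apply Rmin_glb_lt|]. intros s Hs.
    assert (S1 := Rlt_le_trans _ _ _ Hs (Rmin_l _ _)). assert (S2 := Rlt_le_trans _ _ _ Hs (Rmin_r _ _)).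
    destruct (Req_dec (phi s) (phi t)) as [E|E].
    - assert (s = t) as -> by (rewrite <- (Hu s S2), E; exact Ut).
      rewrite !Rminus_diag, Rmult_0_r, Rminus_0_r, Rabs_R0. lra.
    - assert (Hst : s <> t) by (intros ->; now apply E).
      assert (D : Rabs (phi s - phi t) < d1).
      { apply K2. split; [|exact S1]. split; [exact I|]. intros X; now apply Hst. }
      assert (N : phi s - phi t <> 0) by lra.
      specialize (K1 _ N D). replace (phi t + (phi s - phi t)) with (phi s) in K1 by ring.
      rewrite Ut, (Hu s S2) in K1.
      replace (s - t - m * (phi s - phi t)) with (((s - t) / (phi s - phi t) - m) * (phi s - phi t)) by (field; exact N).
      rewrite Rabs_mult. apply Rmult_le_compat_r; [apply Rabs_pos|lra]. }
  intros eps Heps.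
  (* The first bound makes [phi] Lipschitz with constant 2/m near [t]; the second then brings the
     error of the difference quotient below [eps]. *)
  set (eta := Rmin (m / 2) (eps * m * m / 4)).
  assert (P : 0 < eps * m * m) by (repeat apply Rmult_lt_0_compat; lra).
  assert (Heta : 0 < eta) by (unfold eta; apply Rmin_glb_lt; lra).
  assert (E1 : eta <= m / 2) by apply Rmin_l. assert (E2 : eta <= eps * m * m / 4) by apply Rmin_r.
  destruct (L eta Heta) as [d [Hdd K]]. exists (mkposreal d Hdd). intros h Hh Hhd. simpl in Hhd.
  specialize (K (t + h)). replace (t + h - t) with h in K by ring. specialize (K Hhd).
  set (x := phi (t + h) - phi t) in *.
  assert (Hp : 0 < Rabs h) by now apply Rabs_pos_lt.
  assert (B : Rabs x * m <= 2 * Rabs h).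
  { assert (Rabs (m * x) <= Rabs h + Rabs (h - m * x)).
    { replace (m * x) with (h + - (h - m * x)) at 1 by ring.
      eapply Rle_trans; [apply Rabs_triang|]. rewrite Rabs_Ropp. lra. }
    rewrite Rabs_mult, (Rabs_right m) in H by lra. pose proof (Rabs_pos x). nra. }
  replace (x / h - / m) with ((- / (m * h)) * (h - m * x)) by (field; split; lra).
  rewrite Rabs_mult, Rabs_Ropp, Rabs_inv, Rabs_mult, (Rabs_right m) by lra.
  apply Rmult_lt_reg_l with (m * Rabs h); [apply Rmult_lt_0_compat; lra|].
  rewrite <- Rmult_assoc, Rinv_r, Rmult_1_l by (apply Rgt_not_eq, Rmult_lt_0_compat; lra).
  eapply Rle_lt_trans; [exact K|].
  pose proof (Rabs_pos x).
  assert (eta * Rabs x <= eps * m * (Rabs x * m) / 4) by nra.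
  assert (0 < eps * m) by (apply Rmult_lt_0_compat; lra). nra.
Qed.

(** Differentiability of [psi] is avoided: on a smaller interval |psi| < 1 < pi/2, so cos psi is the
    positive root of 1 - kappa^2 sin^2 phi and depends on [phi] alone. If cos psi = 1, then sin phi
    = 0, so phi = 0 and t = u(0) = 0. *)
Lemma cos_psi_ode (phi psi : R -> R) (del : R) : 0 < del ->
  phi 0 = 0 -> psi 0 = 0 ->
  (forall t, Rabs t < del -> continuity_pt phi t /\ continuity_pt psi t) ->
  (forall t, Rabs t < del -> u_int kappa (phi t) = t /\ sin (psi t) = kappa * sin (phi t)) ->
  exists del', 0 < del' <= del /\ forall t, Rabs t < del' ->
    (t <> 0 -> cos (psi t) <> 1) /\
    exists l, is_derive (fun s => cos (psi s)) t l /\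
      l * l = 2 * (1 - cos (psi t)) * (cos (psi t) * cos (psi t) - (1 - kappa ^ 2)).
Proof.
  intros Hdel P0 S0 Hc He.
  assert (D0 : Rabs 0 < del) by (rewrite Rabs_R0; exact Hdel).
  destruct (proj1 (Hc 0 D0) 1 Rlt_0_1) as [d1 [Hd1 K1]].
  destruct (proj2 (Hc 0 D0) 1 Rlt_0_1) as [d2 [Hd2 K2]].
  assert (N1 : forall t, Rabs t < d1 -> -1 < phi t < 1).
  { intros t Ht. destruct (Req_dec t 0) as [->|N]; [rewrite P0; lra|].
    assert (X : Rabs (phi t - phi 0) < 1).
    { apply K1. split; [split; [exact I|lra]|]. unfold dist; simpl. unfold Rdist. now rewrite Rminus_0_r. }
    rewrite P0, Rminus_0_r in X. apply Rabs_def2 in X. lra. }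
  assert (N2 : forall t, Rabs t < d2 -> -1 < psi t < 1).
  { intros t Ht. destruct (Req_dec t 0) as [->|N]; [rewrite S0; lra|].
    assert (X : Rabs (psi t - psi 0) < 1).
    { apply K2. split; [split; [exact I|lra]|]. unfold dist; simpl. unfold Rdist. now rewrite Rminus_0_r. }
    rewrite S0, Rminus_0_r in X. apply Rabs_def2 in X. lra. }
  pose proof PI2_1 as HPI.
  exists (Rmin del (Rmin d1 d2)). split; [split; [repeat apply Rmin_glb_lt; assumption|apply Rmin_l]|].
  intros t Ht.
  assert (T1 := Rlt_le_trans _ _ _ Ht (Rmin_l _ _)). assert (T2 := Rlt_le_trans _ _ _ Ht (Rmin_r _ _)).
  assert (T3 := Rlt_le_trans _ _ _ T2 (Rmin_l _ _)). assert (T4 := Rlt_le_trans _ _ _ T2 (Rmin_r _ _)).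
  assert (Cp : forall s, Rabs s < d2 -> 0 < cos (psi s)).
  { intros s Hs. pose proof (N2 s Hs). apply cos_gt_0; lra. }
  split.
  - intros Nt E. apply Nt. destruct (He t T1) as [U Sn]. pose proof (N1 t T3) as B.
    assert (Z : sin (phi t) = 0).
    { pose proof (sin2_cos2 (psi t)) as Q. unfold Rsqr in Q. rewrite E, Sn in Q.
      assert (kappa * sin (phi t) * (kappa * sin (phi t)) = 0) as X by lra.
      apply Rmult_integral in X. destruct X as [X|X]; apply Rmult_integral in X; destruct X; lra. }
    assert (phi t = 0) as F.
    { destruct (Rtotal_order (phi t) 0) as [L|[L|L]]; [|exact L|].
      - assert (0 < sin (- phi t)) by (apply sin_gt_0; lra). rewrite sin_neg in H. lra.
      - assert (0 < sin (phi t)) by (apply sin_gt_0; lra). lra. }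
    rewrite F in U. rewrite <- U, u_int_eq. apply (RInt_point (V := R_CompleteNormedModule)).
  - set (y := phi t). set (s := kappa * sin y).
    assert (Bs : -1 < s < 1) by apply ksin_bound.
    assert (Ec : forall r, Rabs r < Rmin del d2 -> cos (psi r) = sqrt (1 - (kappa * sin (phi r)) * (kappa * sin (phi r)))).
    { intros r Hr. assert (R1 := Rlt_le_trans _ _ _ Hr (Rmin_l _ _)). assert (R2 := Rlt_le_trans _ _ _ Hr (Rmin_r _ _)).
      destruct (He r R1) as [_ Sn]. rewrite <- Sn. pose proof (sin2_cos2 (psi r)) as Q. unfold Rsqr in Q.
      replace (1 - sin (psi r) * sin (psi r)) with (cos (psi r) * cos (psi r)) by lra.
      symmetry. apply sqrt_square. left. now apply Cp. }
    assert (Tm : Rabs t < Rmin del d2) by now apply Rmin_glb_lt.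
    assert (Ps : 0 < 1 - s * s) by nra.
    assert (Dphi : is_derive phi t (/ integrand y)).
    { apply (inverse_derive (u_int kappa) phi t (del - Rabs t)); [lra|apply integrand_pos| | |apply u_int_derive].
      - intros r Hr. apply He. pose proof (Rabs_triang_inv r t). lra.
      - now apply Hc. }
    assert (DH : is_derive (fun y => sqrt (1 - (kappa * sin y) * (kappa * sin y))) y
      (- (s * (kappa * cos y)) / sqrt (1 - s * s))).
    { assert (0 < sqrt (1 - s * s)) by now apply sqrt_lt_R0.
      unfold s, Rminus in *. auto_derive; [exact Ps|]. field. lra. }
    exists (/ integrand y * (- (s * (kappa * cos y)) / sqrt (1 - s * s))). split.
    + apply (is_derive_ext_loc (fun r => sqrt (1 - (kappa * sin (phi r)) * (kappa * sin (phi r))))).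
      * assert (Pd : 0 < Rmin del d2 - Rabs t) by lra.
        exists (mkposreal _ Pd). intros r Hr. symmetry. apply Ec.
        change (Rabs (r - t) < Rmin del d2 - Rabs t) in Hr. pose proof (Rabs_triang_inv r t). lra.
      * exact (is_derive_comp (fun y => sqrt (1 - (kappa * sin y) * (kappa * sin y))) phi t _ _ DH Dphi).
    + rewrite (Ec t Tm). fold y. fold s. set (c := sqrt (1 - s * s)).
      assert (Pc : 0 < c) by now apply sqrt_lt_R0.
      assert (Cc : c * c = 1 - s * s) by (apply sqrt_sqrt; lra).
      unfold integrand. fold s.
      set (p := sqrt (1 + s)). set (q := sqrt (1 - s)).
      assert (Pp : 0 < p) by (apply sqrt_lt_R0; lra). assert (Pq : 0 < q) by (apply sqrt_lt_R0; lra).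
      assert (Ep : p * p = 1 + s) by (apply sqrt_sqrt; lra). assert (Eq : q * q = 1 - s) by (apply sqrt_sqrt; lra).
      assert (Epq : c = p * q).
      { unfold c, p, q. rewrite <- sqrt_mult by lra. f_equal. ring. }
      set (k := kappa * cos y).
      assert (Ek : k * k = kappa ^ 2 - s * s).
      { unfold k, s. pose proof (sin2_cos2 y) as Q. unfold Rsqr in Q.
        replace (kappa ^ 2) with (kappa * kappa * (sin y * sin y + cos y * cos y)) by (rewrite Q; ring). ring. }
      set (l := / ((/ q + / p) / 2) * (- (s * k) / c)).
      (* With p, q the roots of 1 + s and 1 - s, du/dphi is (p+q)/(2pq). Since pq = c, squaring uses
         (p+q)^2 = 2(1+c), and 1 + c cancels against s^2 = (1-c)(1+c). *)
      assert (El : l * (p + q) = - 2 * (s * k)).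
      { unfold l. rewrite Epq. field. repeat split; lra. }
      apply Rmult_eq_reg_r with ((p + q) * (p + q)); [|nra].
      transitivity ((l * (p + q)) * (l * (p + q))); [ring|]. rewrite El.
      replace ((p + q) * (p + q)) with (2 + 2 * c) by (rewrite Epq; lra).
      replace (- 2 * (s * k) * (- 2 * (s * k))) with (4 * ((s * s) * (k * k))) by ring.
      rewrite Ek. replace (s * s) with (1 - c * c) by lra. ring.
Qed.

End RealCurve.

(** * Identification of d *)
Lemma pole_of_order_ext (f g : C -> C) (z : C) (m : nat) (e : R) : 0 < e ->
  (forall w, 0 < Cmod (w - z) < e -> f w = g w) -> pole_of_order f z m -> pole_of_order g z m.
Proof.
  intros He H [Hm [r [Hr [k [Hk [Nk E]]]]]]. split; [exact Hm|].
  exists (Rmin e r). split; [now apply Rmin_glb_lt|]. exists k.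
  split; [eapply holo_on_disc_sub; [apply Rmin_r|exact Hk]|]. split; [exact Nk|].
  intros w Hw Hwz.
  assert (W1 := Rlt_le_trans _ _ _ Hw (Rmin_l _ _)). assert (W2 := Rlt_le_trans _ _ _ Hw (Rmin_r _ _)).
  rewrite <- (H w); [now apply E|]. split; [now apply neq_Cmod_pos|exact W1].
Qed.

(** Shows that [d] is regular at 0, since its values near 0 on the real axis are cosines. *)
Lemma bounded_not_pole (f : C -> C) (P : C -> Prop) (del M : R) : meromorphic_with_poles f P ->
  0 < del -> 0 < M -> (forall t, Rabs t < del -> Cmod (f (RtoC t)) <= M) -> ~ P 0.
Proof.
  intros Hm Hdel HM Hb HP.
  destruct (meromorphic_local_form f P 0 Hm) as [r [m [g [Hr [Hg [E L]]]]]].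
  destruct L as [[Nm [_ Ng]]|[_ [X _]]]; [|tauto].
  assert (D0 : Cmod (0 - 0) < r) by (rewrite Cmod_self; exact Hr).
  destruct (Hg 0 D0) as [l Hl].
  destruct (ccontinuous_neq0 g 0 (cderiv_continuous _ _ _ Hl) Ng) as [d [Hd K]].
  apply Cmod_gt_0 in Ng. set (G := Cmod (g 0)) in *.
  assert (PG : 0 < G / (2 * M)) by (apply Rdiv_lt_0_compat; lra).
  (* As t < 1, the power t^m is at most t, so |f(t)| exceeds (G/2)/t, which is above [M] by the last
     bound. *)
  set (q := Rmin (Rmin del r) (Rmin (Rmin d 1) (G / (2 * M)))). set (t := q / 2).
  assert (Pq : 0 < q) by (unfold q; repeat apply Rmin_glb_lt; lra).
  assert (T : t < del /\ t < r /\ t < d /\ t < 1 /\ t < G / (2 * M)).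
  { assert (A1 : q <= Rmin del r) by apply Rmin_l.
    assert (A2 : q <= Rmin (Rmin d 1) (G / (2 * M))) by apply Rmin_r.
    pose proof (Rmin_l del r). pose proof (Rmin_r del r). pose proof (Rmin_l (Rmin d 1) (G / (2 * M))).
    pose proof (Rmin_r (Rmin d 1) (G / (2 * M))). pose proof (Rmin_l d 1). pose proof (Rmin_r d 1).
    unfold t. repeat split; lra. }
  destruct T as [T1 [T2 [T3 [T4 T5]]]]. assert (Ht : 0 < t) by (unfold t; lra).
  assert (Ct : Cmod (RtoC t - 0) = t).
  { replace (RtoC t - 0)%C with (RtoC t) by ring. rewrite Cmod_R, Rabs_right; lra. }
  destruct (E (RtoC t)) as [_ F]; [rewrite Ct; lra|].
  specialize (K (RtoC t)). rewrite Ct in K. specialize (K T3).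
  specialize (Hb t). rewrite Rabs_right in Hb by lra. specialize (Hb T1).
  assert (Nt : RtoC t <> 0) by (intros Y; apply RtoC_inj in Y; lra).
  assert (Np : ((RtoC t - 0) ^ m)%C <> 0) by now apply Cpow_nz_sub.
  rewrite F, Cmod_div, Cmod_pow, Ct in Hb by exact Np.
  assert (Pm : 0 < t ^ m) by now apply pow_lt.
  apply Rle_div_l in Hb; [|exact Pm].
  assert (t ^ m <= t).
  { destruct m as [|m]; [lia|]. simpl. assert (t ^ m <= 1); [|nra].
    rewrite <- (pow1 m). apply pow_incr. lra. }
  apply Rlt_div_r in T5; [|lra]. nra.
Qed.

Theorem theorem6
  (kappa : R) (Hk0 : 0 < kappa) (Hk1 : kappa < 1)
  (om om' : R) (Hom : 0 < om) (Hom' : 0 < om')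
  (wp : C -> C) (Pwp : C -> Prop)
  (Hwp : weierstrass_p (RtoC (4/3 - kappa ^ 2)) (RtoC (8/27 - kappa ^ 2 / 3)) wp Pwp)
  (Hlat : period_lattice_is wp Pwp om om')
  (d : C -> C) (Pd : C -> Prop)
  (Hd : elliptic d Pd)
  (Hext : exists delta : R, 0 < delta /\
     exists phi psi : R -> R,
       phi 0 = 0 /\ psi 0 = 0 /\
       (forall t, Rabs t < delta -> continuity_pt phi t /\ continuity_pt psi t) /\
       (forall t, Rabs t < delta ->
          u_int kappa (phi t) = t /\
          sin (psi t) = kappa * sin (phi t) /\
          d (RtoC t) = RtoC (cos (psi t)))) :
  let lambda := sqrt (1 - kappa ^ 2) in
  pole_of_order d (Ci * RtoC om')%C 2 /\
  (forall z, Pd z <-> exists m n : Z,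
      z = (Ci * RtoC om' + RtoC (2 * IZR m * om) + Ci * RtoC (2 * IZR n * om'))%C) /\
  value_with_mult d (RtoC om + Ci * RtoC om')%C (RtoC (- lambda)) 2 /\
  value_with_mult d (RtoC om) (RtoC lambda) 2.
Proof.
  intros lambda.
  assert (Hl2 : lambda * lambda = 1 - kappa ^ 2) by (apply sqrt_sqrt; nra).
  assert (Hl0 : 0 < lambda) by (apply sqrt_lt_R0; nra).
  assert (Hl1 : lambda < 1) by nra.
  clearbody lambda.
  destruct Hwp as [Hm [HP0 [Hpole Hode]]].
  set (e1 := (1 / 3 + lambda) / 2). set (e2 := (1 / 3 - lambda) / 2). set (e3 := - (1 / 3)).
  assert (Hsum : e1 + e2 + e3 = 0) by (unfold e1, e2, e3; lra).
  assert (H12 : e2 < e1) by (unfold e1, e2; lra).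
  assert (H23 : e3 < e2) by (unfold e3, e2; lra).
  assert (Eg2 : 4 / 3 - kappa ^ 2 = -4 * (e1 * e2 + e1 * e3 + e2 * e3)) by (unfold e1, e2, e3; nra).
  assert (Eg3 : 8 / 27 - kappa ^ 2 / 3 = 4 * e1 * e2 * e3) by (unfold e1, e2, e3; nra).
  rewrite Eg2, Eg3 in Hode.
  set (g2 := -4 * (e1 * e2 + e1 * e3 + e2 * e3)) in *. set (g3 := 4 * e1 * e2 * e3) in *.
  assert (Hw : weierstrass_ode (RtoC g2) (RtoC g3) wp Pwp) by exact Hode.
  destruct (half_period_values e1 e2 e3 om om' wp Pwp Hsum H12 H23 Hom Hom' Hm HP0 Hw Hlat) as [V1 [V3 V2]].
  assert (PL := pole_iff_lattice e1 e2 e3 om om' wp Pwp Hm HP0 Hw Hlat).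
  assert (Per := wp_period om om' wp Pwp Hlat).
  set (tau := (Ci * RtoC om')%C) in *.
  assert (MV := meromorphic_affine wp Pwp 1 tau one_sqr Hm).
  assert (WV := weierstrass_ode_affine _ _ wp Pwp 1 tau one_sqr Hw).
  (* The target is d = 1/3 - 2 V. The factor [1 *] only matches the form of the affine lemmas. *)
  set (V := fun w => wp (1 * w + tau)%C) in *. set (PV := fun w => Pwp (1 * w + tau)%C) in *.
  assert (NV : exists p, PV p).
  { exists (- tau)%C. unfold PV. replace (1 * - tau + tau)%C with (RtoC 0) by ring. exact HP0. }
  assert (Ft : fst tau = 0 /\ snd tau = om') by (unfold tau; simpl; lra). destruct Ft as [Ft1 Ft2].
  assert (PVL : forall z, PV z <-> in_lattice om om' (z + tau)%C).
  { intros z. unfold PV. replace (1 * z + tau)%C with (z + tau)%C by ring. apply PL. }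
  assert (Fa : forall a b : C, fst (a + b)%C = fst a + fst b /\ snd (a + b)%C = snd a + snd b)
    by (intros; split; reflexivity).
  destruct Hd as [Md _].
  destruct Hext as [del [Hdel [phi [psi [P0 [S0 [Hc He]]]]]]].
  assert (Nd0 : ~ Pd 0).
  { apply (bounded_not_pole d Pd del 1 Md Hdel Rlt_0_1). intros t Ht.
    destruct (He t Ht) as [_ [_ ->]]. rewrite Cmod_R. apply Rabs_le, COS_bound. }
  destruct (cos_psi_ode kappa Hk0 Hk1 phi psi del Hdel P0 S0 Hc) as [dl [[Hdl0 Hdl] Hcos]].
  { intros t Ht. destruct (He t Ht) as [A1 [A2 _]]. now split. }
  assert (Hreal : forall t, Rabs t < dl -> d (RtoC t) = RtoC (cos (psi t))).
  { intros t Ht. apply He. lra. }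
  destruct (proj1 Md 0 Nd0) as [r [Hr K]].
  assert (Hhol : holo_on_disc d 0 r) by (intros w W; now apply K).
  destruct (holo_deriv d 0 r Hr Hhol) as [d1 [Dd Hd1]].
  assert (Cm : forall t, Cmod (RtoC t - 0) = Rabs t).
  { intros t. replace (RtoC t - 0)%C with (RtoC t) by ring. apply Cmod_R. }
  (* The defect of the differential equation: holomorphic near 0 and zero at real points, hence zero
     on a disc. *)
  set (Q := fun w => (d1 w * d1 w - 2 * (1 - d w) * (d w * d w - RtoC (1 - kappa ^ 2)))%C).
  assert (HQ : holo_on_disc Q 0 (r / 3)).
  { intros w W. destruct (Hd1 w W) as [l Hl]. pose proof (Dd w W). change (cderiv d1 w l) in Hl. enough (X : exists l, cderiv Q w l) by exact X. eexists. unfold Q. auto_cderiv. }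
  assert (HQr : forall t, Rabs t < Rmin dl (r / 3) -> Q (RtoC t) = 0).
  { intros t Ht. assert (T1 := Rlt_le_trans _ _ _ Ht (Rmin_l _ _)). assert (T2 := Rlt_le_trans _ _ _ Ht (Rmin_r _ _)).
    destruct (Hcos t T1) as [_ [l [Dl El]]].
    assert (Zt : forall t, (0 + RtoC t * 1)%C = RtoC t) by (intros; ring).
    assert (Dt : cderiv d (0 + RtoC t * 1)%C (d1 (RtoC t))) by (rewrite Zt; apply Dd; now rewrite Cm).
    destruct (cderiv_along_line d 0 1 _ t Dt) as [D1 D2].
    assert (Near : locally t (fun s => d (0 + RtoC s * 1)%C = RtoC (cos (psi s)))).
    { assert (Pp : 0 < dl - Rabs t) by lra. exists (mkposreal _ Pp). intros s Hs.
      change (Rabs (s - t) < dl - Rabs t) in Hs. rewrite Zt. apply Hreal.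
      pose proof (Rabs_triang_inv s t). lra. }
    (* The derivative along the real axis recovers the complex one. Near [t] the restriction of [d]
       is the real function cos psi, so its real part has derivative [l] and its imaginary part has
       derivative 0. *)
    assert (E : d1 (RtoC t) = RtoC l).
    { apply injective_projections.
      - transitivity (fst (1 * d1 (RtoC t))%C); [simpl; ring|]. change (fst (RtoC l)) with l.
        rewrite <- (is_derive_unique _ _ _ Dl). symmetry. apply is_derive_unique.
        apply (is_derive_ext_loc (fun s => fst (d (0 + RtoC s * 1)%C))); [|exact D1].
        revert Near. apply filter_imp. intros s ->. reflexivity.
      - transitivity (snd (1 * d1 (RtoC t))%C); [simpl; ring|].
        rewrite <- (is_derive_unique (fun s => snd (d (0 + RtoC s * 1)%C)) t _ D2).
        rewrite (Derive_ext_loc _ (fun _ => 0)); [apply Derive_const|].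
        revert Near. apply filter_imp. intros s ->. reflexivity. }
    unfold Q. rewrite E, (Hreal t T1).
    assert (E2 : (RtoC l * RtoC l)%C = RtoC (2 * (1 - cos (psi t)) * (cos (psi t) * cos (psi t) - (1 - kappa ^ 2))))
      by (rewrite <- RtoC_mult, El; reflexivity).
    rewrite E2, !RtoC_mult, !RtoC_minus, !RtoC_mult. ring. }
  assert (Q0 : forall w, Cmod (w - 0) < r / 3 / 3 -> Q w = 0).
  { apply (holo_accum Q 0 (r / 3)); [lra|exact HQ|]. intros eps Heps.
    set (m := Rmin eps (Rmin dl (r / 3))). assert (Pm : 0 < m) by (unfold m; repeat apply Rmin_glb_lt; lra).
    assert (M1 : m <= eps) by apply Rmin_l. assert (M2 : m <= Rmin dl (r / 3)) by apply Rmin_r.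
    exists (RtoC (m / 2)). rewrite Cm, Rabs_right by lra. split; [lra|]. apply HQr. rewrite Rabs_right; lra. }
  assert (d00 : d 0 = 1).
  { rewrite (Hreal 0) by (rewrite Rabs_R0; exact Hdl0). now rewrite S0, cos_0. }
  (* This is (1 - d)/2 + e3, with 1/6 = 1/2 - 1/3. At 0, where d = 1, it takes the value e3, as [V]
     does there. *)
  set (D0 := fun w => (RtoC (1 / 6) + RtoC (- (1 / 2)) * d w)%C).
  assert (MD : meromorphic_with_poles D0 Pd).
  { apply meromorphic_affine_post; [|exact Md]. intros X; apply RtoC_inj in X; lra. }
  destruct (is_root_simple e1 e2 e3 Hsum H12 H23 e3 (or_intror (or_intror eq_refl))) as [Root3 Simple3].
  fold g2 in Root3, Simple3. fold g3 in Root3.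
  assert (HVD : forall z, (PV z <-> Pd z) /\ (~ PV z -> V z = D0 z)).
  { apply (weierstrass_ode_eq_of_root (RtoC g2) (RtoC g3) V D0 PV Pd 0 (RtoC e3) MV WV MD); [|exact NV| | |exact Root3|exact Simple3].
    - exists (r / 3 / 3). split; [lra|]. split; [|intros w W; apply K; lra].
      assert (Es : forall w, (D0 w - RtoC e3 = (1 - d w) / 2)%C).
      { intros w. unfold D0, e3. rewrite !RtoC_opp, !RtoC_div by lra. field. }
      split; [|split].
      + rewrite Es, d00. field.
      + intros w W. pose proof (Dd w ltac:(lra)) as Dw. specialize (Q0 w W).
        exists (- d1 w / 2)%C. split.
        * eapply cderiv_eq; [unfold D0; auto_cderiv|]. rewrite RtoC_opp, RtoC_div by lra. field.
        * rewrite Es. unfold Q in Q0. apply Ceq_minus in Q0.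
          transitivity (d1 w * d1 w / 4)%C; [field|]. rewrite Q0.
          unfold cubic_poly, e3. rewrite <- Eg2, RtoC_opp, !RtoC_minus, !RtoC_div by lra. field.
      + intros eps Heps.
        set (m := Rmin eps dl). assert (Pm : 0 < m) by (unfold m; repeat apply Rmin_glb_lt; lra).
        assert (M1 : m <= eps) by apply Rmin_l. assert (M2 : m <= dl) by apply Rmin_r.
        exists (RtoC (m / 2)). rewrite Cm, Rabs_right by lra. split; [lra|]. rewrite Es.
        assert (Ht : Rabs (m / 2) < dl) by (rewrite Rabs_right; lra).
        destruct (Hcos (m / 2) Ht) as [Nc _]. rewrite (Hreal _ Ht).
        intros X. apply Nc; [lra|]. apply (f_equal (fun x => 2 * x)%C) in X.
        assert (Y : (1 - RtoC (cos (psi (m / 2)%R)) = 0)%C).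
        { rewrite <- (Cmult_0_r 2), <- X. field. }
        rewrite <- RtoC_minus in Y. apply RtoC_inj in Y. lra.
    - rewrite PVL. apply (not_in_lattice_snd om om' Hom' _ om'); [lra|]. left. rewrite (proj2 (Fa _ _)), Ft2. simpl. lra.
    - unfold V. replace (1 * 0 + tau)%C with tau by ring. exact V3. }
  assert (dV : forall z, ~ Pd z -> d z = (RtoC (1 / 3) + RtoC (-2) * V z)%C).
  { intros z Hz. destruct (HVD z) as [A1 A2]. rewrite A2 by tauto. unfold D0.
    rewrite !RtoC_opp, !RtoC_div by lra. field. }
  assert (PdL : forall z, Pd z <-> in_lattice om om' (z + tau)%C).
  { intros z. rewrite <- PVL. symmetry. apply HVD. }
  (* The difference d - (1/3 - 2e) is -2 (V - e), and V - e is a branch solution, which vanishes to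
     order exactly two. *)
  assert (Val : forall z0 e, is_root e1 e2 e3 e -> ~ in_lattice om om' (z0 + tau)%C -> wp (z0 + tau)%C = RtoC e ->
    value_with_mult d z0 (RtoC (1 / 3 - 2 * e)) 2).
  { intros z0 e Hie Hz E.
    destruct (is_root_simple e1 e2 e3 Hsum H12 H23 e Hie) as [Root Simple]. fold g2 in Root, Simple. fold g3 in Root.
    rewrite <- PVL in Hz.
    destruct (weierstrass_ode_branch_sol (RtoC g2) (RtoC g3) V PV z0 (RtoC e) MV WV NV Hz) as [rr [Hrr [Sl Np]]]; [|exact Root|].
    { unfold V. replace (1 * z0 + tau)%C with (z0 + tau)%C by ring. exact E. }
    destruct (branch_sol_order _ _ _ _ Simple _ z0 rr Hrr Sl) as [h [Hh [H0 Eh]]].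
    exists rr. split; [exact Hrr|]. exists (fun w => RtoC (-2) * h w)%C. split; [|split].
    - intros w W. destruct (Hh w W) as [l Hlh]. eexists. exact (cderiv_mult _ _ _ _ _ (cderiv_const (RtoC (-2)) w) Hlh).
    - apply Cmult_neq_0; [intros X; apply RtoC_inj in X; lra|].
      intros X. rewrite X in H0. apply Simple. rewrite <- H0. ring.
    - intros w W. rewrite dV by (rewrite <- (proj1 (HVD w)); now apply Np).
      rewrite cpow_Cpow. transitivity (RtoC (-2) * ((w - z0) ^ 2 * h w))%C; [|ring].
      rewrite <- (Eh w W). cbv beta. rewrite RtoC_minus, RtoC_mult. ring. }
  split; [|split; [|split]].
  - assert (Pt : Pd tau).
    { rewrite PdL. exists 0%Z, 1%Z. rewrite (proj1 (Fa _ _)), (proj2 (Fa _ _)), Ft1, Ft2. lra. }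
    destruct (proj2 Md tau Pt) as [_ [rr [Hrr Iso]]].
    (* The shift by +tau in [V] is replaced by -tau using the period 2 tau, which moves the given
       double pole of [wp] from 0 to tau. *)
    apply (pole_of_order_ext (fun w => RtoC (1 / 3) + RtoC (-2) * wp (1 * w + - tau))%C d tau 2 rr Hrr).
    + intros w [W1 W2]. apply Cmod_pos_neq in W1. pose proof (Iso w W2 W1) as Nw. rewrite (dV w Nw).
      unfold V. replace (1 * w + - tau)%C with ((1 * w + tau) + (- (2) * tau))%C by ring.
      assert (L : in_lattice om om' (- (2) * tau)%C) by (exists 0%Z, (-1)%Z; unfold tau; split; simpl; ring).
      rewrite (proj2 (Per _ _ L)); [reflexivity|].
      rewrite <- (proj1 (HVD w)) in Nw. exact Nw.
    + apply (pole_of_order_affine_post (fun w => wp (1 * w + - tau)%C)); [intros X; apply RtoC_inj in X; lra|].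
      apply pole_of_order_affine; [exact one_sqr|]. replace (1 * tau + - tau)%C with (RtoC 0) by ring. exact Hpole.
  - intros z. rewrite PdL. split.
    + intros [m [n [E1 E2]]]. rewrite (proj1 (Fa _ _)), Ft1 in E1. rewrite (proj2 (Fa _ _)), Ft2 in E2.
      (* The index drops by one because z + tau and z - tau differ by the period 2 tau. *)
      exists m, (n - 1)%Z. rewrite minus_IZR. unfold tau. apply injective_projections; simpl; lra.
    + intros [m [n ->]]. exists m, (n + 1)%Z. rewrite plus_IZR. unfold tau. split; simpl; ring.
  - replace (- lambda) with (1 / 3 - 2 * e1) by (unfold e1; lra).
    assert (L1 : ~ in_lattice om om' (RtoC om)) by (apply (not_in_lattice_fst om om' Hom _ om); [lra|left; reflexivity]).
    assert (L2 : in_lattice om om' (2 * tau)%C) by (exists 0%Z, 1%Z; unfold tau; split; simpl; ring).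
    (* The argument of [wp] is om + 2 tau, congruent to om, so the value is e1 and 1/3 - 2 e1 =
       -lambda. *)
    assert (Ez : (RtoC om + tau + tau = RtoC om + 2 * tau)%C) by ring.
    apply Val; [left; reflexivity| |].
    + rewrite Ez, <- PL, <- (proj1 (Per (RtoC om) _ L2)), PL. exact L1.
    + rewrite Ez, (proj2 (Per (RtoC om) _ L2)); [exact V1|]. now rewrite PL.
  - replace lambda with (1 / 3 - 2 * e2) by (unfold e2; lra).
    apply Val; [right; left; reflexivity| |exact V2].
    apply (not_in_lattice_fst om om' Hom _ om); [lra|]. left. rewrite (proj1 (Fa _ _)), Ft1. simpl. lra.
Qed.
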